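(* Let $\Omega\subset\mathbb{R}^2$ be a simply connected open set, let $n\ge 2$, and let $f:\Omega\to\mathbb{R}^3$ be a $C^n(\Omega)$-immersion, with induced $C^{n-1}(\Omega)$-metric $f^*ds^2_{\mathbb{R}^3}$, whose Gauss curvature satisfies $K\equiv -1$ on $\Omega$. Then there exists a $C^2(\Omega)$ isometry $\phi:(\Omega,f^*ds^2_{\mathbb{R}^3})\to(\mathbb{H}^2,ds^2_{\mathbb{H}^2})$.
   Context: A map is of class $C^k(\Omega)$ if all its derivatives up to order $k$ exist and are continuous ($k=\infty$: infinitely differentiable; $k=\omega$: analytic). A $C^n(\Omega)$ map $f:\Omega\to\mathbb{R}^3$, $n\ge1$, is an immersion if $\mathrm{rank}(df)\equiv 2$. $ds^2_{\mathbb{R}^3}$ is the standard metric on $\mathbb{R}^3$, and $f^*ds^2_{\mathbb{R}^3}$ is its pullback to $\Omega$. $(\mathbb{H}^2,ds^2_{\mathbb{H}^2})$ is the hyperbolic plane with its standard metric of constant curvature $-1$. For a $C^2$-immersion $f$ with coordinates $(x,y)$ and unit normal $N=\frac{f_x\times f_y}{|f_x\times f_y|}$, the Gauss curvature is the continuous function $$K=\frac{\langle N_x,f_x\rangle\langle N_y,f_y\rangle-\langle N_x,f_y\rangle\langle N_y,f_x\rangle}{\langle f_x,f_x\rangle\langle f_y,f_y\rangle-\langle f_x,f_y\rangle^2}.$$ Isometry: if $\Omega_1$ has a metric $g_1$ and $\Omega_2$ has a metric $g_2$, a $C^1(\Omega_1)$-immersion $\phi:(\Omega_1,g_1)\to(\Omega_2,g_2)$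 is called an isometry if $\phi^*(g_2)=g_1$. Neither injectivity nor surjectivity is required. *)

(* Defs.v *)
From Stdlib Require Import Reals.
From Coquelicot Require Import Coquelicot.
Open Scope R_scope.

Definition R2 : Type := (R * R)%type.
Definition R3 : Type := (R * R * R)%type.

Definition c1 (v : R3) : R := fst (fst v).
Definition c2 (v : R3) : R := snd (fst v).
Definition c3 (v : R3) : R := snd v.

Definition dot (v w : R3) : R := c1 v * c1 w + c2 v * c2 w + c3 v * c3 w.

Definition cross (v w : R3) : R3 :=
  (c2 v * c3 w - c3 v * c2 w,
   c3 v * c1 w - c1 v * c3 w,
   c1 v * c2 w - c2 v * c1 w).

Definition norm3 (v : R3) : R := sqrt (dot v v).

Definition smul3 (a : R) (v : R3) : R3 := (a * c1 v, a * c2 v, a * c3 v).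

(** Simple connectedness: path-connected, and every loop contracts to its base
    point through loops with that base point. *)

Definition unit_interval (t : R) : Prop := 0 <= t <= 1.
Definition unit_square (q : R2) : Prop :=
  unit_interval (fst q) /\ unit_interval (snd q).

Definition path_in (Omega : R2 -> Prop) (gamma : R -> R2) (p q : R2) : Prop :=
  continuous_on unit_interval gamma /\
  (forall t, unit_interval t -> Omega (gamma t)) /\
  gamma 0 = p /\ gamma 1 = q.

Definition null_homotopic (Omega : R2 -> Prop) (gamma : R -> R2) (p : R2) : Prop :=
  exists H : R2 -> R2,
    continuous_on unit_square H /\
    (forall q, unit_square q -> Omega (H q)) /\
    (forall t, unit_interval t -> H (0, t) = gamma t) /\
    (forall t, unit_interval t -> H (1, t) = p) /\
    (forall s, unit_interval s -> H (s, 0) = p /\ H (s, 1) = p).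

Definition simply_connected (Omega : R2 -> Prop) : Prop :=
  (forall p q, Omega p -> Omega q -> exists gamma, path_in Omega gamma p q) /\
  (forall p gamma, path_in Omega gamma p p -> null_homotopic Omega gamma p).

(** Maps on an open set [Omega] are total functions whose values outside [Omega]
    are irrelevant: everything below depends only on the germs at points of
    [Omega]. [ex_diff_n g k x y] says that all iterated partial derivatives of
    [g] of order at most [k] exist and are continuous at [(x, y)]. *)

Definition Ck (k : nat) (Omega : R2 -> Prop) (g : R2 -> R) : Prop :=
  forall x y, Omega (x, y) -> ex_diff_n (fun u v => g (u, v)) k x y.

Definition Ck_R2 (k : nat) (Omega : R2 -> Prop) (phi : R2 -> R2) : Prop :=
  Ck k Omega (fun p => fst (phi p)) /\ Ck k Omega (fun p => snd (phi p)).

Definition Ck_R3 (k : nat) (Omega : R2 -> Prop) (f : R2 -> R3) : Prop :=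
  Ck k Omega (fun p => c1 (f p)) /\
  Ck k Omega (fun p => c2 (f p)) /\
  Ck k Omega (fun p => c3 (f p)).

Definition dx (g : R2 -> R) (p : R2) : R := Derive (fun t => g (t, snd p)) (fst p).
Definition dy (g : R2 -> R) (p : R2) : R := Derive (fun t => g (fst p, t)) (snd p).

Definition dx3 (f : R2 -> R3) (p : R2) : R3 :=
  (dx (fun q => c1 (f q)) p, dx (fun q => c2 (f q)) p, dx (fun q => c3 (f q)) p).
Definition dy3 (f : R2 -> R3) (p : R2) : R3 :=
  (dy (fun q => c1 (f q)) p, dy (fun q => c2 (f q)) p, dy (fun q => c3 (f q)) p).

Definition diff_R (g : R2 -> R) (p v : R2) : R := fst v * dx g p + snd v * dy g p.

Definition diff_R2 (phi : R2 -> R2) (p v : R2) : R2 :=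
  (diff_R (fun q => fst (phi q)) p v, diff_R (fun q => snd (phi q)) p v).

Definition diff_R3 (f : R2 -> R3) (p v : R2) : R3 :=
  (diff_R (fun q => c1 (f q)) p v,
   diff_R (fun q => c2 (f q)) p v,
   diff_R (fun q => c3 (f q)) p v).

(** The image of the linear map [L] has dimension two. *)
Definition rank_two {V : ModuleSpace R_Ring} (L : R2 -> V) : Prop :=
  exists e1 e2 : V,
    (forall a b : R, plus (scal a e1) (scal b e2) = zero -> a = 0 /\ b = 0) /\
    (forall w : V, (exists v : R2, w = L v) <->
                   (exists a b : R, w = plus (scal a e1) (scal b e2))).

Definition immersion_R2 (k : nat) (Omega : R2 -> Prop) (phi : R2 -> R2) : Prop :=
  Ck_R2 k Omega phi /\ forall p, Omega p -> rank_two (diff_R2 phi p).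

Definition immersion_R3 (k : nat) (Omega : R2 -> Prop) (f : R2 -> R3) : Prop :=
  Ck_R3 k Omega f /\ forall p, Omega p -> rank_two (diff_R3 f p).

(** [g p v w] is the inner product of the tangent vectors [v] and [w] at [p]. *)
Definition metric (V : Type) : Type := V -> V -> V -> R.

Definition euclidean_metric : metric R3 := fun _ v w => dot v w.

Definition pullback_R2 (phi : R2 -> R2) (g : metric R2) : metric R2 :=
  fun p v w => g (phi p) (diff_R2 phi p v) (diff_R2 phi p w).

Definition pullback_R3 (f : R2 -> R3) (g : metric R3) : metric R2 :=
  fun p v w => g (f p) (diff_R3 f p v) (diff_R3 f p w).

(** The hyperbolic plane, in the upper half-plane model:
    metric [(dx^2 + dy^2) / y^2] on [y > 0]. *)
Definition H2 (p : R2) : Prop := 0 < snd p.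

Definition H2_metric : metric R2 :=
  fun p v w => (fst v * fst w + snd v * snd w) / (snd p) ^ 2.

Definition unit_normal (f : R2 -> R3) (p : R2) : R3 :=
  let n := cross (dx3 f p) (dy3 f p) in smul3 (/ norm3 n) n.

Definition gauss_curvature (f : R2 -> R3) (p : R2) : R :=
  let fx := dx3 f p in
  let fy := dy3 f p in
  let Nx := dx3 (unit_normal f) p in
  let Ny := dy3 (unit_normal f) p in
  (dot Nx fx * dot Ny fy - dot Nx fy * dot Ny fx) /
  (dot fx fx * dot fy fy - dot fx fy ^ 2).

(** Neither injectivity nor surjectivity is required of an isometry. *)
Definition isometry (Omega1 : R2 -> Prop) (g1 : metric R2)
    (Omega2 : R2 -> Prop) (g2 : metric R2) (phi : R2 -> R2) : Prop :=
  (forall p, Omega1 p -> Omega2 (phi p)) /\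
  immersion_R2 1 Omega1 phi /\
  (forall p, Omega1 p -> forall v w, pullback_R2 phi g2 p v w = g1 p v w).

(* Main.v *)
From Stdlib Require Import Reals Lra Lia ClassicalChoice.
From Corelib Require Import ssreflect.
From Coquelicot Require Import Coquelicot.
Require Import Defs.
Open Scope R_scope.

(** An orthonormal frame [e1], [e2], [N] adapted to the surface is only of class C1 when [f] is of
    class C2. Write [df = w1 e1 + w2 e2], with forms [w1], [w2] of class C1, and let
    [w12 = <de1, e2>] be the connection form, which is merely continuous. The equations
    [dw1 = w12 /\ w2] and [dw2 = - w12 /\ w1] hold classically. Curvature -1 means
    [dw12 = w1 /\ w2], but this equation only makes sense in integrated form; it is proved that way
    (lemma [moving_frame]) from a Green formula for forms [h dg] with [g] and [h] of class C1
    ([green_derivative]).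

    These three equations say that the connection with matrix
    [[
      1/2 *  |    w2     w1 + w12 |
             | w1 - w12    - w2   |
    ]]
    is flat. If [F] is a solution of [dF = F A] with values in the unimodular matrices, let
    [phi = F . i] be the image of the point [i] of the upper half-plane under the homography [F].
    Then [d phi = (w1 + i w2) / (C i + D)^2], where [(C, D)] is the second row of [F], whereas
    [Im phi = 1 / (C^2 + D^2)]. Hence [phi] pulls the hyperbolic metric back to [w1^2 + w2^2], which
    is the induced metric. The connection form has dropped out of [d phi], so that [d phi] is of
    class C1 and [phi] of class C2 ([developing_partials]).

    It remains to find [F]. Locally the frame can be rotated by an angle [psi] that makes the
    connection form continuously differentiable: the integrated curvature equation says exactly
    that [w12] differs by an exact form from an explicit primitive of the area form
    ([rotation_angle]). After this rotation the system has coefficients of class C1, and cross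
    differentiation turns it into a Goursat problem, solved by a fixed point argument on a small
    square ([flat_system_solvable]). Solutions on overlapping squares are compared by means of
    their Wronskian, which is constant, and simple connectedness of the domain glues them together
    ([monodromy]). *)

(** * Functions of class C1 in two variables *)

Definition partials (g : R2 -> R) (p : R2) (a b : R) : Prop :=
  is_derive (fun t => g (t, snd p)) (fst p) a /\
  is_derive (fun t => g (fst p, t)) (snd p) b.

Definition C1_on (U : R2 -> Prop) (g : R2 -> R) : Prop :=
  forall p, U p -> partials g p (dx g p) (dy g p) /\
                   continuous (dx g) p /\ continuous (dy g) p.

Lemma partials_dx g p a b : partials g p a b -> dx g p = a.
Proof. intros [H _]. now apply is_derive_unique. Qed.

Lemma partials_dy g p a b : partials g p a b -> dy g p = b.
Proof. intros [_ H]. now apply is_derive_unique. Qed.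

Lemma partials_eq g p a b a' b' :
  partials g p a b -> a = a' -> b = b' -> partials g p a' b'.
Proof. now intros H <- <-. Qed.

Lemma locally_imp (p : R2) (P Q : R2 -> Prop) :
  (forall q, P q -> Q q) -> locally p P -> locally p Q.
Proof. apply: filter_imp. Qed.

Lemma locally_section_x (P : R2 -> Prop) (p : R2) :
  locally p P -> locally (fst p) (fun t => P (t, snd p)).
Proof.
  intros [e He]. exists e. intros t Ht. apply He. split; [exact Ht | apply ball_center].
Qed.

Lemma locally_section_y (P : R2 -> Prop) (p : R2) :
  locally p P -> locally (snd p) (fun t => P (fst p, t)).
Proof.
  intros [e He]. exists e. intros t Ht. apply He. split; [apply ball_center | exact Ht].
Qed.

Lemma partials_ext_loc g h p a b :
  locally p (fun q => g q = h q) -> partials g p a b -> partials h p a b.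
Proof.
  intros E [H1 H2]; split.
  - now apply (is_derive_ext_loc _ _ _ _ (locally_section_x _ _ E)).
  - now apply (is_derive_ext_loc _ _ _ _ (locally_section_y _ _ E)).
Qed.

Lemma partials_const c p : partials (fun _ => c) p 0 0.
Proof. split; apply @is_derive_const. Qed.

Lemma partials_plus g h p a b a' b' :
  partials g p a b -> partials h p a' b' ->
  partials (fun q => g q + h q) p (a + a') (b + b').
Proof. intros [] []; split; now apply: is_derive_plus. Qed.

Lemma partials_minus g h p a b a' b' :
  partials g p a b -> partials h p a' b' ->
  partials (fun q => g q - h q) p (a - a') (b - b').
Proof. intros [] []; split; now apply: is_derive_minus. Qed.

Lemma partials_mult g h p a b a' b' :
  partials g p a b -> partials h p a' b' ->
  partials (fun q => g q * h q) p (a * h p + g p * a') (b * h p + g p * b').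
Proof.
  destruct p as [x y].
  intros [] []; split; apply: is_derive_mult => //; intros; apply Rmult_comm.
Qed.

Lemma partials_comp (u : R -> R) g p a b d :
  is_derive u (g p) d -> partials g p a b ->
  partials (fun q => u (g q)) p (a * d) (b * d).
Proof.
  destruct p as [x y].
  intros Hu []; split; now apply: (is_derive_comp u).
Qed.

Lemma C1_intro (U : R2 -> Prop) (g gx gy : R2 -> R) :
  open U ->
  (forall p, U p -> partials g p (gx p) (gy p)) ->
  (forall p, U p -> continuous gx p) ->
  (forall p, U p -> continuous gy p) -> C1_on U g.
Proof.
  intros HU H Cx Cy p Hp.
  assert (L : locally p U) by now apply HU.
  split; [|split].
  - rewrite (partials_dx _ _ _ _ (H p Hp)) (partials_dy _ _ _ _ (H p Hp)). now apply H.
  - apply continuous_ext_loc with gx; [|now apply Cx].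
    apply: locally_imp L => q Hq. symmetry. exact (partials_dx _ _ _ _ (H q Hq)).
  - apply continuous_ext_loc with gy; [|now apply Cy].
    apply: locally_imp L => q Hq. symmetry. exact (partials_dy _ _ _ _ (H q Hq)).
Qed.

Lemma C1_partials (U : R2 -> Prop) g p : C1_on U g -> U p -> partials g p (dx g p) (dy g p).
Proof. intros H Hp. exact (proj1 (H p Hp)). Qed.

Lemma C1_continuous_dx (U : R2 -> Prop) g p : C1_on U g -> U p -> continuous (dx g) p.
Proof. intros H Hp. exact (proj1 (proj2 (H p Hp))). Qed.

Lemma C1_continuous_dy (U : R2 -> Prop) g p : C1_on U g -> U p -> continuous (dy g) p.
Proof. intros H Hp. exact (proj2 (proj2 (H p Hp))). Qed.

Lemma continuous_eps {T : UniformSpace} (g : T -> R) (p : T) :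
  continuous g p <-> forall eps : posreal, locally p (fun q => Rabs (g q - g p) < eps).
Proof. apply: filterlim_locally. Qed.

Lemma mvt_abs_bound (g dg : R -> R) (a b M : R) :
  (forall t, Rmin a b <= t <= Rmax a b -> is_derive g t (dg t)) ->
  (forall t, Rmin a b <= t <= Rmax a b -> Rabs (dg t) <= M) ->
  Rabs (g b - g a) <= M * Rabs (b - a).
Proof.
  intros Hd HM.
  destruct (MVT_gen g a b dg) as [c [Hc ->]].
  - intros x Hx. apply Hd. lra.
  - intros x Hx. apply derivable_continuous_pt. exists (dg x).
    now apply is_derive_Reals, Hd.
  - rewrite Rabs_mult. apply Rmult_le_compat_r; [apply Rabs_pos | now apply HM].
Qed.

Lemma between_abs (a b t : R) : Rmin a b <= t <= Rmax a b -> Rabs (t - a) <= Rabs (b - a).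
Proof.
  unfold Rmin, Rmax; destruct Rle_dec as [h|h]; intros [h1 h2].
  - rewrite !Rabs_pos_eq; lra.
  - rewrite !Rabs_left1; lra.
Qed.

Lemma ball_R2 (p q : R2) (e : R) :
  ball p e q <-> Rabs (fst q - fst p) < e /\ Rabs (snd q - snd p) < e.
Proof. reflexivity. Qed.

(** A function with continuous partial derivatives is continuous: the partial derivatives are
    locally bounded, so that the mean value theorem controls one variable uniformly in the
    other. *)
Lemma C1_continuous (U : R2 -> Prop) (g : R2 -> R) p :
  open U -> C1_on U g -> U p -> continuous g p.
Proof.
  intros HU HC Hp.
  assert (Cy : continuous (fun q : R2 => g (fst p, snd q)) p).
  { apply (continuous_comp (fun q : R2 => snd q) (fun t => g (fst p, t))).
    - apply continuous_snd.
    - apply: ex_derive_continuous. exists (dy g p). exact (proj2 (C1_partials U g p HC Hp)). }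
  assert (B : locally p (fun q => Rabs (dx g q - dx g p) < mkposreal 1 Rlt_0_1)).
  { apply (proj1 (continuous_eps (dx g) p)). exact (C1_continuous_dx U g p HC Hp). }
  destruct (filter_and _ _ B (HU _ Hp)) as [e He].
  set (M := Rabs (dx g p) + 1).
  assert (HM : 0 < M) by (unfold M; assert (h := Rabs_pos (dx g p)); lra).
  apply continuous_eps. intros eps.
  assert (Cy' := proj1 (continuous_eps _ _) Cy (pos_div_2 eps)).
  assert (Hd : 0 < eps / 2 / M) by (apply Rdiv_lt_0_compat; [apply (cond_pos (pos_div_2 eps)) | lra]).
  assert (L := filter_and _ _ Cy' (filter_and _ _ (locally_ball p e)
    (locally_ball p (mkposreal _ Hd)))).
  apply: locally_imp L => q [H1 [H2 H3]]. simpl in H1.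
  
  destruct (proj1 (ball_R2 p q e) H2) as [Hx Hy].
  destruct (proj1 (ball_R2 p q _) H3) as [H3x _]. simpl in H3x.
  clear H2 H3.
  assert (K : Rabs (g q - g (fst p, snd q)) <= M * Rabs (fst q - fst p)).
  { destruct q as [u v]; simpl in *.
    apply (mvt_abs_bound (fun t => g (t, v)) (fun t => dx g (t, v))).
    - intros t Ht. refine (proj1 (C1_partials U g (t, v) HC _)). apply He. apply ball_R2; simpl. apply between_abs in Ht. split; lra.
    - intros t Ht. assert (D : Rabs (dx g (t, v) - dx g p) < 1).
      { apply He. apply ball_R2; simpl. apply between_abs in Ht. split; lra. }
      unfold M. assert (T := Rabs_triang (dx g (t, v) - dx g p) (dx g p)).
      replace (dx g (t, v) - dx g p + dx g p) with (dx g (t, v)) in T by ring. lra. }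
  assert (K2 : M * Rabs (fst q - fst p) <= eps / 2).
  { replace (pos eps / 2) with (M * (eps / 2 / M)) by (field; lra).
    apply Rmult_le_compat_l; lra. }
  replace (g q - g p) with ((g q - g (fst p, snd q)) + (g (fst p, snd q) - g p)) by ring.
  eapply Rle_lt_trans; [apply Rabs_triang|].
  destruct p; simpl in *. lra.
Qed.

(* Keeps unification from expanding derivatives. *)
#[local] Opaque dx dy.

Ltac c1_cont U := intros;
  lazymatch goal with
  | |- continuous (dx _) _ => solve [apply (C1_continuous_dx U); auto]
  | |- continuous (dy _) _ => solve [apply (C1_continuous_dy U); auto]
  | |- continuous (fun q => dx _ q) _ => solve [apply (C1_continuous_dx U); auto]
  | |- continuous (fun q => dy _ q) _ => solve [apply (C1_continuous_dy U); auto]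
  | |- continuous _ _ => solve [apply (C1_continuous U); auto]
  end.

Section C1Closure.
Variable U : R2 -> Prop.
Hypothesis HU : open U.

Lemma C1_ext g h : (forall p, U p -> g p = h p) -> C1_on U g -> C1_on U h.
Proof.
  intros E H. apply C1_intro with (dx g) (dy g); auto; [|intros; now apply (C1_continuous_dx U)|intros; now apply (C1_continuous_dy U)].
  intros p Hp. apply partials_ext_loc with g; [|now apply (C1_partials U)].
  apply: locally_imp (HU p Hp) => q. apply E.
Qed.

Lemma C1_const c : C1_on U (fun _ => c).
Proof.
  apply C1_intro with (fun _ => 0) (fun _ => 0); auto; intros.
  - apply partials_const.
  - apply continuous_const.
  - apply continuous_const.
Qed.

Lemma C1_plus g h : C1_on U g -> C1_on U h -> C1_on U (fun q => g q + h q).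
Proof.
  intros Hg Hh.
  apply C1_intro with (fun q => dx g q + dx h q) (fun q => dy g q + dy h q); auto; intros p Hp.
  - apply partials_plus; now apply (C1_partials U).
  - apply: continuous_plus; c1_cont U.
  - apply: continuous_plus; c1_cont U.
Qed.

Lemma C1_mult g h : C1_on U g -> C1_on U h -> C1_on U (fun q => g q * h q).
Proof.
  intros Hg Hh.
  apply C1_intro with (fun q => dx g q * h q + g q * dx h q)
                      (fun q => dy g q * h q + g q * dy h q); auto; intros p Hp.
  - apply partials_mult; now apply (C1_partials U).
  - apply: continuous_plus; apply: continuous_mult;
      c1_cont U.
  - apply: continuous_plus; apply: continuous_mult;
      c1_cont U.
Qed.

Lemma C1_comp (u du : R -> R) g :
  (forall p, U p -> is_derive u (g p) (du (g p)) /\ continuous du (g p)) ->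
  C1_on U g -> C1_on U (fun q => u (g q)).
Proof.
  intros Hu Hg.
  apply C1_intro with (fun q => dx g q * du (g q)) (fun q => dy g q * du (g q)); auto; intros p Hp.
  - apply partials_comp; [now apply Hu | now apply (C1_partials U)].
  - apply: continuous_mult; [c1_cont U|].
    apply continuous_comp; [now apply (C1_continuous U) | now apply Hu].
  - apply: continuous_mult; [c1_cont U|].
    apply continuous_comp; [now apply (C1_continuous U) | now apply Hu].
Qed.

Lemma C1_opp g : C1_on U g -> C1_on U (fun q => - g q).
Proof.
  intros Hg. apply C1_ext with (fun q => -1 * g q).
  - intros; ring.
  - apply C1_mult; [apply C1_const | exact Hg].
Qed.

Lemma C1_minus g h : C1_on U g -> C1_on U h -> C1_on U (fun q => g q - h q).
Proof. intros Hg Hh. apply C1_plus; [exact Hg | now apply C1_opp]. Qed.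

Lemma C1_inv g : (forall p, U p -> g p <> 0) -> C1_on U g -> C1_on U (fun q => / g q).
Proof.
  intros Hn Hg. apply (C1_comp Rinv (fun t => - / t ^ 2)); [|exact Hg].
  intros p Hp. specialize (Hn p Hp). split.
  - auto_derive; [exact Hn|]. field. exact Hn.
  - apply: continuous_opp. apply continuous_comp; [|apply: continuous_Rinv].
    + apply: ex_derive_continuous. auto_derive. auto.
    + now apply pow_nonzero.
Qed.

Lemma C1_sqrt g : (forall p, U p -> 0 < g p) -> C1_on U g -> C1_on U (fun q => sqrt (g q)).
Proof.
  intros Hn Hg. apply (C1_comp sqrt (fun t => / (2 * sqrt t))); [|exact Hg].
  intros p Hp. specialize (Hn p Hp). split.
  - auto_derive; [exact Hn|]. field. apply Rgt_not_eq. now apply sqrt_lt_R0.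
  - assert (0 < sqrt (g p)) by now apply sqrt_lt_R0.
    apply: ex_derive_continuous. auto_derive. split; [exact Hn | split; [lra | auto]].
Qed.

Lemma dx_mult g h p : C1_on U g -> C1_on U h -> U p ->
  dx (fun q => g q * h q) p = dx g p * h p + g p * dx h p.
Proof.
  intros Hg Hh Hp. eapply partials_dx.
  apply partials_mult; [apply (C1_partials U _ _ Hg Hp) | apply (C1_partials U _ _ Hh Hp)].
Qed.

Lemma dy_mult g h p : C1_on U g -> C1_on U h -> U p ->
  dy (fun q => g q * h q) p = dy g p * h p + g p * dy h p.
Proof.
  intros Hg Hh Hp. eapply partials_dy.
  apply partials_mult; [apply (C1_partials U _ _ Hg Hp) | apply (C1_partials U _ _ Hh Hp)].
Qed.

Lemma dx_plus g h p : C1_on U g -> C1_on U h -> U p ->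
  dx (fun q => g q + h q) p = dx g p + dx h p.
Proof.
  intros Hg Hh Hp. eapply partials_dx.
  apply partials_plus; [apply (C1_partials U _ _ Hg Hp) | apply (C1_partials U _ _ Hh Hp)].
Qed.

Lemma dy_plus g h p : C1_on U g -> C1_on U h -> U p ->
  dy (fun q => g q + h q) p = dy g p + dy h p.
Proof.
  intros Hg Hh Hp. eapply partials_dy.
  apply partials_plus; [apply (C1_partials U _ _ Hg Hp) | apply (C1_partials U _ _ Hh Hp)].
Qed.

End C1Closure.

(** * Functions of class Ck and vector-valued functions *)

Lemma continuity_2d_continuous (g : R2 -> R) (x y : R) :
  continuity_2d_pt (fun u v => g (u, v)) x y <-> continuous g (x, y).
Proof.
  rewrite continuity_2d_pt_filterlim. split; intros H.
  - apply: (filterlim_ext _ _ _ H). now intros [u v].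
  - apply: (filterlim_ext g _ _ H). now intros [u v].
Qed.

Lemma ex_diff_n_le (m n : nat) (g : R -> R -> R) x y :
  (m <= n)%nat -> ex_diff_n g n x y -> ex_diff_n g m x y.
Proof.
  revert m g; induction n as [|n IH]; intros [|m] g Hmn; try lia; simpl.
  - auto.
  - intros [H _]; auto.
  - intros [H1 [H2 [H3 [H4 H5]]]]. repeat split; auto; apply IH; auto; lia.
Qed.

Section Regularity.
Variable U : R2 -> Prop.
Hypothesis HU : open U.

Lemma Ck_le m n g : (m <= n)%nat -> Ck n U g -> Ck m U g.
Proof. intros Hmn H x y Hp. eapply ex_diff_n_le; [exact Hmn | now apply H]. Qed.

Lemma Ck_continuous n g p : Ck n U g -> U p -> continuous g p.
Proof.
  intros H Hp. destruct p as [x y]. apply continuity_2d_continuous.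
  assert (h := H x y Hp). destruct n; apply h.
Qed.

Lemma Ck_dx n g : Ck (S n) U g -> Ck n U (dx g).
Proof. intros H x y Hp. assert (h := H x y Hp). apply h. Qed.

Lemma Ck_dy n g : Ck (S n) U g -> Ck n U (dy g).
Proof. intros H x y Hp. assert (h := H x y Hp). apply h. Qed.

Lemma Ck_C1 n g : Ck (S n) U g -> C1_on U g.
Proof.
  intros H p Hp. split; [split|split].
  - destruct p as [x y]. apply Derive_correct. assert (h := H x y Hp). apply h.
  - destruct p as [x y]. apply Derive_correct. assert (h := H x y Hp). apply h.
  - apply Ck_continuous with n; [now apply Ck_dx | exact Hp].
  - apply Ck_continuous with n; [now apply Ck_dy | exact Hp].
Qed.

Lemma Ck_0_intro g : (forall p, U p -> continuous g p) -> Ck 0 U g.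
Proof. intros H x y Hp. split; [|exact I]. apply continuity_2d_continuous. now apply H. Qed.

Lemma Ck_S_intro n g : C1_on U g -> Ck n U (dx g) -> Ck n U (dy g) -> Ck (S n) U g.
Proof.
  intros H Hx Hy x y Hp. simpl. split; [|split; [|split; [|split]]].
  - apply continuity_2d_continuous. now apply (C1_continuous U).
  - exists (dx g (x, y)). apply (proj1 (C1_partials U g (x, y) H Hp)).
  - exists (dy g (x, y)). apply (proj2 (C1_partials U g (x, y) H Hp)).
  - now apply Hx.
  - now apply Hy.
Qed.

Lemma C1_Ck g : C1_on U g -> Ck 1 U g.
Proof.
  intros H. apply Ck_S_intro; [exact H| |]; apply Ck_0_intro; intros p Hp.
  - now apply (C1_continuous_dx U).
  - now apply (C1_continuous_dy U).
Qed.

#[local] Transparent dx dy.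

Lemma Ck_2_mixed_partials g p : Ck 2 U g -> U p -> dx (dy g) p = dy (dx g) p.
Proof.
  intros H Hp. destruct p as [x y].
  assert (Cx := Ck_C1 _ _ (Ck_dx _ _ H)). assert (Cy := Ck_C1 _ _ (Ck_dy _ _ H)).
  assert (C := Ck_C1 _ _ H).
  apply (Schwarz (fun u v => g (u, v)) x y).
  - apply locally_2d_locally. apply: locally_imp (HU _ Hp) => -[u v] Huv /=.
    split; [|split; [|split]].
    + eexists. apply (proj1 (C1_partials U g (u, v) C Huv)).
    + eexists. apply (proj2 (C1_partials U g (u, v) C Huv)).
    + eexists. apply (proj1 (C1_partials U (dy g) (u, v) Cy Huv)).
    + eexists. apply (proj2 (C1_partials U (dx g) (u, v) Cx Huv)).
  - apply (proj2 (continuity_2d_continuous (dx (dy g)) x y)). now apply (C1_continuous_dx U).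
  - apply (proj2 (continuity_2d_continuous (dy (dx g)) x y)). now apply (C1_continuous_dy U).
Qed.

#[local] Opaque dx dy.

Definition C1v (v : R2 -> R3) : Prop :=
  C1_on U (fun p => c1 (v p)) /\ C1_on U (fun p => c2 (v p)) /\ C1_on U (fun p => c3 (v p)).

Lemma C1_dot v w : C1v v -> C1v w -> C1_on U (fun p => dot (v p) (w p)).
Proof.
  intros (v1 & v2 & v3) (w1 & w2 & w3). unfold dot.
  repeat apply C1_plus; auto; now apply C1_mult.
Qed.

Lemma C1v_cross v w : C1v v -> C1v w -> C1v (fun p => cross (v p) (w p)).
Proof.
  intros (v1 & v2 & v3) (w1 & w2 & w3). unfold cross.
  split; [|split]; apply C1_minus; auto; now apply C1_mult.
Qed.

Lemma C1v_smul a v : C1_on U a -> C1v v -> C1v (fun p => smul3 (a p) (v p)).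
Proof.
  intros Ha (v1 & v2 & v3). split; [|split]; now apply C1_mult.
Qed.

Lemma dx_dot v w p : C1v v -> C1v w -> U p ->
  dx (fun q => dot (v q) (w q)) p = dot (dx3 v p) (w p) + dot (v p) (dx3 w p).
Proof.
  intros (v1 & v2 & v3) (w1 & w2 & w3) Hp. unfold dot.
  rewrite (dx_plus U); [rewrite (dx_plus U); [rewrite !(dx_mult U); auto|..]|..];
    auto; repeat apply C1_plus; auto; try (apply C1_mult; auto).
  unfold dx3, c1, c2, c3; simpl. ring.
Qed.

Lemma dy_dot v w p : C1v v -> C1v w -> U p ->
  dy (fun q => dot (v q) (w q)) p = dot (dy3 v p) (w p) + dot (v p) (dy3 w p).
Proof.
  intros (v1 & v2 & v3) (w1 & w2 & w3) Hp. unfold dot.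
  rewrite (dy_plus U); [rewrite (dy_plus U); [rewrite !(dy_mult U); auto|..]|..];
    auto; repeat apply C1_plus; auto; try (apply C1_mult; auto).
  unfold dy3, c1, c2, c3; simpl. ring.
Qed.

End Regularity.

Definition orthonormal (e1 e2 n : R3) : Prop :=
  dot e1 e1 = 1 /\ dot n n = 1 /\ dot n e1 = 0 /\ e2 = cross n e1.

Lemma dot_comm v w : dot v w = dot w v.
Proof. unfold dot; ring. Qed.

(** The product of two triple products is a Gram determinant, here
    [det (v, n, e1) * det (w, n, e1)], and expanding it along an orthonormal pair
    [n], [e1] gives Parseval's identity. *)
Lemma dot_orthonormal e1 e2 n v w : orthonormal e1 e2 n ->
  dot v w = dot v e1 * dot w e1 + dot v e2 * dot w e2 + dot v n * dot w n.
Proof.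
  intros (h1 & hn & h0 & ->).
  assert (G : dot v (cross n e1) * dot w (cross n e1) =
    dot v w * (dot n n * dot e1 e1 - dot n e1 * dot n e1)
    - dot v n * (dot w n * dot e1 e1 - dot n e1 * dot w e1)
    + dot v e1 * (dot w n * dot n e1 - dot n n * dot w e1)).
  { unfold dot, cross, c1, c2, c3; simpl; ring. }
  rewrite G h1 hn h0. ring.
Qed.

Lemma orthonormal_e2 e1 e2 n : orthonormal e1 e2 n ->
  dot e2 e2 = 1 /\ dot e1 e2 = 0 /\ dot n e2 = 0.
Proof.
  intros (h1 & hn & h0 & ->). split; [|split].
  - replace 1 with (dot n n * dot e1 e1 - dot n e1 * dot n e1) by (rewrite h1 hn h0; ring).
    unfold dot, cross, c1, c2, c3; simpl; ring.
  - unfold dot, cross, c1, c2, c3; simpl; ring.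
  - unfold dot, cross, c1, c2, c3; simpl; ring.
Qed.

Lemma locally_const_partials (U : R2 -> Prop) (g : R2 -> R) c p :
  open U -> (forall q, U q -> g q = c) -> U p -> dx g p = 0 /\ dy g p = 0.
Proof.
  intros HU H Hp.
  assert (D : partials g p 0 0).
  { apply partials_ext_loc with (fun _ => c); [|apply partials_const].
    apply: locally_imp (HU _ Hp) => q Hq. symmetry. now apply H. }
  split; [exact (partials_dx _ _ _ _ D) | exact (partials_dy _ _ _ _ D)].
Qed.

(** * Integrals depending on a variable, and Green's formula *)

(* Equalities stated in an abstract normed module hide that they are about reals. *)
Ltac ring_R := lazymatch goal with |- ?u = ?v => change (@eq R u v) end; ring.

(** The tube lemma: by compactness of the segment, the neighbourhoods of its points on which [P]
    holds have a common width. *)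
Lemma tube (P : R2 -> Prop) (x a b : R) :
  (forall t, a <= t <= b -> locally (x, t) P) ->
  exists d : posreal, forall s t, a <= t <= b -> Rabs (s - x) < d -> P (s, t).
Proof.
  intros H.
  assert (H' : forall t, exists e : posreal, a <= t <= b ->
    forall s t', Rabs (s - x) < e -> Rabs (t' - t) < e -> P (s, t')).
  { intros t. destruct (Classical_Prop.classic (a <= t <= b)) as [h|h].
    - destruct (H t h) as [e He]. exists e. intros _ s t' Hs Ht. apply He. now apply ball_R2.
    - exists (mkposreal 1 Rlt_0_1). tauto. }
  destruct (choice _ H') as [delta Hdelta].
  destruct (compactness_value_1d a b delta) as [d Hd].
  exists d. intros s t Ht Hs. apply Classical_Prop.NNPP. intros N.
  apply (Hd t Ht). intros [u [Hu [Htu Hdu]]]. apply N.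
  apply (Hdelta u Hu); [lra | exact Htu].
Qed.

Lemma continuous_section_y (g : R2 -> R) (x t : R) :
  continuous g (x, t) -> continuous (fun t' => g (x, t')) t.
Proof.
  intros H. apply (continuous_comp_2 (fun _ => x) (fun t' => t') (fun u v => g (u, v))).
  - apply continuous_const.
  - apply continuous_id.
  - apply continuous_ext with g; [now intros [] | exact H].
Qed.

Lemma continuous_section_x (g : R2 -> R) (x t : R) :
  continuous g (x, t) -> continuous (fun s => g (s, t)) x.
Proof.
  intros H. apply (continuous_comp_2 (fun s => s) (fun _ => t) (fun u v => g (u, v))).
  - apply continuous_id.
  - apply continuous_const.
  - apply continuous_ext with g; [now intros [] | exact H].
Qed.

Lemma continuous_freeze_pair (x : R) (q : R2) : continuous (fun q : R2 => (x, snd q) : R2) q.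
Proof.
  apply (continuous_comp_2 (fun _ : R2 => x) (fun q : R2 => snd q) (fun u v => (u, v))).
  - apply continuous_const.
  - apply continuous_snd.
  - apply continuous_ext with (fun z => z); [now intros [] | apply continuous_id].
Qed.

Lemma continuous_freeze_x (g : R2 -> R) (x t : R) :
  continuous g (x, t) -> continuous (fun q : R2 => g (x, snd q)) (x, t).
Proof.
  intros H. apply (continuous_comp (fun q : R2 => snd q) (fun t' => g (x, t'))).
  - apply continuous_snd.
  - now apply continuous_section_y.
Qed.

(** Continuity at the points of the segment suffices, since [g] is compared with its value at the
    point of the segment of the same height. *)
Lemma tube_continuous (g : R2 -> R) (x a b : R) (eps : posreal) :
  (forall t, a <= t <= b -> continuous g (x, t)) ->
  exists d : posreal, forall s t, a <= t <= b -> Rabs (s - x) < d ->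
    Rabs (g (s, t) - g (x, t)) < eps.
Proof.
  intros H. apply (tube (fun q => Rabs (g q - g (x, snd q)) < eps)).
  intros t Ht. specialize (H t Ht).
  assert (D : continuous (fun q : R2 => minus (g q) (g (x, snd q))) (x, t)).
  { apply: continuous_minus; [exact H | now apply continuous_freeze_x]. }
  assert (L := proj1 (continuous_eps _ _) D eps).
  apply: locally_imp L => q. unfold minus, plus, opp; simpl.
  intros Hq. replace (g q - g (x, snd q)) with
   (g q + - g (x, snd q) - (g (x, t) + - g (x, t))) by ring. exact Hq.
Qed.

Lemma continuous_bounded (g : R -> R) (a b : R) :
  (forall t, a <= t <= b -> continuous g t) ->
  exists M, 0 <= M /\ forall t, a <= t <= b -> Rabs (g t) <= M.
Proof.
  intros H. destruct (Rle_dec a b) as [h|h].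
  - destruct (continuity_ab_maj (fun t => Rabs (g t)) a b h) as [m [Hm _]].
    + intros t Ht. apply continuity_pt_filterlim.
      apply (continuous_comp g Rabs); [now apply H | apply: continuous_Rabs].
    + exists (Rabs (g m)). split; [apply Rabs_pos | exact Hm].
  - exists 0. split; [lra | intros; lra].
Qed.

Lemma abs_RInt_bound (g : R -> R) (a b M : R) :
  ex_RInt g a b ->
  (forall t, Rmin a b <= t <= Rmax a b -> Rabs (g t) <= M) ->
  Rabs (RInt g a b) <= Rabs (b - a) * M.
Proof.
  intros He H. destruct (Rle_dec a b) as [h|h].
  - rewrite (Rabs_pos_eq (b - a)); [|lra]. apply abs_RInt_le_const; auto.
    intros t Ht. apply H. rewrite Rmin_left // Rmax_right //.
  - rewrite -(opp_RInt_swap g b a); [|now apply ex_RInt_swap].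
    unfold opp; simpl. rewrite Rabs_Ropp (Rabs_left1 (b - a)); [|lra].
    replace (- (b - a)) with (a - b) by ring.
    apply abs_RInt_le_const; [lra | now apply ex_RInt_swap |].
    intros t Ht. apply H. rewrite Rmin_right ?Rmax_left //; lra.
Qed.

Lemma ex_RInt_section_y (g : R2 -> R) (x a b : R) :
  (forall t, Rmin a b <= t <= Rmax a b -> continuous g (x, t)) ->
  ex_RInt (fun t => g (x, t)) a b.
Proof.
  intros H. apply: ex_RInt_continuous => t Ht. now apply continuous_section_y, H.
Qed.

Lemma RInt_by_parts (u du v dv : R -> R) (a b : R) :
  (forall t, Rmin a b <= t <= Rmax a b ->
     is_derive u t (du t) /\ is_derive v t (dv t) /\
     continuous du t /\ continuous dv t) ->
  RInt (fun t => u t * dv t) a b = u b * v b - u a * v a - RInt (fun t => du t * v t) a b.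
Proof.
  intros H.
  assert (Cu : forall t, Rmin a b <= t <= Rmax a b -> continuous u t).
  { intros t Ht. apply: ex_derive_continuous. eexists. apply (H t Ht). }
  assert (Cv : forall t, Rmin a b <= t <= Rmax a b -> continuous v t).
  { intros t Ht. apply: ex_derive_continuous. eexists. apply (H t Ht). }
  assert (E1 : ex_RInt (fun t => u t * dv t) a b).
  { apply: ex_RInt_continuous => t Ht. apply: continuous_mult; [now apply Cu | now apply H]. }
  assert (E2 : ex_RInt (fun t => du t * v t) a b).
  { apply: ex_RInt_continuous => t Ht. apply: continuous_mult; [now apply H | now apply Cv]. }
  assert (I : is_RInt (fun t => plus (du t * v t) (u t * dv t)) a b (minus (u b * v b) (u a * v a))).
  { apply (is_RInt_derive (fun t => u t * v t)).
    - intros t Ht. destruct (H t Ht) as (Hu & Hv & _).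
      apply: is_derive_mult => //. intros; apply Rmult_comm.
    - intros t Ht. apply: continuous_plus; apply: continuous_mult;
        first [now apply H | now apply Cu | now apply Cv]. }
  assert (S := RInt_plus _ _ _ _ E2 E1).
  rewrite (is_RInt_unique _ _ _ _ I) in S.
  unfold plus, minus, opp in S; simpl in S. unfold plus in S; simpl in S. lra.
Qed.

(** With [eps = 1] the bound at [x] itself shows that [r] vanishes there. *)
Lemma is_derive_quadratic_remainder (r : R -> R) (x : R) :
  (forall eps : posreal, locally x (fun s => Rabs (r s) <= eps * Rabs (s - x))) ->
  is_derive r x 0.
Proof.
  intros H. split; [apply is_linear_scal_l|].
  intros x' Hx'. assert (x' = x) by (symmetry; now apply is_filter_lim_locally_unique). subst x'.
  intros eps.
  assert (r0 : r x = 0).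
  { assert (h := locally_singleton _ _ (H (mkposreal 1 Rlt_0_1))). simpl in h.
    rewrite Rminus_diag Rabs_R0 Rmult_0_r in h.
    apply Rabs_eq_0. apply Rle_antisym; [exact h | apply Rabs_pos]. }
  generalize (H eps). apply: filter_imp => s Hs.
  unfold minus, plus, opp, scal, norm; simpl. unfold mult, abs; simpl.
  rewrite r0. replace (r s + - 0 + - ((s + - x) * 0)) with (r s) by ring. exact Hs.
Qed.

(** The tube lemma supplies the neighbourhood on which differentiation under the integral sign
    requires the integrand to be differentiable. *)
Lemma is_derive_RInt_section (U : R2 -> Prop) (w wx : R2 -> R) (x a b : R) :
  open U -> (forall t, Rmin a b <= t <= Rmax a b -> U (x, t)) ->
  (forall q, U q -> is_derive (fun s => w (s, snd q)) (fst q) (wx q)) ->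
  (forall q, U q -> continuous w q) -> (forall q, U q -> continuous wx q) ->
  is_derive (fun s => RInt (fun t => w (s, t)) a b) x (RInt (fun t => wx (x, t)) a b).
Proof.
  intros HU Hs Hd Hw Hwx.
  destruct (tube U x (Rmin a b) (Rmax a b)) as [d HT].
  { intros t Ht. now apply HU, Hs. }
  assert (E : RInt (fun t => Derive (fun s => w (s, t)) x) a b = RInt (fun t => wx (x, t)) a b).
  { apply RInt_ext => t Ht. apply is_derive_unique. apply (Hd (x, t)). apply Hs. lra. }
  rewrite -E. apply (is_derive_RInt_param (fun s t => w (s, t))).
  - exists d. intros s Hsd t Ht. exists (wx (s, t)). apply (Hd (s, t)). now apply HT.
  - intros t Ht. apply (continuity_2d_continuous (fun q => Derive (fun z => w (z, snd q)) (fst q))).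
    apply (continuous_ext_loc _ wx); [|now apply Hwx, Hs].
    apply: locally_imp (HU _ (Hs t Ht)) => q Hq. symmetry. apply is_derive_unique. now apply Hd.
  - exists d. intros s Hsd. apply ex_RInt_section_y. intros t Ht. now apply Hw, HT.
Qed.

(** Green's formula for [h dg], with [g] and [h] merely of class C1, in differentiated form. The
    form [h dg] is only continuous; integration by parts moves the missing second derivative of
    [g] to [h], and the remaining term is a product of two increments. *)
Lemma green_derivative (U : R2 -> Prop) (g h : R2 -> R) (x a b : R) :
  open U -> C1_on U g -> C1_on U h ->
  (forall t, Rmin a b <= t <= Rmax a b -> U (x, t)) ->
  is_derive (fun s => RInt (fun t => h (s, t) * dy g (s, t)) a b) x
    (h (x, b) * dx g (x, b) - h (x, a) * dx g (x, a)
     + RInt (fun t => dx h (x, t) * dy g (x, t) - dy h (x, t) * dx g (x, t)) a b).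
Proof.
  intros HU Hg Hh Hs.
  destruct (tube U x (Rmin a b) (Rmax a b)) as [d HT].
  { intros t Ht. now apply HU, Hs. }
  set (F := fun s => RInt (fun t => h (s, t) * dy g (x, t) - dy h (x, t) * g (s, t)) a b).
  set (Rem := fun s => RInt (fun t => (h (s, t) - h (x, t)) * (dy g (s, t) - dy g (x, t))) a b).
  set (C := RInt (fun t => h (x, t) * dy g (x, t)) a b).
  assert (cg : forall s t, Rabs (s - x) < d -> Rmin a b <= t <= Rmax a b -> continuous g (s, t)).
  { intros. apply (C1_continuous U); auto. }
  assert (ch : forall s t, Rabs (s - x) < d -> Rmin a b <= t <= Rmax a b -> continuous h (s, t)).
  { intros. apply (C1_continuous U); auto. }
  assert (cgy : forall s t, Rabs (s - x) < d -> Rmin a b <= t <= Rmax a b -> continuous (dy g) (s, t)).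
  { intros. apply (C1_continuous_dy U); auto. }
  assert (chy : forall s t, Rabs (s - x) < d -> Rmin a b <= t <= Rmax a b -> continuous (dy h) (s, t)).
  { intros. apply (C1_continuous_dy U); auto. }
  assert (xx : Rabs (x - x) < d) by (rewrite Rminus_diag Rabs_R0; apply cond_pos).
  (* Splitting [h(s) dg(s)] around the increments [h(s) - h(x)] and [g_y(s) - g_y(x)], and integrating
     [h(x) g_y(s)] by parts, leaves only functions that are differentiable in [s], up to [Rem]. *)
  assert (Dec : forall s, Rabs (s - x) < d ->
    RInt (fun t => h (s, t) * dy g (s, t)) a b =
    Rem s + F s - C + (h (x, b) * g (s, b) - h (x, a) * g (s, a))).
  { intros s Hsd. unfold Rem, F, C.
    assert (P := RInt_by_parts (fun t => h (x, t)) (fun t => dy h (x, t))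
                   (fun t => g (s, t)) (fun t => dy g (s, t)) a b).
    assert (P' : h (x, b) * g (s, b) - h (x, a) * g (s, a) =
      RInt (fun t => h (x, t) * dy g (s, t)) a b + RInt (fun t => dy h (x, t) * g (s, t)) a b).
    { rewrite P; [ring|]. intros t Ht.
      split; [|split; [|split]].
      - apply (proj2 (C1_partials U h (x, t) Hh (Hs t Ht))).
      - apply (proj2 (C1_partials U g (s, t) Hg (HT s t Ht Hsd))).
      - apply continuous_section_y; auto.
      - apply continuous_section_y; auto. }
    rewrite P'.
    assert (e1 : ex_RInt (fun t => h (s, t)* dy g (s, t)) a b).
    { apply: ex_RInt_continuous => t Ht. apply: continuous_mult; apply continuous_section_y; auto. }
    assert (e2 : ex_RInt (fun t => h (x, t)* dy g (s, t)) a b).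
    { apply: ex_RInt_continuous => t Ht. apply: continuous_mult; apply continuous_section_y; auto. }
    assert (e3 : ex_RInt (fun t => h (s, t)* dy g (x, t)) a b).
    { apply: ex_RInt_continuous => t Ht. apply: continuous_mult; apply continuous_section_y; auto. }
    assert (e4 : ex_RInt (fun t => h (x, t)* dy g (x, t)) a b).
    { apply: ex_RInt_continuous => t Ht. apply: continuous_mult; apply continuous_section_y; auto. }
    assert (e5 : ex_RInt (fun t => dy h (x, t)* g (s, t)) a b).
    { apply: ex_RInt_continuous => t Ht. apply: continuous_mult; apply continuous_section_y; auto. }
    apply: is_RInt_unique.
    assert (e6 : ex_RInt (fun t => (h (s, t) - h (x, t)) * (dy g (s, t) - dy g (x, t))) a b).
    { apply: ex_RInt_continuous => t Ht. apply: continuous_mult;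
      apply: continuous_minus; apply continuous_section_y; auto. }
    assert (e7 : ex_RInt (fun t => h (s, t) * dy g (x, t) - dy h (x, t) * g (s, t)) a b).
    { now apply: ex_RInt_minus. }
    apply (is_RInt_ext (fun t => ((h (s, t) - h (x, t)) * (dy g (s, t) - dy g (x, t)) +
      (h (s, t) * dy g (x, t) - dy h (x, t) * g (s, t)) - h (x, t) * dy g (x, t) +
      (h (x, t) * dy g (s, t) + dy h (x, t) * g (s, t))))).
    { intros t _. ring_R. }
    apply: is_RInt_plus; [apply: is_RInt_minus; [apply: is_RInt_plus|]|apply: is_RInt_plus];
      now apply: RInt_correct. }
  (* The first increment is of order [s - x], the second one tends to 0 uniformly. *)
  assert (DRem : is_derive Rem x 0).
  { apply is_derive_quadratic_remainder. intros eps.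
    destruct (continuous_bounded (fun t => dx h (x, t)) (Rmin a b) (Rmax a b)) as [M [HM0 HM]].
    { intros t Ht. apply continuous_section_y. apply (C1_continuous_dx U); auto. }
    set (K := Rabs (b - a) * (M + 1) + 1).
    assert (HK : 0 < K).
    { unfold K. assert (0 <= Rabs (b - a) * (M + 1)); [|lra].
      apply Rmult_le_pos; [apply Rabs_pos | lra]. }
    assert (HK' : 0 < eps / K) by (apply Rdiv_lt_0_compat; [apply cond_pos | exact HK]).
    destruct (tube_continuous (dx h) x (Rmin a b) (Rmax a b) (mkposreal 1 Rlt_0_1)) as [d1 H1].
    { intros t Ht. apply (C1_continuous_dx U); auto. }
    destruct (tube_continuous (dy g) x (Rmin a b) (Rmax a b) (mkposreal _ HK')) as [d2 H2].
    { intros t Ht. auto. }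
    assert (L := filter_and _ _ (locally_ball x d) (filter_and _ _ (locally_ball x d1) (locally_ball x d2))).
    apply: filter_imp L => s [B0 [B1 B2]].
    change (Rabs (s - x) < d) in B0. change (Rabs (s - x) < d1) in B1.
    change (Rabs (s - x) < d2) in B2.
    unfold Rem. eapply Rle_trans.
    - apply (abs_RInt_bound _ a b ((M + 1) * Rabs (s - x) * (eps / K))).
      + apply: ex_RInt_continuous => t Ht. apply: continuous_mult;
        apply: continuous_minus; apply continuous_section_y; auto.
      + intros t Ht. rewrite Rabs_mult. apply Rmult_le_compat; try apply Rabs_pos.
        * apply (mvt_abs_bound (fun z => h (z, t)) (fun z => dx h (z, t))).
          -- intros z Hz. apply between_abs in Hz.
             apply (proj1 (C1_partials U h (z, t) Hh (HT z t Ht ltac:(lra)))).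
          -- intros z Hz. apply between_abs in Hz.
             assert (D := H1 z t Ht ltac:(lra)). simpl in D.
             assert (T := Rabs_triang (dx h (z, t) - dx h (x, t)) (dx h (x, t))).
             replace (dx h (z, t) - dx h (x, t) + dx h (x, t)) with (dx h (z, t)) in T by ring.
             assert (D' := HM t Ht). lra.
        * left. now apply H2.
    - replace (Rabs (b - a) * ((M + 1) * Rabs (s - x) * (eps / K))) with
        ((Rabs (b - a) * (M + 1)) / K * (eps * Rabs (s - x))) by (field; lra).
      rewrite -[X in _ <= X]Rmult_1_l. apply Rmult_le_compat_r.
      + apply Rmult_le_pos; [left; apply cond_pos | apply Rabs_pos].
      + apply Rmult_le_reg_r with K; [exact HK|]. unfold Rdiv.
        rewrite Rmult_assoc Rinv_l; [|lra]. unfold K. lra. }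
  assert (DF : is_derive F x (RInt (fun t => dx h (x, t) * dy g (x, t) - dy h (x, t) * dx g (x, t)) a b)).
  { set (V := fun q : R2 => U q /\ U (x, snd q)).
    assert (HV : open V).
    { apply open_and; [exact HU|].
      apply (open_comp (fun q : R2 => (x, snd q)) U); [|exact HU].
      intros q _. apply: continuous_freeze_pair. }
    assert (fr : forall w : R2 -> R, (forall q, U q -> continuous w q) ->
              forall q : R2, V q -> continuous (fun q : R2 => w (x, snd q)) q).
    { intros w Hw q Hq. apply (continuous_comp (fun q : R2 => (x, snd q)) w).
      - apply continuous_freeze_pair.
      - apply Hw, Hq. }
    assert (frg := fr (dy g) (fun q => C1_continuous_dy U g q Hg)).
    assert (frh := fr (dy h) (fun q => C1_continuous_dy U h q Hh)).
    apply (is_derive_RInt_section V (fun q => h q * dy g (x, snd q) - dy h (x, snd q) * g q)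
             (fun q => dx h q * dy g (x, snd q) - dy h (x, snd q) * dx g q)); auto.
    - intros t Ht. split; now apply Hs.
    - intros q [Hq Hq']. simpl.
      apply: is_derive_minus; [evar_last; [apply: is_derive_mult => //|]|].
      + apply (proj1 (C1_partials U h q Hh Hq)).
      + apply: is_derive_const.
      + intros; apply Rmult_comm.
      + unfold plus, mult, zero; simpl. destruct q; simpl. ring.
      + apply: is_derive_scal. apply (proj1 (C1_partials U g q Hg Hq)).
    - intros q Hq. apply: continuous_minus; apply: continuous_mult; auto; apply (C1_continuous U); auto; apply Hq.
    - intros q Hq. apply: continuous_minus; apply: continuous_mult; auto; apply (C1_continuous_dx U); auto; apply Hq. }
  assert (ab : Rmin a b <= a <= Rmax a b /\ Rmin a b <= b <= Rmax a b).
  { unfold Rmin, Rmax. destruct Rle_dec; lra. }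
  apply (is_derive_ext_loc (fun s => Rem s + F s - C + (h (x, b) * g (s, b) - h (x, a) * g (s, a)))).
  { exists d. intros s Hsd. symmetry. now apply Dec. }
  assert (Db := proj1 (C1_partials U g (x, b) Hg (Hs b (proj2 ab)))).
  assert (Da := proj1 (C1_partials U g (x, a) Hg (Hs a (proj1 ab)))).
  simpl in Da, Db.
  evar_last.
  - apply: is_derive_plus.
    + apply: is_derive_minus; [apply: is_derive_plus; [exact DRem | exact DF] | apply: is_derive_const].
    + apply: is_derive_minus; [apply (is_derive_scal _ _ (h (x, b)) _ Db)
                              |apply (is_derive_scal _ _ (h (x, a)) _ Da)].
  - unfold plus, minus, opp, zero; simpl. unfold plus; simpl. ring.
Qed.

(** * The moving frame of a surface of curvature -1 *)

(** Here [w1 = a1 dx + b1 dy], [w2 = a2 dx + b2 dy] and [w12 = k dx + l dy]. The first two equations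
    are [dw1 = w12 /\ w2] and [dw2 = - w12 /\ w1]. The last one is [dw12 = w1 /\ w2]; since [k] and
    [l] need not be differentiable, it is integrated along vertical segments. *)
Record structure_equations (U : R2 -> Prop) (a1 b1 a2 b2 k l : R2 -> R) : Prop := {
  se_a1 : C1_on U a1; se_b1 : C1_on U b1; se_a2 : C1_on U a2; se_b2 : C1_on U b2;
  se_k : forall p, U p -> continuous k p;
  se_l : forall p, U p -> continuous l p;
  se_d1 : forall p, U p -> dx b1 p - dy a1 p = k p * b2 p - l p * a2 p;
  se_d2 : forall p, U p -> dx b2 p - dy a2 p = l p * a1 p - k p * b1 p;
  se_d12 : forall x a b, (forall t, Rmin a b <= t <= Rmax a b -> U (x, t)) ->
    is_derive (fun s => RInt (fun t => l (s, t)) a b) x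
      (k (x, b) - k (x, a)
       + RInt (fun t => a1 (x, t) * b2 (x, t) - a2 (x, t) * b1 (x, t)) a b) }.

(** The connection form [<dv, w>] is a sum of three forms [h dg]. *)
Lemma green_derivative_dot (U : R2 -> Prop) (v w : R2 -> R3) (x a b : R) :
  open U -> C1v U v -> C1v U w ->
  (forall t, Rmin a b <= t <= Rmax a b -> U (x, t)) ->
  is_derive (fun s => RInt (fun t => dot (dy3 v (s, t)) (w (s, t))) a b) x
    (dot (dx3 v (x, b)) (w (x, b)) - dot (dx3 v (x, a)) (w (x, a))
     + RInt (fun t => dot (dy3 v (x, t)) (dx3 w (x, t)) - dot (dx3 v (x, t)) (dy3 w (x, t))) a b).
Proof.
  intros HU (v1 & v2 & v3) (w1 & w2 & w3) Hs.
  destruct (tube U x (Rmin a b) (Rmax a b)) as [d HT].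
  { intros t Ht. now apply HU, Hs. }
  assert (G1 := green_derivative U _ _ x a b HU v1 w1 Hs).
  assert (G2 := green_derivative U _ _ x a b HU v2 w2 Hs).
  assert (G3 := green_derivative U _ _ x a b HU v3 w3 Hs).
  assert (E : forall g h, C1_on U g -> C1_on U h -> forall s, Rabs (s - x) < d ->
    ex_RInt (fun t => h (s, t) * dy g (s, t)) a b).
  { intros g h Hg Hh s Hd. apply: ex_RInt_continuous => t Ht.
    apply: continuous_mult; apply continuous_section_y.
    - apply (C1_continuous U); auto.
    - apply (C1_continuous_dy U); auto. }
  assert (E' : forall g h, C1_on U g -> C1_on U h ->
    ex_RInt (fun t => dx h (x, t) * dy g (x, t) - dy h (x, t) * dx g (x, t)) a b).
  { intros g h Hg Hh. apply: ex_RInt_continuous => t Ht.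
    apply: continuous_minus; apply: continuous_mult; apply continuous_section_y;
    c1_cont U. }
  eapply is_derive_ext_loc; [|evar_last; [apply: is_derive_plus; [apply: is_derive_plus; [exact G1|exact G2]|exact G3]|]].
  - exists d. intros s Hd. change (Rabs (s - x) < d) in Hd. symmetry. apply: is_RInt_unique.
    assert (I := is_RInt_plus _ _ _ _ _ _ (is_RInt_plus _ _ _ _ _ _
      (RInt_correct _ _ _ (E _ _ v1 w1 s Hd)) (RInt_correct _ _ _ (E _ _ v2 w2 s Hd)))
      (RInt_correct _ _ _ (E _ _ v3 w3 s Hd))).
    apply: is_RInt_ext I.
    intros t _. unfold plus, dot, dy3; simpl. unfold c1, c2, c3; simpl. ring_R.
  - unfold plus; simpl.
    assert (A : RInt (fun t => dot (dy3 v (x, t)) (dx3 w (x, t)) - dot (dx3 v (x, t)) (dy3 w (x, t))) a b =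
      RInt (fun t => dx (fun p => c1 (w p)) (x, t) * dy (fun p => c1 (v p)) (x, t) - dy (fun p => c1 (w p)) (x, t) * dx (fun p => c1 (v p)) (x, t)) a b
    + RInt (fun t => dx (fun p => c2 (w p)) (x, t) * dy (fun p => c2 (v p)) (x, t) - dy (fun p => c2 (w p)) (x, t) * dx (fun p => c2 (v p)) (x, t)) a b
    + RInt (fun t => dx (fun p => c3 (w p)) (x, t) * dy (fun p => c3 (v p)) (x, t) - dy (fun p => c3 (w p)) (x, t) * dx (fun p => c3 (v p)) (x, t)) a b).
    { apply: is_RInt_unique.
      assert (I := is_RInt_plus _ _ _ _ _ _ (is_RInt_plus _ _ _ _ _ _
        (RInt_correct _ _ _ (E' _ _ v1 w1)) (RInt_correct _ _ _ (E' _ _ v2 w2)))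
        (RInt_correct _ _ _ (E' _ _ v3 w3))).
      apply: is_RInt_ext I.
      intros t _. unfold plus, dot, dy3, dx3; simpl. unfold c1, c2, c3; simpl. ring_R. }
    rewrite A. unfold dot, dx3, c1, c2, c3; simpl. ring.
Qed.

Lemma dot_smul_l a v w : dot (smul3 a v) w = a * dot v w.
Proof. unfold dot, smul3, c1, c2, c3; simpl; ring. Qed.

Lemma dot_smul_r a v w : dot v (smul3 a w) = a * dot v w.
Proof. unfold dot, smul3, c1, c2, c3; simpl; ring. Qed.

Lemma dot_normalize v : 0 < dot v v ->
  dot (smul3 (/ norm3 v) v) (smul3 (/ norm3 v) v) = 1.
Proof.
  intros H. rewrite dot_smul_l dot_smul_r. unfold norm3.
  assert (0 < sqrt (dot v v)) by now apply sqrt_lt_R0.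
  rewrite -{3}(sqrt_sqrt (dot v v)); [|lra]. field. lra.
Qed.

Lemma dot_cross_cross v w : dot (cross v w) (cross v w) = dot v v * dot w w - dot v w ^ 2.
Proof. unfold dot, cross, c1, c2, c3; simpl; ring. Qed.

Lemma dot_cross_l v w : dot v (cross v w) = 0.
Proof. unfold dot, cross, c1, c2, c3; simpl; ring. Qed.

Lemma dot_cross_r v w : dot w (cross v w) = 0.
Proof. unfold dot, cross, c1, c2, c3; simpl; ring. Qed.

Lemma C1v_normalize (U : R2 -> Prop) (v : R2 -> R3) : open U ->
  C1v U v -> (forall p, U p -> 0 < dot (v p) (v p)) ->
  C1v U (fun p => smul3 (/ norm3 (v p)) (v p)).
Proof.
  intros HU Hv Hpos. apply C1v_smul; auto. unfold norm3. apply C1_inv; auto.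
  - intros p Hp. apply Rgt_not_eq, sqrt_lt_R0. now apply Hpos.
  - apply C1_sqrt; auto. now apply C1_dot.
Qed.

Lemma continuous_dot_dx3 (U : R2 -> Prop) (v w : R2 -> R3) p : open U ->
  C1v U v -> C1v U w -> U p -> continuous (fun q => dot (dx3 v q) (w q)) p.
Proof.
  intros HU (v1 & v2 & v3) (w1 & w2 & w3) Hp. unfold dot, dx3, c1, c2, c3; simpl.
  apply: continuous_plus; [apply: continuous_plus|]; apply: continuous_mult; c1_cont U.
Qed.

Lemma continuous_dot_dy3 (U : R2 -> Prop) (v w : R2 -> R3) p : open U ->
  C1v U v -> C1v U w -> U p -> continuous (fun q => dot (dy3 v q) (w q)) p.
Proof.
  intros HU (v1 & v2 & v3) (w1 & w2 & w3) Hp. unfold dot, dy3, c1, c2, c3; simpl.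
  apply: continuous_plus; [apply: continuous_plus|]; apply: continuous_mult; c1_cont U.
Qed.

Lemma dot_const_derivatives (U : R2 -> Prop) (v w : R2 -> R3) c p : open U ->
  C1v U v -> C1v U w -> (forall q, U q -> dot (v q) (w q) = c) -> U p ->
  dot (dx3 v p) (w p) = - dot (dx3 w p) (v p) /\
  dot (dy3 v p) (w p) = - dot (dy3 w p) (v p).
Proof.
  intros HU Hv Hw Hc Hp.
  destruct (locally_const_partials U _ c p HU Hc Hp) as [Dx Dy].
  rewrite (dx_dot U) in Dx; auto. rewrite (dy_dot U) in Dy; auto.
  rewrite (dot_comm (v p)) in Dx. rewrite (dot_comm (v p)) in Dy. lra.
Qed.

(** The structure equations of the orthonormal frame of a surface of curvature -1. The first two
    express the symmetry of the second derivatives of [f]; the third combines Green's formula for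
    the connection form [<de1, e2>] with the curvature equation, which only involves first
    derivatives of the frame. *)
Lemma moving_frame (U : R2 -> Prop) (f : R2 -> R3) :
  open U -> Ck_R3 2 U f ->
  (forall p, U p -> 0 < dot (cross (dx3 f p) (dy3 f p)) (cross (dx3 f p) (dy3 f p))) ->
  (forall p, U p -> gauss_curvature f p = -1) ->
  exists a1 b1 a2 b2 k l : R2 -> R,
    structure_equations U a1 b1 a2 b2 k l /\
    forall p, U p ->
      dot (dx3 f p) (dx3 f p) = a1 p * a1 p + a2 p * a2 p /\
      dot (dx3 f p) (dy3 f p) = a1 p * b1 p + a2 p * b2 p /\
      dot (dy3 f p) (dy3 f p) = b1 p * b1 p + b2 p * b2 p.
Proof.
  intros HU (F1 & F2 & F3) Himm HK.
  assert (Cfx : C1v U (dx3 f)).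
  { split; [|split]; unfold dx3, c1, c2, c3; simpl; apply Ck_C1 with O; now apply (Ck_dx U 1). }
  assert (Cfy : C1v U (dy3 f)).
  { split; [|split]; unfold dy3, c1, c2, c3; simpl; apply Ck_C1 with O; now apply (Ck_dy U 1). }
  assert (Hxy : forall p, U p -> dx3 (dy3 f) p = dy3 (dx3 f) p).
  { intros p Hp. unfold dx3, dy3; simpl. unfold c1, c2, c3; simpl.
    f_equal; [f_equal|]; now apply (Ck_2_mixed_partials U). }
  assert (Hfx : forall p, U p -> 0 < dot (dx3 f p) (dx3 f p)).
  { intros p Hp. specialize (Himm p Hp). rewrite dot_cross_cross in Himm.
    assert (0 <= dot (dx3 f p) (dx3 f p)) by (unfold dot; nra).
    assert (0 <= dot (dx3 f p) (dy3 f p) ^ 2) by apply pow2_ge_0.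
    destruct (Req_dec (dot (dx3 f p) (dx3 f p)) 0) as [Z|Z]; [rewrite Z in Himm|]; lra. }
  set (N := unit_normal f).
  set (e1 := fun p => smul3 (/ norm3 (dx3 f p)) (dx3 f p)).
  set (e2 := fun p => cross (N p) (e1 p)).
  assert (CN : C1v U N).
  { unfold N, unit_normal. apply C1v_normalize; auto. now apply C1v_cross. }
  assert (Ce1 : C1v U e1) by now apply C1v_normalize.
  assert (Ce2 : C1v U e2) by now apply C1v_cross.
  assert (ON : forall p, U p -> orthonormal (e1 p) (e2 p) (N p)).
  { intros p Hp. split; [|split; [|split]]; [| | |reflexivity].
    - apply dot_normalize. now apply Hfx.
    - apply dot_normalize. now apply Himm.
    - unfold N, e1, unit_normal. rewrite dot_smul_l dot_smul_r dot_comm dot_cross_l. ring. }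
  assert (Nfx : forall p, U p -> dot (dx3 f p) (N p) = 0).
  { intros p Hp. unfold N, unit_normal. rewrite dot_smul_r dot_cross_l. ring. }
  assert (Nfy : forall p, U p -> dot (dy3 f p) (N p) = 0).
  { intros p Hp. unfold N, unit_normal. rewrite dot_smul_r dot_cross_r. ring. }
  assert (P := fun p (Hp : U p) v w => dot_orthonormal _ _ _ v w (ON p Hp)).
  assert (D11 : forall p, U p -> dot (dx3 e1 p) (e1 p) = - dot (dx3 e1 p) (e1 p) /\
                          dot (dy3 e1 p) (e1 p) = - dot (dy3 e1 p) (e1 p)).
  { intros p Hp. apply (dot_const_derivatives U _ _ 1); auto. intros q Hq. apply ON; auto. }
  assert (D22 : forall p, U p -> dot (dx3 e2 p) (e2 p) = - dot (dx3 e2 p) (e2 p) /\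
                          dot (dy3 e2 p) (e2 p) = - dot (dy3 e2 p) (e2 p)).
  { intros p Hp. apply (dot_const_derivatives U _ _ 1); auto. intros q Hq.
    now apply (orthonormal_e2 _ _ _ (ON q Hq)). }
  assert (D12 : forall p, U p -> dot (dx3 e1 p) (e2 p) = - dot (dx3 e2 p) (e1 p) /\
                          dot (dy3 e1 p) (e2 p) = - dot (dy3 e2 p) (e1 p)).
  { intros p Hp. apply (dot_const_derivatives U _ _ 0); auto. intros q Hq.
    now apply (orthonormal_e2 _ _ _ (ON q Hq)). }
  assert (D1N : forall p, U p -> dot (dx3 e1 p) (N p) = - dot (dx3 N p) (e1 p) /\
                          dot (dy3 e1 p) (N p) = - dot (dy3 N p) (e1 p)).
  { intros p Hp. apply (dot_const_derivatives U _ _ 0); auto. intros q Hq.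
    rewrite dot_comm. now apply ON. }
  assert (D2N : forall p, U p -> dot (dx3 e2 p) (N p) = - dot (dx3 N p) (e2 p) /\
                          dot (dy3 e2 p) (N p) = - dot (dy3 N p) (e2 p)).
  { intros p Hp. apply (dot_const_derivatives U _ _ 0); auto. intros q Hq.
    rewrite dot_comm. now apply (orthonormal_e2 _ _ _ (ON q Hq)). }
  exists (fun p => dot (dx3 f p) (e1 p)), (fun p => dot (dy3 f p) (e1 p)),
         (fun p => dot (dx3 f p) (e2 p)), (fun p => dot (dy3 f p) (e2 p)),
         (fun p => dot (dx3 e1 p) (e2 p)), (fun p => dot (dy3 e1 p) (e2 p)).
  split; [split|].
  - now apply C1_dot.
  - now apply C1_dot.
  - now apply C1_dot.
  - now apply C1_dot.
  - intros p Hp. now apply (continuous_dot_dx3 U).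
  - intros p Hp. now apply (continuous_dot_dy3 U).
  - intros p Hp. rewrite (dx_dot U) // (dy_dot U) // Hxy //.
    rewrite (P p Hp (dy3 f p) (dx3 e1 p)) (P p Hp (dx3 f p) (dy3 e1 p)) Nfx // Nfy //.
    destruct (D11 p Hp). replace (dot (dx3 e1 p) (e1 p)) with 0 by lra.
    replace (dot (dy3 e1 p) (e1 p)) with 0 by lra. ring.
  - intros p Hp. rewrite (dx_dot U) // (dy_dot U) // Hxy //.
    rewrite (P p Hp (dy3 f p) (dx3 e2 p)) (P p Hp (dx3 f p) (dy3 e2 p)) Nfx // Nfy //.
    destruct (D22 p Hp). replace (dot (dx3 e2 p) (e2 p)) with 0 by lra.
    replace (dot (dy3 e2 p) (e2 p)) with 0 by lra.
    destruct (D12 p Hp) as [-> ->]. ring.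
  - intros x a b Hs. evar_last; [now apply (green_derivative_dot U)|].
    f_equal. apply RInt_ext => t Ht.
    assert (Hp : U (x, t)) by (apply Hs; lra). generalize dependent (x, t). clear - P Himm HK D11 D22 D12 D1N D2N Nfx Nfy.
    intros p Hp.
    rewrite (P p Hp (dy3 e1 p) (dx3 e2 p)) (P p Hp (dx3 e1 p) (dy3 e2 p)).
    specialize (HK p Hp). specialize (Himm p Hp). rewrite dot_cross_cross in Himm.
    unfold gauss_curvature in HK. fold N in HK.
    destruct (D11 p Hp), (D22 p Hp), (D12 p Hp), (D1N p Hp) as [-> ->], (D2N p Hp) as [-> ->].
    replace (dot (dx3 e1 p) (e1 p)) with 0 by lra.
    replace (dot (dy3 e1 p) (e1 p)) with 0 by lra.
    replace (dot (dx3 e2 p) (e2 p)) with 0 by lra.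
    replace (dot (dy3 e2 p) (e2 p)) with 0 by lra.
    rewrite (P p Hp (dx3 N p) (dx3 f p)) (P p Hp (dx3 N p) (dy3 f p)) 
            (P p Hp (dy3 N p) (dx3 f p)) (P p Hp (dy3 N p) (dy3 f p))
            (P p Hp (dx3 f p) (dx3 f p)) (P p Hp (dx3 f p) (dy3 f p))
            (P p Hp (dy3 f p) (dy3 f p)) in HK.
    rewrite (P p Hp (dx3 f p) (dx3 f p)) (P p Hp (dx3 f p) (dy3 f p))
            (P p Hp (dy3 f p) (dy3 f p)) in Himm.
    rewrite Nfx // Nfy // in HK, Himm.
    set (a1 := dot (dx3 f p) (e1 p)) in *. set (a2 := dot (dx3 f p) (e2 p)) in *.
    set (b1 := dot (dy3 f p) (e1 p)) in *. set (b2 := dot (dy3 f p) (e2 p)) in *.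
    set (p1 := dot (dx3 N p) (e1 p)) in *. set (p2 := dot (dx3 N p) (e2 p)) in *.
    set (q1 := dot (dy3 N p) (e1 p)) in *. set (q2 := dot (dy3 N p) (e2 p)) in *.
    (* The second fundamental form in the coordinate frame is the one in the frame [e1], [e2] times
       the matrix of the coframe, whose determinant squared is the Gram determinant. *)
    assert (W : 0 < (a1 * b2 - a2 * b1) ^ 2) by (ring_simplify; ring_simplify in Himm; lra).
    assert (W0 : a1 * b2 - a2 * b1 <> 0) by (intros Z; rewrite Z in W; lra).
    assert (HK' : (p1 * q2 - p2 * q1) / (a1 * b2 - a2 * b1) = -1).
    { rewrite -HK. field. split; [|exact W0].
      intros Z. rewrite !Rmult_0_l !Rplus_0_r Z in Himm. lra. }
    apply (Rmult_eq_compat_r (a1 * b2 - a2 * b1)) in HK'.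
    unfold Rdiv in HK'. rewrite Rmult_assoc Rinv_l // in HK'. lra.
  - intros p Hp. rewrite (P p Hp (dx3 f p) (dx3 f p)) (P p Hp (dx3 f p) (dy3 f p))
            (P p Hp (dy3 f p) (dy3 f p)) Nfx // Nfy //.
    split; [|split]; ring.
Qed.

(** * Primitives and the rotation angle *)

Definition swap (q : R2) : R2 := (snd q, fst q).

Lemma continuous_swap q : continuous swap q.
Proof.
  apply (continuous_comp_2 (fun q : R2 => snd q) (fun q : R2 => fst q) (fun u v => (u, v))).
  - apply continuous_snd.
  - apply continuous_fst.
  - apply continuous_ext with (fun z => z); [now intros [] | apply continuous_id].
Qed.

Lemma open_swap (U : R2 -> Prop) : open U -> open (fun q => U (swap q)).
Proof. intros HU. apply (open_comp swap U); [intros; apply continuous_swap | exact HU]. Qed.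

Lemma open_ball (p : R2) (r : R) : open (fun q : R2 => ball p r q).
Proof.
  intros [u v] Hq. destruct (proj1 (ball_R2 p (u, v) r) Hq) as [h1 h2]. simpl in h1, h2.
  assert (He : 0 < Rmin (r - Rabs (u - fst p)) (r - Rabs (v - snd p)))
    by (apply Rmin_glb_lt; lra).
  exists (mkposreal _ He). intros [u' v'] Hz.
  destruct (proj1 (ball_R2 (u, v) (u', v') _) Hz) as [z1 z2]. simpl in z1, z2.
  assert (m1 := Rmin_l (r - Rabs (u - fst p)) (r - Rabs (v - snd p))).
  assert (m2 := Rmin_r (r - Rabs (u - fst p)) (r - Rabs (v - snd p))).
  apply (proj2 (ball_R2 p (u', v') r)); simpl.
  assert (t1 := Rabs_triang (u' - u) (u - fst p)).
  assert (t2 := Rabs_triang (v' - v) (v - snd p)).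
  replace (u' - u + (u - fst p)) with (u' - fst p) in t1 by ring.
  replace (v' - v + (v - snd p)) with (v' - snd p) in t2 by ring.
  split; lra.
Qed.

Lemma ball_segment_y (p : R2) (r x y t : R) :
  ball p r ((x, y) : R2) -> Rmin (snd p) y <= t <= Rmax (snd p) y -> ball p r ((x, t) : R2).
Proof.
  intros H Ht. destruct (proj1 (ball_R2 p (x, y) r) H) as [h1 h2]. simpl in h1, h2.
  apply (proj2 (ball_R2 p (x, t) r)); simpl. apply between_abs in Ht. split; lra.
Qed.

Lemma ball_segment_x (p : R2) (r x y t : R) :
  ball p r ((x, y) : R2) -> Rmin (fst p) x <= t <= Rmax (fst p) x -> ball p r ((t, y) : R2).
Proof.
  intros H Ht. destruct (proj1 (ball_R2 p (x, y) r) H) as [h1 h2]. simpl in h1, h2.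
  apply (proj2 (ball_R2 p (t, y) r)); simpl. apply between_abs in Ht. split; lra.
Qed.

Lemma between_end (a b : R) : Rmin a b <= b <= Rmax a b.
Proof. split; [apply Rmin_r | apply Rmax_r]. Qed.

Lemma locally_continuous_bounded (g : R2 -> R) (p : R2) :
  continuous g p -> locally p (fun q => Rabs (g q) <= Rabs (g p) + 1).
Proof.
  intros H. assert (L := proj1 (continuous_eps _ _) H (mkposreal 1 Rlt_0_1)).
  apply: locally_imp L => q Hq. simpl in Hq.
  assert (T := Rabs_triang (g q - g p) (g p)).
  replace (g q - g p + g p) with (g q) in T by ring. lra.
Qed.

Section Primitive.
Variables (U : R2 -> Prop) (w : R2 -> R).
Hypotheses (HU : open U) (Hw : forall q, U q -> continuous w q).

(** Near [(x, y)] the segment from [(x', c)] to [(x', y')] stays in [U]. *)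
Lemma locally_ex_RInt_section_y (c x y : R) :
  (forall t, Rmin c y <= t <= Rmax c y -> U (x, t)) ->
  exists e : posreal, forall x' y', Rabs (x' - x) < e -> Rabs (y' - y) < e ->
    ex_RInt (fun t => w (x', t)) c y /\ ex_RInt (fun t => w (x', t)) y y' /\
    ex_RInt (fun t => w (x', t)) c y'.
Proof.
  intros Hs.
  destruct (tube U x (Rmin c y) (Rmax c y)) as [d Hd]; [intros; now apply HU, Hs|].
  destruct (HU _ (Hs y (between_end c y))) as [e He].
  assert (Hm : 0 < Rmin d e) by (apply Rmin_glb_lt; apply cond_pos).
  exists (mkposreal _ Hm). simpl. intros x' y' Hx Hy.
  assert (m1 := Rmin_l d e). assert (m2 := Rmin_r d e).
  assert (I1 : ex_RInt (fun t => w (x', t)) c y).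
  { apply ex_RInt_section_y. intros t Ht. apply Hw, Hd; [exact Ht | lra]. }
  assert (I2 : ex_RInt (fun t => w (x', t)) y y').
  { apply ex_RInt_section_y. intros t Ht. apply Hw, He. apply between_abs in Ht.
    apply (proj2 (ball_R2 (x, y) (x', t) e)); simpl. split; lra. }
  split; [exact I1 | split; [exact I2 | now apply ex_RInt_Chasles with y]].
Qed.

Lemma is_derive_RInt_y (c x y : R) :
  (forall t, Rmin c y <= t <= Rmax c y -> U (x, t)) ->
  is_derive (fun y' => RInt (fun t => w (x, t)) c y') y (w (x, y)).
Proof.
  intros Hs. destruct (locally_ex_RInt_section_y c x y Hs) as [e He].
  apply (is_derive_RInt (fun t => w (x, t)) _ c).
  - exists e. intros y' Hy'. apply: RInt_correct. apply He; [|exact Hy'].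
    rewrite Rminus_diag Rabs_R0. apply cond_pos.
  - apply continuous_section_y, Hw, Hs, between_end.
Qed.

Lemma continuous_RInt_y (c : R) (q : R2) :
  (forall t, Rmin c (snd q) <= t <= Rmax c (snd q) -> U (fst q, t)) ->
  continuous (fun q' : R2 => RInt (fun t => w (fst q', t)) c (snd q')) q.
Proof.
  destruct q as [x y]; simpl. intros Hs.
  destruct (locally_ex_RInt_section_y c x y Hs) as [e He].
  apply continuous_eps. intros eps.
  set (K := Rabs (y - c) + 1).
  assert (HK : 0 < K) by (unfold K; assert (h := Rabs_pos (y - c)); lra).
  assert (HK' : 0 < eps / 2 / K) by (apply Rdiv_lt_0_compat; [apply (cond_pos (pos_div_2 eps)) | exact HK]).
  destruct (tube_continuous w x (Rmin c y) (Rmax c y) (mkposreal _ HK')) as [d Hd].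
  { intros t Ht. now apply Hw, Hs. }
  destruct (locally_continuous_bounded w (x, y)) as [r Hr].
  { apply Hw, Hs, between_end. }
  set (M := Rabs (w (x, y)) + 1).
  assert (HM : 0 < M) by (unfold M; assert (h := Rabs_pos (w (x, y))); lra).
  assert (HM' : 0 < eps / 2 / M) by (apply Rdiv_lt_0_compat; [apply (cond_pos (pos_div_2 eps)) | exact HM]).
  assert (L := filter_and _ _ (filter_and _ _ (locally_ball ((x, y) : R2) e) (locally_ball ((x, y) : R2) d))
    (filter_and _ _ (locally_ball ((x, y) : R2) r) (locally_ball ((x, y) : R2) (mkposreal _ HM')))).
  apply: locally_imp L => -[x' y'] [[Be Bd] [Br BM]].
  destruct (proj1 (ball_R2 (x, y) (x', y') _) Be) as [ex ey].
  destruct (proj1 (ball_R2 (x, y) (x', y') _) Bd) as [ddx ddy].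
  destruct (proj1 (ball_R2 (x, y) (x', y') _) Br) as [rx ry].
  destruct (proj1 (ball_R2 (x, y) (x', y') _) BM) as [mx my].
  clear Be Bd Br BM. simpl in *.
  destruct (He x' y' ex ey) as (I1 & I2 & I3).
  assert (I0 : ex_RInt (fun t => w (x, t)) c y).
  { apply (He x y); rewrite Rminus_diag Rabs_R0; apply cond_pos. }
  assert (Ch := RInt_Chasles _ _ _ _ I1 I2). unfold plus in Ch; simpl in Ch. rewrite -Ch.
  assert (Mi := RInt_minus _ _ _ _ I1 I0). unfold minus, plus, opp in Mi; simpl in Mi.
  replace (RInt (fun t => w (x', t)) c y + RInt (fun t => w (x', t)) y y' - RInt (fun t => w (x, t)) c y)
    with (RInt (fun t => w (x', t) + - w (x, t)) c y + RInt (fun t => w (x', t)) y y') by (rewrite Mi; ring).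
  eapply Rle_lt_trans; [apply Rabs_triang|].
  assert (B1 : Rabs (RInt (fun t => w (x', t) + - w (x, t)) c y) <= Rabs (y - c) * (eps / 2 / K)).
  { apply abs_RInt_bound; [now apply: ex_RInt_minus|].
    intros t Ht. left. now apply Hd. }
  assert (B2 : Rabs (RInt (fun t => w (x', t)) y y') <= Rabs (y' - y) * M).
  { apply abs_RInt_bound; [exact I2|]. intros t Ht. apply Hr.
    apply between_abs in Ht. apply (proj2 (ball_R2 (x, y) (x', t) r)); simpl. split; lra. }
  assert (B1' : Rabs (y - c) * (eps / 2 / K) < eps / 2).
  { replace (eps / 2) with (K * (eps / 2 / K)) at 2 by (field; lra).
    apply Rmult_lt_compat_r; [exact HK' | unfold K; lra]. }
  assert (B2' : Rabs (y' - y) * M <= eps / 2).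
  { replace (eps / 2) with (eps / 2 / M * M) by (field; lra).
    apply Rmult_le_compat_r; lra. }
  lra.
Qed.

End Primitive.

Section PrimitiveX.
Variables (U : R2 -> Prop) (w : R2 -> R).
Hypotheses (HU : open U) (Hw : forall q, U q -> continuous w q).

Let wT q := w (swap q).

Lemma continuous_swapped q : U (swap q) -> continuous wT q.
Proof. intros Hq. apply (continuous_comp swap w); [apply continuous_swap | now apply Hw]. Qed.

Lemma is_derive_RInt_x (c x y : R) :
  (forall s, Rmin c x <= s <= Rmax c x -> U (s, y)) ->
  is_derive (fun x' => RInt (fun s => w (s, y)) c x') x (w (x, y)).
Proof.
  intros Hs.
  exact (is_derive_RInt_y (fun q => U (swap q)) wT (open_swap U HU) continuous_swapped c y x Hs).
Qed.

Lemma continuous_RInt_x (c : R) (q : R2) :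
  (forall s, Rmin c (fst q) <= s <= Rmax c (fst q) -> U (s, snd q)) ->
  continuous (fun q' : R2 => RInt (fun s => w (s, snd q')) c (fst q')) q.
Proof.
  intros Hs.
  apply (continuous_comp swap (fun q' : R2 => RInt (fun t => wT (fst q', t)) c (snd q'))).
  - apply continuous_swap.
  - exact (continuous_RInt_y (fun q => U (swap q)) wT (open_swap U HU) continuous_swapped c (swap q) Hs).
Qed.

End PrimitiveX.

(** The connection form becomes continuously differentiable after a rotation of the frame by the
    angle [psi]: its rotated version is [beta dy], where [beta dy] is an explicit primitive of the
    area form. *)
Lemma rotation_angle (U : R2 -> Prop) (a1 b1 a2 b2 k l : R2 -> R) (p0 : R2) :
  open U -> structure_equations U a1 b1 a2 b2 k l -> U p0 ->
  exists (r : posreal) (psi beta : R2 -> R),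
    (forall q, ball p0 r q -> U q) /\
    forall q, ball p0 r q ->
      partials psi q (k q) (l q - beta q) /\ continuous beta q /\
      is_derive (fun s => beta (s, snd q)) (fst q) (a1 q * b2 q - a2 q * b1 q).
Proof.
  intros HU HS Hp0. destruct (HU _ Hp0) as [r Hr]. destruct p0 as [x0 y0].
  set (V := fun q : R2 => ball ((x0, y0) : R2) r q).
  assert (HV : open V) by apply open_ball.
  set (W := fun q => a1 q * b2 q - a2 q * b1 q).
  assert (CW : forall q, V q -> continuous W q).
  { intros q Hq. destruct HS. apply: continuous_minus; apply: continuous_mult;
    apply (C1_continuous U); auto. }
  assert (Ck : forall q, V q -> continuous k q) by (intros q Hq; apply (se_k _ _ _ _ _ _ _ HS); auto).
  assert (Cl : forall q, V q -> continuous l q) by (intros q Hq; apply (se_l _ _ _ _ _ _ _ HS); auto).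
  (* [d (beta dy)] is the area form [W dx dy]. *)
  set (beta := fun q : R2 => RInt (fun s => W (s, snd q)) x0 (fst q)).
  assert (Cb : forall q, V q -> continuous beta q).
  { intros [x y] Hq. apply (continuous_RInt_x V W HV CW x0 (x, y)).
    intros s Hs. exact (ball_segment_x (x0, y0) r x y s Hq Hs). }
  assert (Db : forall q, V q -> is_derive (fun s => beta (s, snd q)) (fst q) (W q)).
  { intros [x y] Hq. simpl. apply (is_derive_RInt_x V W HV CW x0 x y).
    intros s Hs. exact (ball_segment_x (x0, y0) r x y s Hq Hs). }
  assert (Clb : forall q, V q -> continuous (fun q => l q - beta q) q).
  { intros q Hq. apply: continuous_minus; auto. }
  exists r, (fun q => RInt (fun s => k (s, y0)) x0 (fst q) +
             RInt (fun t => l (fst q, t) - beta (fst q, t)) y0 (snd q)), beta.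
  split; [exact Hr|]. intros [x y] Hq. split; [split|split; [now apply Cb | now apply Db]]; simpl.
  - assert (Hs : forall t, Rmin y0 y <= t <= Rmax y0 y -> V (x, t)).
    { intros t Ht. exact (ball_segment_y (x0, y0) r x y t Hq Ht). }
    assert (D1 : is_derive (fun x' => RInt (fun s => k (s, y0)) x0 x') x (k (x, y0))).
    { apply (is_derive_RInt_x V k HV Ck x0 x y0). intros s Hs'.
      apply (ball_segment_x (x0, y0) r x y0); [|exact Hs'].
      apply (ball_segment_y (x0, y0) r x y); [exact Hq | split; [apply Rmin_l | apply Rmax_l]]. }
    assert (D2 := se_d12 _ _ _ _ _ _ _ HS x y0 y (fun t Ht => Hr _ (Hs t Ht))).
    assert (D3 := is_derive_RInt_section V beta W x y0 y HV Hs Db Cb CW).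
    destruct (tube V x (Rmin y0 y) (Rmax y0 y)) as [d HT].
    { intros t Ht. now apply HV, Hs. }
    apply (is_derive_ext_loc (fun x' => RInt (fun s => k (s, y0)) x0 x' +
      (RInt (fun t => l (x', t)) y0 y - RInt (fun t => beta (x', t)) y0 y))).
    { exists d. intros x' Hx'. f_equal. symmetry. apply: RInt_minus;
      apply ex_RInt_section_y; intros t Ht; [apply Cl | apply Cb]; now apply HT. }
    evar_last; [apply: is_derive_plus; [exact D1 | apply: is_derive_minus; [exact D2 | exact D3]]|].
    unfold plus, minus, opp; simpl. unfold plus; simpl. unfold W. ring.
  - evar_last; [apply: is_derive_plus; [apply: is_derive_const|]|].
    + apply (is_derive_RInt_y V (fun q => l q - beta q) HV Clb y0 x y).
      intros t Ht. exact (ball_segment_y (x0, y0) r x y t Hq Ht).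
    + unfold plus, zero; simpl. ring.
Qed.

(** * Contractions of continuous functions *)

Lemma half_pow_small (K eps : R) : 0 < eps -> exists n, K * (/ 2) ^ n < eps.
Proof.
  intros He.
  destruct (pow_lt_1_zero (/ 2)) with (y := eps / (Rabs K + 1)) as [n Hn].
  - rewrite Rabs_pos_eq; lra.
  - apply Rdiv_lt_0_compat; [exact He | assert (h := Rabs_pos K); lra].
  - exists n. specialize (Hn n (Nat.le_refl n)).
    assert (h := Rabs_pos K). assert (hp : 0 < (/ 2) ^ n) by (apply pow_lt; lra).
    rewrite Rabs_pos_eq in Hn; [|lra].
    apply (Rmult_lt_compat_l (Rabs K + 1)) in Hn; [|lra].
    replace ((Rabs K + 1) * (eps / (Rabs K + 1))) with eps in Hn by (field; lra).
    assert (K * (/ 2) ^ n <= Rabs K * (/ 2) ^ n); [|lra].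
    apply Rmult_le_compat_r; [lra | apply Rle_abs].
Qed.

Lemma zero_of_half_pow_bounds (a K : R) : (forall n, Rabs a <= K * (/ 2) ^ n) -> a = 0.
Proof.
  intros H. destruct (Req_dec a 0) as [h|h]; [exact h|exfalso].
  destruct (half_pow_small K (Rabs a)) as [n Hn]; [now apply Rabs_pos_lt|].
  specialize (H n). lra.
Qed.

Section FixedPoint.
Variables (I : Type) (T : (I -> R2 -> R) -> I -> R2 -> R) (Y0 : I -> R2 -> R) (K : R).
Let cont (Y : I -> R2 -> R) := forall i q, continuous (Y i) q.
Hypotheses (T_cont : forall Y, cont Y -> cont (T Y)) (Y0_cont : cont Y0).
Hypothesis T_contracts : forall Y Z D, cont Y -> cont Z ->
  (forall i q, Rabs (Y i q - Z i q) <= D) ->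
  forall i q, Rabs (T Y i q - T Z i q) <= D / 2.
Hypothesis Y0_start : forall i q, Rabs (T Y0 i q - Y0 i q) <= K.

Let it n := Nat.iter n T Y0.

Lemma iterate_cont n : cont (it n).
Proof. induction n as [|n IH]; [exact Y0_cont | now apply T_cont]. Qed.

Lemma iterate_step n i q : Rabs (it (S n) i q - it n i q) <= K * (/ 2) ^ n.
Proof.
  revert i q; induction n as [|n IH]; intros i q.
  - rewrite pow_O Rmult_1_r. apply Y0_start.
  - replace (K * (/ 2) ^ S n) with (K * (/ 2) ^ n / 2) by (simpl; field).
    apply T_contracts; auto using iterate_cont.
Qed.

Lemma iterate_tail n d i q : Rabs (it (d + n)%nat i q - it n i q) <= 2 * K * (/ 2) ^ n.
Proof.
  assert (K0 : 0 <= K) by (eapply Rle_trans; [apply Rabs_pos | apply (Y0_start i q)]).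
  assert (A : Rabs (it (d + n)%nat i q - it n i q) <= 2 * K * (/ 2) ^ n * (1 - (/ 2) ^ d)).
  { induction d as [|d IH].
    - simpl. rewrite Rminus_diag Rabs_R0. lra.
    - assert (St := iterate_step (d + n) i q).
      assert (Tr := Rabs_triang (it (S (d + n)) i q - it (d + n)%nat i q) (it (d + n)%nat i q - it n i q)).
      replace (it (S (d + n)) i q - it (d + n)%nat i q + (it (d + n)%nat i q - it n i q))
        with (it (S d + n)%nat i q - it n i q) in Tr by (simpl; ring).
      rewrite pow_add in St. simpl pow. lra. }
  assert (0 <= 2 * K * (/ 2) ^ n) by (apply Rmult_le_pos; [lra | apply pow_le; lra]).
  assert (0 <= (/ 2) ^ d) by (apply pow_le; lra). nra.
Qed.

Lemma iterate_cauchy i q : Cauchy_crit (fun n => it n i q).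
Proof.
  intros eps He. destruct (half_pow_small (4 * K) eps He) as [n Hn].
  exists n. intros m m' Hm Hm'.
  assert (A := iterate_tail n (m - n) i q). assert (A' := iterate_tail n (m' - n) i q).
  replace (m - n + n)%nat with m in A by lia. replace (m' - n + n)%nat with m' in A' by lia.
  unfold Rdist. assert (Tr := Rabs_triang (it m i q - it n i q) (it n i q - it m' i q)).
  replace (it m i q - it n i q + (it n i q - it m' i q)) with (it m i q - it m' i q) in Tr by ring.
  rewrite (Rabs_minus_sym (it n i q)) in Tr. lra.
Qed.

(** Banach's fixed point theorem in the uniform norm: consecutive iterates differ by at most
    [K / 2^n], hence converge uniformly, and the limit is continuous. The bound on the fixed point
    is the sum of this geometric series. *)
Lemma contraction_fixed_point :
  exists Y, cont Y /\ (forall i q, T Y i q = Y i q) /\ forall i q, Rabs (Y i q - Y0 i q) <= 2 * K.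
Proof.
  set (Y := fun i q => proj1_sig (Rcomplete.R_complete _ (iterate_cauchy i q))).
  assert (HY : forall n i q, Rabs (Y i q - it n i q) <= 2 * K * (/ 2) ^ n).
  { intros n i q. unfold Y. destruct (Rcomplete.R_complete _ _) as [l Hl]; simpl.
    apply le_epsilon. intros eps He. destruct (Hl eps He) as [m Hm].
    specialize (Hm (m + n)%nat ltac:(lia)). unfold Rdist in Hm.
    assert (A := iterate_tail n m i q).
    assert (Tr := Rabs_triang (l - it (m + n)%nat i q) (it (m + n)%nat i q - it n i q)).
    replace (l - it (m + n)%nat i q + (it (m + n)%nat i q - it n i q)) with (l - it n i q) in Tr by ring.
    rewrite (Rabs_minus_sym l (it (m + n)%nat i q)) in Tr. lra. }
  assert (CY : cont Y).
  { intros i q. apply continuous_eps. intros eps.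
    destruct (half_pow_small (2 * K) (eps / 3)) as [n Hn].
    { assert (h := cond_pos eps). lra. }
    assert (He : 0 < eps / 3) by (assert (h := cond_pos eps); lra).
    assert (L := proj1 (continuous_eps _ _) (iterate_cont n i q) (mkposreal _ He)).
    apply: locally_imp L => q' Hq'. simpl in Hq'.
    assert (A := HY n i q). assert (A' := HY n i q').
    replace (Y i q' - Y i q) with ((Y i q' - it n i q') + ((it n i q' - it n i q) + (it n i q - Y i q))) by ring.
    rewrite (Rabs_minus_sym (Y i q)) in A.
    assert (T1 := Rabs_triang (Y i q' - it n i q') ((it n i q' - it n i q) + (it n i q - Y i q))).
    assert (T2 := Rabs_triang (it n i q' - it n i q) (it n i q - Y i q)).
    lra. }
  exists Y. split; [exact CY|split].
  - intros i q. apply Rminus_diag_uniq. apply (zero_of_half_pow_bounds _ (2 * K)). intros n.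
    assert (A := T_contracts Y (it n) _ CY (iterate_cont n) (HY n) i q).
    assert (A' := HY (S n) i q). simpl in A'. change (T (it n) i q) with (it (S n) i q) in A.
    rewrite (Rabs_minus_sym (Y i q)) in A'.
    assert (Tr := Rabs_triang (T Y i q - it (S n) i q) (it (S n) i q - Y i q)).
    replace (T Y i q - it (S n) i q + (it (S n) i q - Y i q)) with (T Y i q - Y i q) in Tr by ring.
    simpl in *. lra.
  - intros i q. specialize (HY 0%nat i q). simpl in HY. rewrite Rmult_1_r in HY. exact HY.
Qed.

End FixedPoint.

Definition row_mul (Y : bool -> R2 -> R) (M : bool -> bool -> R2 -> R) (i : bool) (q : R2) : R :=
  Y true q * M true i q + Y false q * M false i q.

Definition clamp (c r z : R) : R := Rmax (c - r) (Rmin (c + r) z).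

Lemma clamp_bounds c r z : 0 <= r -> Rabs (clamp c r z - c) <= r.
Proof.
  intros Hr. unfold clamp, Rmax, Rmin. apply Rabs_le.
  destruct (Rle_dec (c + r) z), Rle_dec; lra.
Qed.

Lemma clamp_id c r z : Rabs (z - c) <= r -> clamp c r z = z.
Proof.
  intros H. unfold clamp, Rmax, Rmin. apply Rabs_le_between in H.
  destruct (Rle_dec (c + r) z), Rle_dec; lra.
Qed.

Lemma Rabs_Rmax_diff a x y : Rabs (Rmax a x - Rmax a y) <= Rabs (x - y).
Proof.
  unfold Rmax. destruct (Rle_dec a x), (Rle_dec a y); unfold Rabs; repeat destruct Rcase_abs; lra.
Qed.

Lemma Rabs_Rmin_diff a x y : Rabs (Rmin a x - Rmin a y) <= Rabs (x - y).
Proof.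
  unfold Rmin. destruct (Rle_dec a x), (Rle_dec a y); unfold Rabs; repeat destruct Rcase_abs; lra.
Qed.

Lemma continuous_clamp c r z : continuous (clamp c r) z.
Proof.
  apply continuous_eps. intros eps. exists eps. intros y Hy. change (Rabs (y - z) < eps) in Hy.
  unfold clamp. eapply Rle_lt_trans; [apply Rabs_Rmax_diff|].
  eapply Rle_lt_trans; [apply Rabs_Rmin_diff | exact Hy].
Qed.

Definition clamp2 (c : R2) (r : R) (q : R2) : R2 := (clamp (fst c) r (fst q), clamp (snd c) r (snd q)).

Lemma continuous_clamp2 c r q : continuous (clamp2 c r) q.
Proof.
  apply (continuous_comp_2 (fun q : R2 => clamp (fst c) r (fst q))
          (fun q : R2 => clamp (snd c) r (snd q)) (fun u v => (u, v))).
  - apply (continuous_comp (fun q : R2 => fst q)); [apply continuous_fst | apply continuous_clamp].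
  - apply (continuous_comp (fun q : R2 => snd q)); [apply continuous_snd | apply continuous_clamp].
  - apply continuous_ext with (fun z => z); [now intros [] | apply continuous_id].
Qed.

Lemma RInt_diff_bound (g h : R -> R) (a b m : R) :
  (forall t, continuous g t) -> (forall t, continuous h t) ->
  (forall t, Rmin a b <= t <= Rmax a b -> Rabs (g t - h t) <= m) ->
  Rabs (RInt g a b - RInt h a b) <= Rabs (b - a) * m.
Proof.
  intros Cg Ch H.
  assert (Ig : ex_RInt g a b) by (apply: ex_RInt_continuous => t _; auto).
  assert (Ih : ex_RInt h a b) by (apply: ex_RInt_continuous => t _; auto).
  assert (Mi := RInt_minus _ _ _ _ Ig Ih). unfold minus, plus, opp in Mi; simpl in Mi.
  replace (RInt g a b - RInt h a b) with (RInt (fun t => g t + - h t) a b) by (rewrite Mi; ring_R).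
  apply abs_RInt_bound; [now apply: ex_RInt_minus | exact H].
Qed.

Lemma row_mul_continuous Y M i q :
  (forall j, continuous (Y j) q) -> (forall j i, continuous (M j i) q) ->
  continuous (row_mul Y M i) q.
Proof.
  intros HY HM. apply: continuous_plus; apply: continuous_mult; auto.
Qed.

Lemma row_mul_diff_bound Y Z M i q D C : 0 <= C ->
  (forall j, Rabs (Y j q - Z j q) <= D) -> (forall j i, Rabs (M j i q) <= C) ->
  Rabs (row_mul Y M i q - row_mul Z M i q) <= 2 * C * D.
Proof.
  intros HC HY HM. unfold row_mul.
  replace (Y true q * M true i q + Y false q * M false i q -
           (Z true q * M true i q + Z false q * M false i q))
    with ((Y true q - Z true q) * M true i q + (Y false q - Z false q) * M false i q) by ring.
  eapply Rle_trans; [apply Rabs_triang|]. rewrite !Rabs_mult.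
  assert (Rabs (Y true q - Z true q) * Rabs (M true i q) <= D * C)
    by (apply Rmult_le_compat; auto using Rabs_pos).
  assert (Rabs (Y false q - Z false q) * Rabs (M false i q) <= D * C)
    by (apply Rmult_le_compat; auto using Rabs_pos).
  lra.
Qed.

Lemma row_mul_bound Y M i q D C : 0 <= C ->
  (forall j, Rabs (Y j q) <= D) -> (forall j i, Rabs (M j i q) <= C) ->
  Rabs (row_mul Y M i q) <= 2 * C * D.
Proof.
  intros HC HY HM.
  assert (A := row_mul_diff_bound Y (fun _ _ => 0) M i q D C HC).
  replace (row_mul Y M i q - row_mul (fun _ _ => 0) M i q) with (row_mul Y M i q) in A
    by (unfold row_mul; ring).
  apply A; [intros j; rewrite Rminus_0_r; auto | exact HM].
Qed.

Lemma locally_bounded_family (M : bool -> bool -> R2 -> R) (p : R2) :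
  (forall j i, continuous (M j i) p) ->
  exists C, 0 <= C /\ locally p (fun q => forall j i, Rabs (M j i q) <= C).
Proof.
  intros H.
  exists (Rabs (M true true p) + Rabs (M true false p) + Rabs (M false true p) + Rabs (M false false p) + 1).
  assert (h1 := Rabs_pos (M true true p)). assert (h2 := Rabs_pos (M true false p)).
  assert (h3 := Rabs_pos (M false true p)). assert (h4 := Rabs_pos (M false false p)).
  split; [lra|].
  assert (L := filter_and _ _ (filter_and _ _ (locally_continuous_bounded _ _ (H true true))
                              (locally_continuous_bounded _ _ (H true false)))
              (filter_and _ _ (locally_continuous_bounded _ _ (H false true))
                              (locally_continuous_bounded _ _ (H false false)))).
  apply: locally_imp L => q [[l1 l2] [l3 l4]] j i; destruct j, i; lra.
Qed.

(** * Flat linear systems of class C1 *)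

Section Goursat.
Variables (x0 y0 : R) (M N B : bool -> bool -> R2 -> R) (s : bool -> R).

(** Integral form of the Goursat problem [Y_xy = Y B] with [Y = s] at [(x0, y0)], [Y_x = Y M] on the
    horizontal axis and [Y_y = Y N] on the vertical axis. A solution of the system [Y_x = Y M],
    [Y_y = Y N] satisfies it with [B = M_y + N M]. *)
Definition goursat (Y : bool -> R2 -> R) (i : bool) (q : R2) : R :=
  s i + RInt (fun u => row_mul Y M i (u, y0)) x0 (fst q)
      + RInt (fun t => row_mul Y N i (x0, t)) y0 (snd q)
      + RInt (fun u => RInt (fun t => row_mul Y B i (u, t)) y0 (snd q)) x0 (fst q).

Hypotheses (M_cont : forall j i q, continuous (M j i) q)
           (N_cont : forall j i q, continuous (N j i) q)
           (B_cont : forall j i q, continuous (B j i) q).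

Let everywhere : R2 -> Prop := fun _ => True.

Lemma inner_continuous Y i q : (forall j q, continuous (Y j) q) ->
  continuous (fun q : R2 => RInt (fun t => row_mul Y B i (fst q, t)) y0 (snd q)) q.
Proof.
  intros HY. apply (continuous_RInt_y everywhere (row_mul Y B i)); unfold everywhere; auto using open_true.
  intros. now apply row_mul_continuous.
Qed.

Lemma goursat_continuous Y i q : (forall j q, continuous (Y j) q) -> continuous (goursat Y i) q.
Proof.
  intros HY.
  assert (A : forall w : R2 -> R, (forall q, continuous w q) -> forall q : R2,
    continuous (fun q' : R2 => RInt (fun u => w (u, snd q')) x0 (fst q')) q).
  { intros w Hw q'. apply (continuous_RInt_x everywhere w); unfold everywhere; auto using open_true. }
  assert (A' : forall w : R2 -> R, (forall q, continuous w q) -> forall q : R2,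
    continuous (fun q' : R2 => RInt (fun t => w (fst q', t)) y0 (snd q')) q).
  { intros w Hw q'. apply (continuous_RInt_y everywhere w); unfold everywhere; auto using open_true. }
  unfold goursat.
  apply: continuous_plus; [apply: continuous_plus; [apply: continuous_plus|]|].
  - apply continuous_const.
  - apply (A (fun q => row_mul Y M i (fst q, y0))). intros [u v].
    apply (continuous_comp (fun q : R2 => fst q) (fun u => row_mul Y M i (u, y0))).
    + apply continuous_fst.
    + apply continuous_section_x. now apply row_mul_continuous.
  - apply (A' (fun q => row_mul Y N i (x0, snd q))). intros [u v].
    apply (continuous_comp (fun q : R2 => snd q) (fun t => row_mul Y N i (x0, t))).
    + apply continuous_snd.
    + apply continuous_section_y. now apply row_mul_continuous.
  - apply (A (fun q => RInt (fun t => row_mul Y B i (fst q, t)) y0 (snd q))).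
    intros q'. now apply inner_continuous.
Qed.

(** Each of the three integrals contributes at most [2 * C * D * r], since [r <= 1]. *)
Lemma goursat_contracts Y Z D C r q i : 0 <= C ->
  0 <= r <= 1 -> 12 * C * r <= 1 ->
  (forall j i q, Rabs (M j i q) <= C) -> (forall j i q, Rabs (N j i q) <= C) ->
  (forall j i q, Rabs (B j i q) <= C) ->
  (forall j q, continuous (Y j) q) -> (forall j q, continuous (Z j) q) ->
  (forall j q, Rabs (Y j q - Z j q) <= D) ->
  Rabs (fst q - x0) <= r -> Rabs (snd q - y0) <= r ->
  Rabs (goursat Y i q - goursat Z i q) <= D / 2.
Proof.
  intros HC Hr HCr BM BN BB CY CZ HD Hx Hy. destruct q as [x y]; simpl in Hx, Hy.
  assert (D0 : 0 <= D) by (eapply Rle_trans; [apply Rabs_pos | apply (HD true (x, y))]).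
  set (m := 2 * C * D).
  assert (m0 : 0 <= m) by (unfold m; apply Rmult_le_pos; lra).
  assert (CyM : forall Y, (forall j q, continuous (Y j) q) -> forall t,
            continuous (fun u => row_mul Y M i (u, y0)) t).
  { intros W HW t. apply continuous_section_x. now apply row_mul_continuous. }
  assert (CxN : forall Y, (forall j q, continuous (Y j) q) -> forall t,
            continuous (fun u => row_mul Y N i (x0, u)) t).
  { intros W HW t. apply continuous_section_y. now apply row_mul_continuous. }
  assert (CB : forall Y, (forall j q, continuous (Y j) q) -> forall u t,
            continuous (fun t => row_mul Y B i (u, t)) t).
  { intros W HW u t. apply continuous_section_y. now apply row_mul_continuous. }
  assert (E1 : Rabs (RInt (fun u => row_mul Y M i (u, y0)) x0 x - RInt (fun u => row_mul Z M i (u, y0)) x0 x) <= Rabs (x - x0) * m).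
  { apply RInt_diff_bound; auto. intros t _. now apply row_mul_diff_bound. }
  assert (E2 : Rabs (RInt (fun t => row_mul Y N i (x0, t)) y0 y - RInt (fun t => row_mul Z N i (x0, t)) y0 y) <= Rabs (y - y0) * m).
  { apply RInt_diff_bound; auto. intros t _. now apply row_mul_diff_bound. }
  assert (E3 : Rabs (RInt (fun u => RInt (fun t => row_mul Y B i (u, t)) y0 y) x0 x
                     - RInt (fun u => RInt (fun t => row_mul Z B i (u, t)) y0 y) x0 x) <= Rabs (x - x0) * (Rabs (y - y0) * m)).
  { apply RInt_diff_bound.
    - intros u. apply (continuous_section_x (fun q : R2 => RInt (fun t => row_mul Y B i (fst q, t)) y0 (snd q))). now apply inner_continuous.
    - intros u. apply (continuous_section_x (fun q : R2 => RInt (fun t => row_mul Z B i (fst q, t)) y0 (snd q))). now apply inner_continuous.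
    - intros u _. apply RInt_diff_bound; auto. intros t _. now apply row_mul_diff_bound. }
  unfold goursat; simpl.
  set (e1 := RInt _ x0 x - RInt _ x0 x) in E1. set (e2 := RInt _ y0 y - RInt _ y0 y) in E2.
  set (e3 := RInt _ x0 x - RInt _ x0 x) in E3.
  match goal with |- Rabs ?t <= _ => replace t with (e1 + e2 + e3) by (unfold e1, e2, e3; ring) end.
  assert (t1 := Rabs_triang (e1 + e2) e3). assert (t2 := Rabs_triang e1 e2).
  assert (b1 : Rabs (x - x0) * m <= r * m) by (apply Rmult_le_compat_r; lra).
  assert (b2 : Rabs (y - y0) * m <= r * m) by (apply Rmult_le_compat_r; lra).
  assert (b3 : Rabs (x - x0) * (Rabs (y - y0) * m) <= r * m).
  { rewrite -[X in _ <= X]Rmult_1_r (Rmult_comm (r * m)) -Rmult_assoc -Rmult_assoc.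
    apply Rmult_le_compat_r; [exact m0|]. rewrite Rmult_1_l -[X in _ <= X]Rmult_1_r.
    apply Rmult_le_compat; try apply Rabs_pos; lra. }
  assert (3 * (r * m) <= D / 2); [|lra].
  unfold m. replace (3 * (r * (2 * C * D))) with (12 * C * r * (D / 2)) by field.
  rewrite -[X in _ <= X]Rmult_1_l. apply Rmult_le_compat_r; lra.
Qed.

Definition goursat_x (Y : bool -> R2 -> R) (i : bool) (q : R2) : R :=
  row_mul Y M i (fst q, y0) + RInt (fun t => row_mul Y B i (fst q, t)) y0 (snd q).

Definition goursat_y (Y : bool -> R2 -> R) (i : bool) (q : R2) : R :=
  row_mul Y N i (x0, snd q) + RInt (fun u => row_mul Y B i (u, snd q)) x0 (fst q).

(** Both derivatives of the double integral exist although only one of them is a derivative with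
    respect to the outer bound; the other one is taken under the integral sign. *)
Lemma goursat_partials Y i q : (forall j q, continuous (Y j) q) ->
  partials (goursat Y i) q (goursat_x Y i q) (goursat_y Y i q).
Proof.
  intros HY. destruct q as [x y].
  assert (CM : forall q, everywhere q -> continuous (row_mul Y M i) q) by (intros; now apply row_mul_continuous).
  assert (CN : forall q, everywhere q -> continuous (row_mul Y N i) q) by (intros; now apply row_mul_continuous).
  assert (CB : forall q, everywhere q -> continuous (row_mul Y B i) q) by (intros; now apply row_mul_continuous).
  split; unfold goursat, goursat_x, goursat_y; simpl.
  - assert (D1 := is_derive_RInt_x everywhere _ open_true CM x0 x y0 (fun _ _ => Logic.I)).
    assert (D2 := is_derive_RInt_x everywhere
       (fun q => RInt (fun t => row_mul Y B i (fst q, t)) y0 (snd q)) open_true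
       (fun q _ => inner_continuous Y i q HY) x0 x y (fun _ _ => Logic.I)).
    evar_last; [apply: is_derive_plus; [apply: is_derive_plus; [apply: is_derive_plus;
      [apply: is_derive_const | exact D1] | apply: is_derive_const] | exact D2]|].
    unfold plus, zero; simpl. ring.
  - assert (D1 := is_derive_RInt_y everywhere _ open_true CN y0 x0 y (fun _ _ => Logic.I)).
    assert (D2 : is_derive (fun y' => RInt (fun u => RInt (fun t => row_mul Y B i (u, t)) y0 y') x0 x) y
              (RInt (fun u => row_mul Y B i (u, y)) x0 x)).
    { apply (is_derive_RInt_section everywhere
        (fun q : R2 => RInt (fun t => row_mul Y B i (snd q, t)) y0 (fst q))
        (fun q => row_mul Y B i (swap q))); auto using open_true.
      - exact (fun _ _ => Logic.I).
      - intros [t u] _. simpl.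
        apply (is_derive_RInt_y everywhere _ open_true CB y0 u t (fun _ _ => Logic.I)).
      - intros q _. apply (continuous_comp swap (fun q : R2 => RInt (fun t => row_mul Y B i (fst q, t)) y0 (snd q))).
        + apply continuous_swap.
        + now apply inner_continuous.
      - intros q _. apply (continuous_comp swap); [apply continuous_swap | now apply CB]. }
    evar_last; [apply: is_derive_plus; [apply: is_derive_plus; [apply: is_derive_const
       | exact D1] | exact D2]|].
    unfold plus, zero; simpl. ring.
Qed.

End Goursat.

(** If [G] and [H] vanish on the two axes and each bounds the transversal derivative of the
    other, then halving their common bound again and again forces both to vanish. *)
Lemma goursat_uniqueness (x0 y0 r C K : R) (M N : bool -> bool -> R2 -> R)
    (G H : bool -> R2 -> R) :
  0 < r -> 0 <= C -> 4 * C * r <= 1 ->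
  (forall j i q, Rabs (M j i q) <= C) -> (forall j i q, Rabs (N j i q) <= C) ->
  let V := fun q : R2 => ball ((x0, y0) : R2) r q in
  (forall i q, V q -> is_derive (fun t => G i (fst q, t)) (snd q) (- row_mul H M i q)) ->
  (forall i q, V q -> is_derive (fun t => H i (t, snd q)) (fst q) (- row_mul G N i q)) ->
  (forall i x, V (x, y0) -> G i (x, y0) = 0) -> (forall i y, V (x0, y) -> H i (x0, y) = 0) ->
  (forall i q, V q -> Rabs (G i q) <= K) -> (forall i q, V q -> Rabs (H i q) <= K) ->
  forall i q, V q -> G i q = 0 /\ H i q = 0.
Proof.
  intros Hr HC HCr BM BN V DG DH G0 H0 BG BH.
  assert (A : forall n, (forall i q, V q -> Rabs (G i q) <= K * (/ 2) ^ n) /\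
                        (forall i q, V q -> Rabs (H i q) <= K * (/ 2) ^ n)).
  { induction n as [|n [IG IH]].
    - split; intros i q Hq; rewrite pow_O Rmult_1_r; auto.
    - assert (step : forall z, Rabs z < r -> 0 <= K * (/ 2) ^ n ->
        2 * C * (K * (/ 2) ^ n) * Rabs z <= K * (/ 2) ^ S n).
      { intros z Hz HK. simpl.
        replace (K * (/ 2 * (/ 2) ^ n)) with (1 * (K * (/ 2) ^ n) / 2) by field.
        apply Rle_trans with (4 * C * r * (K * (/ 2) ^ n) / 2).
        - replace (2 * C * (K * (/ 2) ^ n) * Rabs z) with (4 * C * Rabs z * (K * (/ 2) ^ n) / 2) by field.
          unfold Rdiv. apply Rmult_le_compat_r; [lra|]. apply Rmult_le_compat_r; [exact HK|].
          apply Rmult_le_compat_l; lra.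
        - unfold Rdiv. apply Rmult_le_compat_r; [lra|]. now apply Rmult_le_compat_r. }
      split; intros i [x y] Hq;
        assert (HK := Rle_trans _ _ _ (Rabs_pos _) (IG true (x, y) Hq));
        destruct (proj1 (ball_R2 (x0, y0) (x, y) r) Hq) as [hx hy]; simpl in hx, hy.
      + assert (Hs : forall t, Rmin y0 y <= t <= Rmax y0 y -> V (x, t)).
        { intros t Ht. exact (ball_segment_y (x0, y0) r x y t Hq Ht). }
        assert (B := mvt_abs_bound (fun t => G i (x, t)) (fun t => - row_mul H M i (x, t)) y0 y
          (2 * C * (K * (/ 2) ^ n)) (fun t Ht => DG i (x, t) (Hs t Ht))).
        simpl in B. rewrite G0 in B.
        2:{ apply Hs. split; [apply Rmin_l | apply Rmax_l]. }
        rewrite Rminus_0_r in B. eapply Rle_trans; [apply B|].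
        * intros t Ht. rewrite Rabs_Ropp. apply row_mul_bound; auto.
        * now apply step.
      + assert (Hs : forall t, Rmin x0 x <= t <= Rmax x0 x -> V (t, y)).
        { intros t Ht. exact (ball_segment_x (x0, y0) r x y t Hq Ht). }
        assert (B := mvt_abs_bound (fun t => H i (t, y)) (fun t => - row_mul G N i (t, y)) x0 x
          (2 * C * (K * (/ 2) ^ n)) (fun t Ht => DH i (t, y) (Hs t Ht))).
        simpl in B. rewrite H0 in B.
        2:{ apply Hs. split; [apply Rmin_l | apply Rmax_l]. }
        rewrite Rminus_0_r in B. eapply Rle_trans; [apply B|].
        * intros t Ht. rewrite Rabs_Ropp. apply row_mul_bound; auto.
        * now apply step. }
  intros i q Hq. split; apply (zero_of_half_pow_bounds _ K); intros n; now apply A.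
Qed.

(** Cross differentiation turns the system [Y_x = Y M], [Y_y = Y N] into the Goursat problem [Y_xy = Y B], whose solution is a fixed point; flatness then
    shows that the two defects [Y_x - Y M] and [Y_y - Y N] satisfy a homogeneous Goursat
    problem. *)
Lemma flat_system_solvable (U : R2 -> Prop) (M N My Nx : bool -> bool -> R2 -> R) (p0 : R2) :
  open U -> U p0 ->
  (forall j i q, U q -> continuous (M j i) q) ->
  (forall j i q, U q -> continuous (N j i) q) ->
  (forall j i q, U q -> continuous (My j i) q) ->
  (forall j i q, U q -> is_derive (fun t => M j i (fst q, t)) (snd q) (My j i q)) ->
  (forall j i q, U q -> is_derive (fun t => N j i (t, snd q)) (fst q) (Nx j i q)) ->
  (forall j i q, U q -> My j i q + row_mul (N j) M i q = Nx j i q + row_mul (M j) N i q) ->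
  exists r : posreal, (forall q, ball p0 r q -> U q) /\
    forall s : bool -> R, exists Y : bool -> R2 -> R,
      (forall i, Y i p0 = s i) /\
      forall i q, ball p0 r q ->
        continuous (Y i) q /\ partials (Y i) q (row_mul Y M i q) (row_mul Y N i q).
Proof.
  intros HU Hp0 CM CN CMy DM DN Flat. destruct p0 as [x0 y0].
  set (B := fun j i q => My j i q + row_mul (N j) M i q).
  assert (CB : forall j i q, U q -> continuous (B j i) q).
  { intros j i q Hq. apply: continuous_plus; [auto|]. apply row_mul_continuous; auto. }
  destruct (locally_bounded_family M (x0, y0)) as [C1 [C1p L1]]; [auto|].
  destruct (locally_bounded_family N (x0, y0)) as [C2 [C2p L2]]; [auto|].
  destruct (locally_bounded_family B (x0, y0)) as [C3 [C3p L3]]; [auto|].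
  set (C := C1 + C2 + C3). assert (HC : 0 <= C) by (unfold C; lra).
  destruct (filter_and _ _ (HU _ Hp0) (filter_and _ _ L1 (filter_and _ _ L2 L3))) as [e He].
  assert (HrC : 0 < / (12 * (C + 1))) by (apply Rinv_0_lt_compat; lra).
  assert (Hr : 0 < Rmin (e / 2) (Rmin 1 (/ (12 * (C + 1))))).
  { apply Rmin_glb_lt; [apply (cond_pos (pos_div_2 e))|]. apply Rmin_glb_lt; [lra | exact HrC]. }
  set (r := mkposreal _ Hr).
  assert (r1 : r <= e / 2) by apply Rmin_l.
  assert (r2 : r <= 1) by (eapply Rle_trans; [apply Rmin_r | apply Rmin_l]).
  assert (r3 : r <= / (12 * (C + 1))) by (eapply Rle_trans; [apply Rmin_r | apply Rmin_r]).
  assert (r0 := cond_pos r). assert (e0 := cond_pos e).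
  assert (HCr : 12 * C * r <= 1).
  { apply Rle_trans with (12 * (C + 1) * / (12 * (C + 1))); [|right; field; lra].
    apply Rmult_le_compat; lra. }
  clearbody r.
  (* Clamping the arguments extends the coefficients to bounded continuous functions on the whole
     plane, where the fixed point theorem applies, without changing them on the square. *)
  set (cl := clamp2 (x0, y0) r).
  assert (Hcl : forall q, ball ((x0, y0) : R2) e (cl q)).
  { intros q. apply (proj2 (ball_R2 (x0, y0) (cl q) e)). unfold cl, clamp2; simpl.
    assert (h1 := clamp_bounds x0 r (fst q) ltac:(lra)).
    assert (h2 := clamp_bounds y0 r (snd q) ltac:(lra)). split; lra. }
  assert (cl_id : forall q : R2, ball ((x0, y0) : R2) r q -> cl q = q).
  { intros [x y] Hq. destruct (proj1 (ball_R2 (x0, y0) (x, y) r) Hq). simpl in *.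
    unfold cl, clamp2; simpl. rewrite !clamp_id //; lra. }
  assert (Ccl : forall w : R2 -> R, (forall q, U q -> continuous w q) ->
                 forall q, continuous (fun q => w (cl q)) q).
  { intros w Hw q. apply (continuous_comp cl w); [apply continuous_clamp2 | now apply Hw, He]. }
  set (M' := fun j i q => M j i (cl q)). set (N' := fun j i q => N j i (cl q)).
  set (B' := fun j i q => B j i (cl q)).
  assert (CM' : forall j i q, continuous (M' j i) q) by (intros j i; apply Ccl; auto).
  assert (CN' : forall j i q, continuous (N' j i) q) by (intros j i; apply Ccl; auto).
  assert (CB' : forall j i q, continuous (B' j i) q) by (intros j i; apply Ccl; auto).
  assert (BM : forall j i q, Rabs (M' j i q) <= C).
  { intros j i q. destruct (He _ (Hcl q)) as (_ & h & _). specialize (h j i). unfold M', C. lra. }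
  assert (BN : forall j i q, Rabs (N' j i q) <= C).
  { intros j i q. destruct (He _ (Hcl q)) as (_ & _ & h & _). specialize (h j i). unfold N', C. lra. }
  assert (BB : forall j i q, Rabs (B' j i q) <= C).
  { intros j i q. destruct (He _ (Hcl q)) as (_ & _ & _ & h). specialize (h j i). unfold B', C. lra. }
  assert (VU : forall q, ball ((x0, y0) : R2) r q -> U q).
  { intros q Hq. apply He. rewrite -(cl_id q Hq). apply Hcl. }
  exists r. split; [exact VU|]. intros s.
  set (T := fun Y i q => goursat x0 y0 M' N' B' s Y i (cl q)).
  set (Y0 := fun (_ : bool) (_ : R2) => 0).
  assert (clr : forall q, Rabs (fst (cl q) - x0) <= r /\ Rabs (snd (cl q) - y0) <= r).
  { intros q. split; apply clamp_bounds; lra. }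
  destruct (contraction_fixed_point bool T Y0 (Rabs (s true) + Rabs (s false))) as (Y & CY & FP & BY).
  { intros Y HY i q. apply (continuous_comp cl (goursat x0 y0 M' N' B' s Y i)).
    - apply continuous_clamp2.
    - apply goursat_continuous; auto. }
  { intros i q. apply continuous_const. }
  { intros Y Z D HY HZ HD i q. unfold T. apply goursat_contracts with C r; auto; try lra; apply clr. }
  { intros i q.
    assert (Z : T Y0 i q = s i).
    { unfold T, goursat. assert (Z : forall A i q, row_mul Y0 A i q = 0) by (intros; unfold row_mul, Y0; ring).
      rewrite (RInt_ext _ (fun _ => 0)); [|intros; apply Z].
      rewrite (RInt_ext _ (fun _ => 0) y0); [|intros; apply Z].
      rewrite (RInt_ext (fun u => RInt _ _ _) (fun _ => 0)).
      - rewrite !RInt_const. unfold scal; simpl. unfold mult; simpl. ring.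
      - intros u _. rewrite (RInt_ext _ (fun _ => 0)); [|intros; apply Z].
        rewrite RInt_const. unfold scal; simpl. unfold mult; simpl. ring. }
    rewrite Z. unfold Y0. rewrite Rminus_0_r.
    assert (h1 := Rabs_pos (s true)). assert (h2 := Rabs_pos (s false)). destruct i; lra. }
  assert (CY' : forall j q, continuous (Y j) q) by exact CY.
  set (V := fun q : R2 => ball ((x0, y0) : R2) r q).
  assert (HV : open V) by apply open_ball.
  assert (EY : forall i q, V q -> Y i q = goursat x0 y0 M' N' B' s Y i q).
  { intros i q Hq. rewrite -FP. unfold T. now rewrite cl_id. }
  set (Yx := goursat_x y0 M' B' Y). set (Yy := goursat_y x0 N' B' Y).
  assert (PY : forall i q, V q -> partials (Y i) q (Yx i q) (Yy i q)).
  { intros i q Hq. apply partials_ext_loc with (goursat x0 y0 M' N' B' s Y i).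
    - apply: locally_imp (HV _ Hq) => q' Hq'. symmetry. now apply EY.
    - now apply goursat_partials. }
  exists Y. split.
  { intros i. rewrite EY; [|apply ball_center]. unfold goursat; simpl.
    rewrite !RInt_point. unfold zero; simpl. ring. }
  assert (rm : forall Z A q i, V q -> row_mul Z (fun j i q => A j i (cl q)) i q = row_mul Z A i q).
  { intros Z A q i Hq. unfold row_mul. now rewrite (cl_id q Hq). }
  (* The two defects, which flatness turns into a solution of the homogeneous problem. *)
  set (G := fun i q => Yx i q - row_mul Y M i q). set (H := fun i q => Yy i q - row_mul Y N i q).
  set (S0 := 2 * (Rabs (s true) + Rabs (s false))).
  assert (BY' : forall j q, Rabs (Y j q) <= S0).
  { intros j q. specialize (BY j q). unfold Y0 in BY. now rewrite Rminus_0_r in BY. }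
  assert (S0p : 0 <= S0) by (eapply Rle_trans; [apply Rabs_pos | apply (BY' true (x0, y0))]).
  assert (rb : forall A i q, (forall j i q, Rabs (A j i q) <= C) -> Rabs (row_mul Y A i q) <= 2 * C * S0).
  { intros A i q HA. apply row_mul_bound; auto. }
  assert (rbI : forall z0 z w, Rabs (z - z0) < r -> (forall t, continuous w t) ->
     (forall t, Rabs (w t) <= 2 * C * S0) -> Rabs (RInt w z0 z) <= 2 * C * S0).
  { intros z0 z w Hz Cw Hw. eapply Rle_trans.
    - apply abs_RInt_bound; [apply: ex_RInt_continuous => t _; apply Cw | intros t _; apply Hw].
    - rewrite -[X in _ <= X]Rmult_1_l. apply Rmult_le_compat_r; [|lra].
      apply Rmult_le_pos; [apply Rmult_le_pos|]; lra. }
  assert (CS : 0 <= C * S0) by now apply Rmult_le_pos.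
  assert (Z : forall i q, V q -> G i q = 0 /\ H i q = 0).
  { apply (goursat_uniqueness x0 y0 r C (6 * C * S0) M' N' G H); auto; try lra.
    - intros i [x y] Hq.
      assert (D1 : is_derive (fun t => RInt (fun t' => row_mul Y B' i (x, t')) y0 t) y (row_mul Y B' i (x, y))).
      { apply (is_derive_RInt_y (fun _ => True) (row_mul Y B' i) open_true); auto.
        intros; now apply row_mul_continuous. }
      assert (Dj : forall j, is_derive (fun t => Y j (x, t) * M j i (x, t)) y
                  (Yy j (x, y) * M j i (x, y) + Y j (x, y) * My j i (x, y))).
      { intros j. apply: is_derive_mult; [apply (proj2 (PY j (x, y) Hq)) | apply (DM j i (x, y)); now apply VU|].
        intros; apply Rmult_comm. }
      unfold G, Yx, goursat_x, row_mul at 2; simpl.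
      evar_last; [apply: is_derive_minus; [apply: is_derive_plus; [apply: is_derive_const | exact D1]
         | apply: is_derive_plus; [exact (Dj true) | exact (Dj false)]]|].
      unfold minus, plus, opp, zero; simpl. unfold plus; simpl.
      unfold B', M'. rewrite !rm //.
      unfold H, row_mul, B, row_mul. ring.
    - intros i [x y] Hq.
      assert (D1 : is_derive (fun t => RInt (fun t' => row_mul Y B' i (t', y)) x0 t) x (row_mul Y B' i (x, y))).
      { apply (is_derive_RInt_x (fun _ => True) (row_mul Y B' i) open_true); auto.
        intros; now apply row_mul_continuous. }
      assert (Dj : forall j, is_derive (fun t => Y j (t, y) * N j i (t, y)) x
                  (Yx j (x, y) * N j i (x, y) + Y j (x, y) * Nx j i (x, y))).
      { intros j. apply: is_derive_mult; [apply (proj1 (PY j (x, y) Hq)) | apply (DN j i (x, y)); now apply VU|].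
        intros; apply Rmult_comm. }
      unfold H, Yy, goursat_y, row_mul at 2; simpl.
      evar_last; [apply: is_derive_minus; [apply: is_derive_plus; [apply: is_derive_const | exact D1]
         | apply: is_derive_plus; [exact (Dj true) | exact (Dj false)]]|].
      unfold minus, plus, opp, zero; simpl. unfold plus; simpl.
      unfold B', N'. rewrite !rm //.
      assert (BN' : forall j, B j i (x, y) = Nx j i (x, y) + row_mul (M j) N i (x, y)).
      { intros j. apply Flat. now apply VU. }
      unfold G, row_mul. rewrite !BN'. unfold row_mul. ring.
    - intros i x Hq. unfold G, Yx, goursat_x; simpl. rewrite RInt_point.
      unfold M'. rewrite rm //. unfold zero; simpl. ring.
    - intros i y Hq. unfold H, Yy, goursat_y; simpl. rewrite RInt_point.
      unfold N'. rewrite rm //. unfold zero; simpl. ring.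
    - intros i [x y] Hq. destruct (proj1 (ball_R2 (x0, y0) (x, y) r) Hq) as [hx hy]. simpl in hx, hy.
      unfold G, Yx, goursat_x; simpl. rewrite -(rm Y M (x, y) i Hq).
      assert (A1 := rb M' i (x, y0) BM). assert (A2 := rb M' i (x, y) BM).
      assert (A3 : Rabs (RInt (fun t => row_mul Y B' i (x, t)) y0 y) <= 2 * C * S0).
      { apply rbI; auto. intros t. apply continuous_section_y. now apply row_mul_continuous. }
      apply Rabs_le_between in A1. apply Rabs_le_between in A2. apply Rabs_le_between in A3.
      apply Rabs_le_between. unfold M' in *. lra.
    - intros i [x y] Hq. destruct (proj1 (ball_R2 (x0, y0) (x, y) r) Hq) as [hx hy]. simpl in hx, hy.
      unfold H, Yy, goursat_y; simpl. rewrite -(rm Y N (x, y) i Hq).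
      assert (A1 := rb N' i (x0, y) BN). assert (A2 := rb N' i (x, y) BN).
      assert (A3 : Rabs (RInt (fun t => row_mul Y B' i (t, y)) x0 x) <= 2 * C * S0).
      { apply rbI; auto. intros t. apply continuous_section_x. now apply row_mul_continuous. }
      apply Rabs_le_between in A1. apply Rabs_le_between in A2. apply Rabs_le_between in A3.
      apply Rabs_le_between. unfold N' in *. lra. }
  intros i q Hq. split; [apply CY'|]. destruct (Z i q Hq) as [ZG ZH].
  apply partials_eq with (Yx i q) (Yy i q); [now apply PY | unfold G in ZG; lra | unfold H in ZH; lra].
Qed.

(** * The flat connection of the moving frame *)

(** The row [(P, Q)] solves [d(P, Q) = (P, Q) A], where [A] is the matrix with rows
    [(w2, w1 + w12) / 2] and [(w1 - w12, - w2) / 2]. Continuity is part of the definition because the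
    formulas for the partial derivatives involve [P] and [Q] themselves, and do not imply it at a
    single point. *)
Definition frame_solution (a1 b1 a2 b2 k l : R2 -> R) (P Q : R2 -> R) (p : R2) : Prop :=
  continuous P p /\ continuous Q p /\
  partials P p ((P p * a2 p + Q p * (a1 p - k p)) / 2)
               ((P p * b2 p + Q p * (b1 p - l p)) / 2) /\
  partials Q p ((P p * (a1 p + k p) - Q p * a2 p) / 2)
               ((P p * (b1 p + l p) - Q p * b2 p) / 2).

Lemma partials_scal c g p a b :
  partials g p a b -> partials (fun q => c * g q) p (c * a) (c * b).
Proof. intros []; split; now apply: is_derive_scal. Qed.

Lemma partials_cos g p a b : partials g p a b ->
  partials (fun q => cos (g q)) p (- (a * sin (g p))) (- (b * sin (g p))).
Proof.
  intros H. eapply partials_eq; [apply (partials_comp cos g p a b (- sin (g p)))|ring|ring].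
  - apply is_derive_Reals, derivable_pt_lim_cos.
  - exact H.
Qed.

Lemma partials_sin g p a b : partials g p a b ->
  partials (fun q => sin (g q)) p (a * cos (g p)) (b * cos (g p)).
Proof.
  intros H. apply partials_comp; [apply is_derive_Reals, derivable_pt_lim_sin | exact H].
Qed.

Lemma partials_div2 g p a b : partials g p a b -> partials (fun q => g q / 2) p (a / 2) (b / 2).
Proof.
  intros H. apply partials_ext_loc with (fun q => / 2 * g q).
  - apply: filter_forall => q. field.
  - eapply partials_eq; [exact (partials_scal (/ 2) g p a b H) | field | field].
Qed.

Section Rotation.
Variables (U : R2 -> Prop) (a1 b1 a2 b2 k l : R2 -> R).
Hypotheses (HU : open U) (HS : structure_equations U a1 b1 a2 b2 k l).

(** The substitution [P + i Q = exp (i psi / 2) (p + i q)] replaces [w12] by [w12 - dpsi = beta dy] and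
    [w2 + i w1] by [exp (- i psi) (w2 + i w1)]. The system for [(p, q)] therefore has coefficients that
    are differentiable in the transversal direction, as required for solvability. *)
Lemma frame_solution_exists (p0 : R2) : U p0 ->
  exists r : posreal, (forall q, ball p0 r q -> U q) /\
    forall P0 Q0 : R, exists P Q : R2 -> R, P p0 = P0 /\ Q p0 = Q0 /\
      forall q, ball p0 r q -> frame_solution a1 b1 a2 b2 k l P Q q.
Proof.
  intros Hp0.
  destruct (rotation_angle U a1 b1 a2 b2 k l p0 HU HS Hp0) as (r & psi & beta & HrU & Hpsi).
  set (V := fun q : R2 => ball p0 r q).
  assert (HV : open V) by apply open_ball.
  set (c := fun q => cos (psi q)). set (s := fun q => sin (psi q)).
  assert (Dpsi : forall q, V q -> partials psi q (k q) (l q - beta q)) by (intros q Hq; now apply Hpsi).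
  assert (Dc : forall q, V q -> partials c q (- (k q * s q)) (- ((l q - beta q) * s q))).
  { intros q Hq. now apply partials_cos, Dpsi. }
  assert (Ds : forall q, V q -> partials s q (k q * c q) ((l q - beta q) * c q)).
  { intros q Hq. now apply partials_sin, Dpsi. }
  assert (Ck : forall q, V q -> continuous k q) by (intros; apply (se_k _ _ _ _ _ _ _ HS); auto).
  assert (Cl : forall q, V q -> continuous l q) by (intros; apply (se_l _ _ _ _ _ _ _ HS); auto).
  assert (Cbeta : forall q, V q -> continuous beta q) by (intros q Hq; now apply Hpsi).
  assert (Clb : forall q, V q -> continuous (fun q => l q - beta q) q)
    by (intros; apply: continuous_minus; auto).
  assert (Cpsi : forall q, V q -> continuous psi q).
  { intros q Hq. apply (C1_continuous V psi q HV); [|exact Hq].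
    apply (C1_intro V psi k (fun q => l q - beta q)); auto. }
  assert (Cc : forall q, V q -> continuous c q).
  { intros q Hq. apply (continuous_comp psi cos); [auto | apply continuous_cos]. }
  assert (Cs : forall q, V q -> continuous s q).
  { intros q Hq. apply (continuous_comp psi sin); [auto | apply continuous_sin]. }
  assert (Da1 := fun q (Hq : V q) => C1_partials U a1 q (se_a1 _ _ _ _ _ _ _ HS) (HrU q Hq)).
  assert (Db1 := fun q (Hq : V q) => C1_partials U b1 q (se_b1 _ _ _ _ _ _ _ HS) (HrU q Hq)).
  assert (Da2 := fun q (Hq : V q) => C1_partials U a2 q (se_a2 _ _ _ _ _ _ _ HS) (HrU q Hq)).
  assert (Db2 := fun q (Hq : V q) => C1_partials U b2 q (se_b2 _ _ _ _ _ _ _ HS) (HrU q Hq)).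
  assert (Ca1 := fun q (Hq : V q) => C1_continuous U a1 q HU (se_a1 _ _ _ _ _ _ _ HS) (HrU q Hq)).
  assert (Cb1 := fun q (Hq : V q) => C1_continuous U b1 q HU (se_b1 _ _ _ _ _ _ _ HS) (HrU q Hq)).
  assert (Ca2 := fun q (Hq : V q) => C1_continuous U a2 q HU (se_a2 _ _ _ _ _ _ _ HS) (HrU q Hq)).
  assert (Cb2 := fun q (Hq : V q) => C1_continuous U b2 q HU (se_b2 _ _ _ _ _ _ _ HS) (HrU q Hq)).
  assert (Ca1y := fun q (Hq : V q) => C1_continuous_dy U a1 q (se_a1 _ _ _ _ _ _ _ HS) (HrU q Hq)).
  assert (Ca2y := fun q (Hq : V q) => C1_continuous_dy U a2 q (se_a2 _ _ _ _ _ _ _ HS) (HrU q Hq)).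
  (* The rotated coframe; [a1y], [a2y], [b1x], [b2x] are its transversal derivatives. *)
  set (a1' := fun q => a1 q * c q - a2 q * s q). set (a2' := fun q => a2 q * c q + a1 q * s q).
  set (b1' := fun q => b1 q * c q - b2 q * s q). set (b2' := fun q => b2 q * c q + b1 q * s q).
  set (a1y := fun q => dy a1 q * c q - dy a2 q * s q - a2' q * (l q - beta q)).
  set (a2y := fun q => dy a2 q * c q + dy a1 q * s q + a1' q * (l q - beta q)).
  set (b1x := fun q => dx b1 q * c q - dx b2 q * s q - b2' q * k q).
  set (b2x := fun q => dx b2 q * c q + dx b1 q * s q + b1' q * k q).
  assert (Da1' : forall q, V q -> is_derive (fun t => a1' (fst q, t)) (snd q) (a1y q)).
  { intros q Hq. evar_last; [apply: (proj2 (partials_minus _ _ q _ _ _ _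
      (partials_mult _ _ q _ _ _ _ (Da1 q Hq) (Dc q Hq)) (partials_mult _ _ q _ _ _ _ (Da2 q Hq) (Ds q Hq))))|].
    unfold a1y, a2'. ring_R. }
  assert (Da2' : forall q, V q -> is_derive (fun t => a2' (fst q, t)) (snd q) (a2y q)).
  { intros q Hq. evar_last; [apply: (proj2 (partials_plus _ _ q _ _ _ _
      (partials_mult _ _ q _ _ _ _ (Da2 q Hq) (Dc q Hq)) (partials_mult _ _ q _ _ _ _ (Da1 q Hq) (Ds q Hq))))|].
    unfold a2y, a1'. ring_R. }
  assert (Db1' : forall q, V q -> is_derive (fun t => b1' (t, snd q)) (fst q) (b1x q)).
  { intros q Hq. evar_last; [apply: (proj1 (partials_minus _ _ q _ _ _ _
      (partials_mult _ _ q _ _ _ _ (Db1 q Hq) (Dc q Hq)) (partials_mult _ _ q _ _ _ _ (Db2 q Hq) (Ds q Hq))))|].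
    unfold b1x, b2'. ring_R. }
  assert (Db2' : forall q, V q -> is_derive (fun t => b2' (t, snd q)) (fst q) (b2x q)).
  { intros q Hq. evar_last; [apply: (proj1 (partials_plus _ _ q _ _ _ _
      (partials_mult _ _ q _ _ _ _ (Db2 q Hq) (Dc q Hq)) (partials_mult _ _ q _ _ _ _ (Db1 q Hq) (Ds q Hq))))|].
    unfold b2x, b1'. ring_R. }
  set (W := fun q => a1 q * b2 q - a2 q * b1 q).
  assert (Dbeta : forall q, V q -> is_derive (fun t => beta (t, snd q)) (fst q) (W q)) by (intros q Hq; now apply Hpsi).
  set (mk := fun (u v v' : R2 -> R) (j i : bool) (q : R2) =>
    match j, i with true, true => u q / 2 | true, false => v q / 2 | false, true => v' q / 2
    | false, false => - (u q / 2) end).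
  set (M := mk a2' a1' a1'). set (N := mk b2' (fun q => b1' q + beta q) (fun q => b1' q - beta q)).
  set (My := mk a2y a1y a1y). set (Nx := mk b2x (fun q => b1x q + W q) (fun q => b1x q - W q)).
  assert (Cmk : forall (u v v' : R2 -> R) q, continuous u q -> continuous v q -> continuous v' q ->
            forall j i, continuous (mk u v v' j i) q).
  { assert (h : forall (u : R2 -> R) q, continuous u q -> continuous (fun q => u q / 2) q).
    { intros u q Hu. apply: continuous_mult; [exact Hu | apply continuous_const]. }
    intros u v v' q Hu Hv Hv' [] []; unfold mk; auto. apply: continuous_opp. auto. }
  assert (Ca1' : forall q, V q -> continuous a1' q)
    by (intros; apply: continuous_minus; apply: continuous_mult; auto).
  assert (Ca2' : forall q, V q -> continuous a2' q)
    by (intros; apply: continuous_plus; apply: continuous_mult; auto).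
  assert (Cb1' : forall q, V q -> continuous b1' q)
    by (intros; apply: continuous_minus; apply: continuous_mult; auto).
  assert (Cb2' : forall q, V q -> continuous b2' q)
    by (intros; apply: continuous_plus; apply: continuous_mult; auto).
  assert (Hp0V : V p0) by apply ball_center.
  destruct (flat_system_solvable V M N My Nx p0 HV Hp0V) as (r' & Hr' & Sol).
  - intros j i q Hq. apply Cmk; auto.
  - intros j i q Hq. apply Cmk; auto.
    + apply: continuous_plus; auto.
    + apply: continuous_minus; auto.
  - intros j i q Hq. apply Cmk.
    + apply: continuous_plus; [apply: continuous_plus|]; apply: continuous_mult; auto.
    + apply: continuous_minus; [apply: continuous_minus|]; apply: continuous_mult; auto.
    + apply: continuous_minus; [apply: continuous_minus|]; apply: continuous_mult; auto.
  - assert (h : forall (u : R -> R) t d, is_derive u t d -> is_derive (fun t => u t / 2) t (d / 2)).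
    { intros u t d Hu. evar_last; [apply: is_derive_scal_l; exact Hu|]. reflexivity. }
    intros [] [] q Hq; unfold M, My, mk; auto. apply: is_derive_opp. auto.
  - assert (h : forall (u : R -> R) t d, is_derive u t d -> is_derive (fun t => u t / 2) t (d / 2)).
    { intros u t d Hu. evar_last; [apply: is_derive_scal_l; exact Hu|]. reflexivity. }
    intros [] [] q Hq; unfold N, Nx, mk; auto.
    + apply h. apply: is_derive_plus; auto.
    + apply h. apply: is_derive_minus; auto.
    + apply: is_derive_opp. auto.
  - assert (W' : forall q, a1' q * b2' q - a2' q * b1' q = W q).
    { intros q. unfold a1', b2', a2', b1', W, c, s.
      assert (E := sin2_cos2 (psi q)). unfold Rsqr in E.
      transitivity ((a1 q * b2 q - a2 q * b1 q) * (sin (psi q) * sin (psi q) + cos (psi q) * cos (psi q))); [ring|].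
      rewrite E. ring. }
    assert (E1 : forall q, V q -> b1x q - a1y q = - (a2' q * beta q)).
    { intros q Hq. assert (d1 := se_d1 _ _ _ _ _ _ _ HS q (HrU q Hq)).
      assert (d2 := se_d2 _ _ _ _ _ _ _ HS q (HrU q Hq)).
      unfold b1x, a1y.
      transitivity ((dx b1 q - dy a1 q) * c q - (dx b2 q - dy a2 q) * s q - b2' q * k q + a2' q * (l q - beta q)); [ring|].
      rewrite d1 d2. unfold a2', b2'. ring. }
    assert (E2 : forall q, V q -> b2x q - a2y q = a1' q * beta q).
    { intros q Hq. assert (d1 := se_d1 _ _ _ _ _ _ _ HS q (HrU q Hq)).
      assert (d2 := se_d2 _ _ _ _ _ _ _ HS q (HrU q Hq)).
      unfold b2x, a2y.
      transitivity ((dx b2 q - dy a2 q) * c q + (dx b1 q - dy a1 q) * s q + b1' q * k q - a1' q * (l q - beta q)); [ring|].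
      rewrite d1 d2. unfold a1', b1'. ring. }
    intros [] [] q Hq; unfold row_mul, M, N, My, Nx, mk;
      specialize (E1 q Hq); specialize (E2 q Hq); specialize (W' q); lra.
  - exists r'. split; [intros q Hq; now apply HrU, Hr'|]. intros P0 Q0.
    (* Rotating the values by half the angle undoes the rotation of the frame by [psi]. *)
    set (ch := fun q => cos (psi q / 2)). set (sh := fun q => sin (psi q / 2)).
    destruct (Sol (fun i => if i then ch p0 * P0 + sh p0 * Q0 else ch p0 * Q0 - sh p0 * P0)) as (Y & Y0 & DY).
    set (p := Y true). set (q := Y false).
    assert (T : forall z, ch z * ch z + sh z * sh z = 1).
    { intros z. assert (E := sin2_cos2 (psi z / 2)). unfold Rsqr in E. unfold ch, sh. lra. }
    exists (fun z => ch z * p z - sh z * q z), (fun z => sh z * p z + ch z * q z).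
    split; [|split].
    + unfold p, q. rewrite !Y0.
      transitivity ((ch p0 * ch p0 + sh p0 * sh p0) * P0); [ring | rewrite T; ring].
    + unfold p, q. rewrite !Y0.
      transitivity ((ch p0 * ch p0 + sh p0 * sh p0) * Q0); [ring | rewrite T; ring].
    + intros z Hz. assert (Hz' := Hr' z Hz).
      destruct (DY true z Hz) as [Cp Dp]. destruct (DY false z Hz) as [Cq Dq].
      assert (Cch : continuous ch z).
      { apply (continuous_comp psi (fun t => cos (t / 2))); [now apply Cpsi|].
        apply: ex_derive_continuous. auto_derive. auto. }
      assert (Csh : continuous sh z).
      { apply (continuous_comp psi (fun t => sin (t / 2))); [now apply Cpsi|].
        apply: ex_derive_continuous. auto_derive. auto. }
      assert (Dch := partials_cos _ _ _ _ (partials_div2 _ _ _ _ (Dpsi z Hz'))).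
      assert (Dsh := partials_sin _ _ _ _ (partials_div2 _ _ _ _ (Dpsi z Hz'))).
      assert (c2 : c z = ch z * ch z - sh z * sh z).
      { unfold c, ch, sh. replace (psi z) with (2 * (psi z / 2)) at 1 by field. apply cos_2a. }
      assert (s2 : s z = 2 * sh z * ch z).
      { unfold s, ch, sh. replace (psi z) with (2 * (psi z / 2)) at 1 by field. apply sin_2a. }
      split; [apply: continuous_minus; now apply: continuous_mult|].
      split; [apply: continuous_plus; now apply: continuous_mult|].
      split.
      * eapply partials_eq; [apply (partials_minus _ _ z _ _ _ _ (partials_mult _ _ z _ _ _ _ Dch Dp)
           (partials_mult _ _ z _ _ _ _ Dsh Dq))| |];
        fold (ch z) (sh z); fold p q; unfold row_mul, M, N, mk, a1', a2', b1', b2';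
        rewrite c2 s2; fold p q.
        -- transitivity ((ch z * ch z + sh z * sh z) * ((ch z * p z - sh z * q z) * a2 z
             + (sh z * p z + ch z * q z) * a1 z) / 2 - (sh z * p z + ch z * q z) * k z / 2);
             [field | rewrite T; field].
        -- transitivity ((ch z * ch z + sh z * sh z) * ((ch z * p z - sh z * q z) * b2 z
             + (sh z * p z + ch z * q z) * b1 z) / 2 - (sh z * p z + ch z * q z) * l z / 2);
             [field | rewrite T; field].
      * eapply partials_eq; [apply (partials_plus _ _ z _ _ _ _ (partials_mult _ _ z _ _ _ _ Dsh Dp)
           (partials_mult _ _ z _ _ _ _ Dch Dq))| |];
        fold (ch z) (sh z); fold p q; unfold row_mul, M, N, mk, a1', a2', b1', b2';
        rewrite c2 s2; fold p q.
        -- transitivity ((ch z * ch z + sh z * sh z) * ((ch z * p z - sh z * q z) * a1 z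
             - (sh z * p z + ch z * q z) * a2 z) / 2 + (ch z * p z - sh z * q z) * k z / 2);
             [field | rewrite T; field].
        -- transitivity ((ch z * ch z + sh z * sh z) * ((ch z * p z - sh z * q z) * b1 z
             - (sh z * p z + ch z * q z) * b2 z) / 2 + (ch z * p z - sh z * q z) * l z / 2);
             [field | rewrite T; field].
Qed.

End Rotation.

(** The matrix of the connection has trace zero. *)
Lemma wronskian_constant (a1 b1 a2 b2 k l P Q P' Q' : R2 -> R) (p : R2) :
  frame_solution a1 b1 a2 b2 k l P Q p -> frame_solution a1 b1 a2 b2 k l P' Q' p ->
  partials (fun q => P q * Q' q - P' q * Q q) p 0 0.
Proof.
  intros (_ & _ & DP & DQ) (_ & _ & DP' & DQ').
  eapply partials_eq; [apply (partials_minus _ _ p _ _ _ _ (partials_mult _ _ p _ _ _ _ DP DQ')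
     (partials_mult _ _ p _ _ _ _ DP' DQ))| |]; field.
Qed.

(** * Monodromy *)

Definition clamp01 (t : R) : R := Rmax 0 (Rmin 1 t).

Lemma clamp01_le0 t : t <= 0 -> clamp01 t = 0.
Proof. intros H. unfold clamp01, Rmax, Rmin. destruct (Rle_dec 1 t), Rle_dec; lra. Qed.

Lemma clamp01_ge1 t : 1 <= t -> clamp01 t = 1.
Proof. intros H. unfold clamp01, Rmax, Rmin. destruct (Rle_dec 1 t), Rle_dec; lra. Qed.

Lemma clamp01_id t : 0 <= t <= 1 -> clamp01 t = t.
Proof. intros H. unfold clamp01, Rmax, Rmin. destruct (Rle_dec 1 t), Rle_dec; lra. Qed.

Lemma continuous_clamp01 t : continuous clamp01 t.
Proof.
  apply continuous_eps. intros eps. exists eps. intros y Hy. change (Rabs (y - t) < eps) in Hy.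
  unfold clamp01. eapply Rle_lt_trans; [apply Rabs_Rmax_diff|].
  eapply Rle_lt_trans; [apply Rabs_Rmin_diff | exact Hy].
Qed.

(** The polygonal line through [X 0], ..., [X n], at unit speed in the index; a sum of clamped
    terms is continuous without any gluing. *)
Fixpoint polyline (X : nat -> R) (n : nat) (t : R) : R :=
  match n with
  | O => X O
  | S m => polyline X m t + clamp01 (t - INR m) * (X (S m) - X m)
  end.

Lemma polyline_continuous X n t : continuous (polyline X n) t.
Proof.
  induction n as [|n IH]; simpl; [apply continuous_const|].
  apply: continuous_plus; [exact IH|]. apply: continuous_mult; [|apply continuous_const].
  apply continuous_comp; [|apply continuous_clamp01].
  apply: continuous_minus; [apply continuous_id | apply continuous_const].
Qed.

Lemma polyline_after X n t : INR n <= t -> polyline X n t = X n.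
Proof.
  induction n as [|n IH]; intros H; simpl; [reflexivity|].
  rewrite S_INR in H. rewrite IH; [|lra]. rewrite clamp01_ge1; [ring | lra].
Qed.

Lemma polyline_before X m n t : (m <= n)%nat -> t <= INR m -> polyline X n t = polyline X m t.
Proof.
  induction 1 as [|n Hn IH]; intros H; [reflexivity|]. simpl. rewrite IH //.
  apply le_INR in Hn. rewrite clamp01_le0; [ring | lra].
Qed.

Lemma polyline_segment X i n u : (i < n)%nat -> 0 <= u <= 1 ->
  polyline X n (INR i + u) = X i + u * (X (S i) - X i).
Proof.
  intros Hi Hu. rewrite (polyline_before X (S i)); [|exact Hi | rewrite S_INR; lra].
  simpl. rewrite polyline_after; [|lra]. rewrite clamp01_id; [|lra].
  replace (INR i + u - INR i) with u by ring. reflexivity.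
Qed.

Lemma continuous_continuous_on {T V : UniformSpace} (D : T -> Prop) (f : T -> V) :
  (forall x, continuous f x) -> continuous_on D f.
Proof.
  intros H x _. apply: filterlim_filter_le_1 (H x). apply filter_le_within.
Qed.

Lemma ball_convex (p x y : R2) (r u : R) : ball p r x -> ball p r y -> 0 <= u <= 1 ->
  ball p r ((fst x + u * (fst y - fst x), snd x + u * (snd y - snd x)) : R2).
Proof.
  intros Hx Hy Hu.
  destruct (proj1 (ball_R2 p x r) Hx) as [x1 x2]. destruct (proj1 (ball_R2 p y r) Hy) as [y1 y2].
  apply (proj2 (ball_R2 p _ r)); simpl.
  assert (A : forall c a b, Rabs (a - c) < r -> Rabs (b - c) < r -> Rabs (a + u * (b - a) - c) < r).
  { intros c a b Ha Hb. apply Rabs_def2 in Ha as [Ha1 Ha2]. apply Rabs_def2 in Hb as [Hb1 Hb2].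
    destruct (Req_dec u 0) as [->|Hu0]; [apply Rabs_def1; lra|].
    assert (Hu' : 0 < u) by lra.
    assert (A1 := Rmult_lt_0_compat u (r - (b - c)) Hu' ltac:(lra)).
    assert (A2 := Rmult_le_pos (1 - u) (r - (a - c)) ltac:(lra) ltac:(lra)).
    assert (A3 := Rmult_lt_0_compat u (r + (b - c)) Hu' ltac:(lra)).
    assert (A4 := Rmult_le_pos (1 - u) (r + (a - c)) ltac:(lra) ltac:(lra)).
    apply Rabs_def1; lra. }
  split; now apply A.
Qed.

(** Analytic continuation along paths, for an abstract notion [sol] of local solution with values
    in [S]; [Inv] is a property of values preserved by continuation. *)
Section Monodromy.
Variables (S : Type) (Inv : S -> Prop) (Omega : R2 -> Prop) (sol : (R2 -> S) -> R2 -> Prop).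

(** Uniqueness is asked for on the intersection with an arbitrary second ball: two local solutions
    are always compared on the overlap of their domains, which is a rectangle. *)
Definition good_ball (c : R2) (r : posreal) : Prop :=
  (forall q, ball c r q -> Omega q) /\
  (forall q s, ball c r q -> Inv s ->
     exists F, F q = s /\ forall z, ball c r z -> sol F z /\ Inv (F z)) /\
  (forall (c' : R2) (r' : posreal) F G q q',
     (forall z, ball c r z -> ball c' r' z -> sol F z /\ sol G z) ->
     ball c r q -> ball c' r' q -> ball c r q' -> ball c' r' q' -> F q = G q -> F q' = G q').

Hypothesis good : forall p, Omega p -> exists r, good_ball p r.

Definition link (p : R2) (s : S) (q : R2) (s' : S) : Prop :=
  exists c r F, good_ball c r /\ ball c r p /\ ball c r q /\
    (forall z, ball c r z -> sol F z /\ Inv (F z)) /\ F p = s /\ F q = s'.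

Lemma link_sym p s q s' : link p s q s' -> link q s' p s.
Proof. intros (c & r & F & H & Hp & Hq & HF & E & E'). exists c, r, F. tauto. Qed.

Lemma link_Inv p s q s' : link p s q s' -> Inv s /\ Inv s'.
Proof. intros (c & r & F & H & Hp & Hq & HF & <- & <-). split; now apply HF. Qed.

Lemma link_exists c r p q s : good_ball c r -> ball c r p -> ball c r q -> Inv s ->
  exists s', link p s q s'.
Proof.
  intros H Hp Hq Hs. destruct (proj1 (proj2 H) p s Hp Hs) as (F & E & HF).
  exists (F q), c, r, F. tauto.
Qed.

(** Uniqueness on the overlap of two good balls: a link observed in one ball is realised by every
    solution on another ball that contains both points. *)
Lemma link_in_ball c r F p q s' : good_ball c r -> ball c r p -> ball c r q ->
  (forall z, ball c r z -> sol F z /\ Inv (F z)) -> link p (F p) q s' -> F q = s'.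
Proof.
  intros H Hp Hq HF (c' & r' & G & H' & Hp' & Hq' & HG & E & E').
  rewrite -E'. apply (proj2 (proj2 H) c' r' F G p q); auto.
  intros z Hz Hz'. split; [now apply HF | now apply HG].
Qed.

Lemma link_refl_eq p s s' : link p s p s' -> s = s'.
Proof. intros (c & r & F & _ & _ & _ & _ & <- & <-). reflexivity. Qed.

Inductive reach (p : R2) (s : S) : R2 -> S -> Prop :=
| reach_refl : reach p s p s
| reach_step q t q' t' : reach p s q t -> link q t q' t' -> reach p s q' t'.

Lemma reach_trans p s q t q' t' : reach p s q t -> reach q t q' t' -> reach p s q' t'.
Proof. intros H. induction 1; [exact H | now apply reach_step with q0 t0]. Qed.

Lemma reach_sym p s q t : reach p s q t -> reach q t p s.
Proof.
  induction 1 as [|q t q' t' _ IH L]; [apply reach_refl|].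
  apply reach_trans with q t; [|exact IH].
  apply reach_step with q' t'; [apply reach_refl | now apply link_sym].
Qed.

Lemma reach_Inv p s q t : reach p s q t -> Inv s -> Inv t.
Proof. intros H Hs. destruct H as [|q t q' t' _ L]; [exact Hs | apply (link_Inv _ _ _ _ L)]. Qed.

(** Lebesgue number of the cover of the image of the square by good balls. *)
Lemma lebesgue_good_ball (H : R2 -> R2) :
  continuous_on unit_square H -> (forall q, unit_square q -> Omega (H q)) ->
  exists d : posreal, forall a b, unit_square (a, b) -> exists c r, good_ball c r /\
    forall x y, unit_square (x, y) -> Rabs (x - a) < d -> Rabs (y - b) < d -> ball c r (H (x, y)).
Proof.
  intros HC HO.
  assert (D : forall q : R2, exists e : posreal, unit_square q -> exists r, good_ball (H q) r /\
    forall x y, unit_square (x, y) -> Rabs (x - fst q) < 2 * e -> Rabs (y - snd q) < 2 * e ->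
    ball (H q) r (H (x, y))).
  { intros q. destruct (Classical_Prop.classic (unit_square q)) as [h|h].
    - destruct (good (H q) (HO q h)) as [r Hr].
      assert (L := HC q h (fun z => ball (H q) r z) (locally_ball (H q) r)).
      destruct L as [e He]. exists (pos_div_2 e). intros _. exists r. split; [exact Hr|].
      intros x y Hxy Hx Hy. apply He; [|exact Hxy]. simpl in Hx, Hy.
      apply (proj2 (ball_R2 q (x, y) e)); simpl. split; lra.
    - exists (mkposreal 1 Rlt_0_1). tauto. }
  destruct (choice _ D) as [delta Hdelta].
  destruct (compactness_value_2d 0 1 0 1 (fun u v => delta (u, v))) as [d Hd].
  exists d. intros a b [Ha Hb]. apply Classical_Prop.NNPP. intros N.
  apply (Hd a b Ha Hb). intros (u & v & Hu & Hv & Hau & Hbv & Hduv). apply N.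
  destruct (Hdelta (u, v) (conj Hu Hv)) as (r & Hr & HB). simpl in HB.
  exists (H (u, v)), r. split; [exact Hr|]. intros x y Hxy Hx Hy.
  apply HB; [exact Hxy| |].
  - assert (T := Rabs_triang (x - a) (a - u)). replace (x - a + (a - u)) with (x - u) in T by ring. lra.
  - assert (T := Rabs_triang (y - b) (b - v)). replace (y - b + (b - v)) with (y - v) in T by ring. lra.
Qed.

Definition chain (h : nat -> R2) (N : nat) (V : nat -> S) : Prop :=
  forall j, (j < N)%nat -> link (h j) (V j) (h (Datatypes.S j)) (V (Datatypes.S j)).

Lemma chain_exists h N s : Inv s ->
  (forall j, (j < N)%nat -> exists c r, good_ball c r /\ ball c r (h j) /\ ball c r (h (Datatypes.S j))) ->
  exists V, V O = s /\ chain h N V.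
Proof.
  intros Hs Hg.
  destruct (choice (fun (js : nat * S) s' => (fst js < N)%nat -> Inv (snd js) ->
    link (h (fst js)) (snd js) (h (Datatypes.S (fst js))) s')) as [next Hn].
  { intros [j t]; simpl.
    destruct (Classical_Prop.classic ((j < N)%nat /\ Inv t)) as [[h1 h2]|h'].
    - destruct (Hg j h1) as (c & r & Hc & H1 & H2).
      destruct (link_exists c r _ _ t Hc H1 H2 h2) as [s' Hs']. now exists s'.
    - exists t. tauto. }
  set (V := fix V n := match n with O => s | Datatypes.S m => next (m, V m) end).
  exists V. split; [reflexivity|].
  assert (I : forall j, (j <= N)%nat -> Inv (V j)).
  { induction j as [|j IH]; intros Hj; [exact Hs|].
    apply (link_Inv _ _ _ _ (Hn (j, V j) Hj (IH ltac:(lia)))). }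
  intros j Hj. exact (Hn (j, V j) Hj (I j ltac:(lia))).
Qed.

Lemma chain_reach h N V : chain h N V -> forall j, (j <= N)%nat -> reach (h O) (V O) (h j) (V j).
Proof.
  intros H j. induction j as [|j IH]; intros Hj; [apply reach_refl|].
  apply reach_step with (h j) (V j); [apply IH; lia | apply H; lia].
Qed.

(** Two consecutive points of each chain lie in one good ball, where a single solution takes the
    four values. *)
Lemma chain_transfer h h' N V :
  chain h N V -> Inv (V O) ->
  (forall j, (j < N)%nat -> exists c r, good_ball c r /\ ball c r (h j) /\
     ball c r (h (Datatypes.S j)) /\ ball c r (h' j) /\ ball c r (h' (Datatypes.S j))) ->
  (0 < N)%nat ->
  exists W, chain h' N W /\ forall j, (j <= N)%nat -> link (h j) (V j) (h' j) (W j).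
Proof.
  intros HV HI Hg HN.
  assert (I : forall j, (j <= N)%nat -> Inv (V j)).
  { intros j Hj. now apply (reach_Inv _ _ _ _ (chain_reach _ _ _ HV j Hj)). }
  destruct (choice (fun j s' => (j <= N)%nat -> link (h j) (V j) (h' j) s')) as [W HW].
  { intros j. destruct (Compare_dec.le_dec j N) as [Hj|Hj]; [|exists (V O); lia].
    assert (B : exists c r, good_ball c r /\ ball c r (h j) /\ ball c r (h' j)).
    { destruct j as [|j].
      - destruct (Hg O HN) as (c & r & H1 & H2 & H3 & H4 & H5). exists c, r. tauto.
      - destruct (Hg j Hj) as (c & r & H1 & H2 & H3 & H4 & H5). exists c, r. tauto. }
    destruct B as (c & r & H1 & H2 & H3).
    destruct (link_exists c r _ _ (V j) H1 H2 H3 (I j Hj)) as [s' Hs']. now exists s'. }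
  exists W. split; [|exact HW]. intros j Hj.
  destruct (Hg j Hj) as (c & r & H1 & H2 & H3 & H4 & H5).
  destruct (proj1 (proj2 H1) (h j) (V j) H2 (I j ltac:(lia))) as (F & E & HF).
  assert (L0 := HV j Hj). assert (L1 := HW j ltac:(lia)). assert (L2 := HW (Datatypes.S j) Hj).
  rewrite -E in L0, L1.
  assert (E1 := link_in_ball c r F _ _ _ H1 H2 H3 HF L0). rewrite -E1 in L2.
  assert (E2 := link_in_ball c r F _ _ _ H1 H2 H4 HF L1).
  assert (E3 := link_in_ball c r F _ _ _ H1 H3 H5 HF L2).
  exists c, r, F. tauto.
Qed.

Lemma reach_sequence p s q t : reach p s q t ->
  exists (n : nat) (x : nat -> R2) (sigma : nat -> S),
    x O = p /\ sigma O = s /\ x n = q /\ sigma n = t /\ chain x n sigma.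
Proof.
  induction 1 as [|q t q' t' _ (n & x & sigma & X0 & S0 & Xn & Sn & HC) L].
  - exists O, (fun _ => p), (fun _ => s). repeat split; auto. intros j Hj. lia.
  - exists (Datatypes.S n), (fun i => if (i <=? n)%nat then x i else q'),
      (fun i => if (i <=? n)%nat then sigma i else t').
    split; [|split; [|split; [|split]]].
    + exact X0.
    + exact S0.
    + destruct (Nat.leb_spec (Datatypes.S n) n); [lia | reflexivity].
    + destruct (Nat.leb_spec (Datatypes.S n) n); [lia | reflexivity].
    + intros j Hj. destruct (Nat.leb_spec j n); [|lia].
      destruct (Nat.leb_spec (Datatypes.S j) n).
      * apply HC. lia.
      * replace j with n by lia. now rewrite Xn Sn.
Qed.

Lemma unit_fraction (N j : nat) : (0 < N)%nat -> (j <= N)%nat -> unit_interval (INR j / INR N).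
Proof.
  intros HN Hj. apply lt_0_INR in HN. apply le_INR in Hj. assert (h := pos_INR j). split.
  - apply Rmult_le_pos; [exact h | left; now apply Rinv_0_lt_compat].
  - apply Rmult_le_reg_r with (INR N); [exact HN|]. unfold Rdiv.
    rewrite Rmult_assoc Rinv_l; lra.
Qed.

Lemma fraction_step (N j : nat) (d : R) : (0 < N)%nat -> / INR N < d -> 0 < d ->
  Rabs (INR j / INR N - INR j / INR N) < d /\
  Rabs (INR (Datatypes.S j) / INR N - INR j / INR N) < d.
Proof.
  intros HN Hd d0. apply lt_0_INR in HN. split; [rewrite Rminus_diag Rabs_R0; exact d0|].
  rewrite S_INR. replace ((INR j + 1) / INR N - INR j / INR N) with (/ INR N) by (field; lra).
  rewrite Rabs_pos_eq; [exact Hd | left; now apply Rinv_0_lt_compat].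
Qed.

Lemma exists_large_nat (d : R) : 0 < d -> exists k, (0 < k)%nat /\ / INR k < d.
Proof.
  intros Hd. destruct (archimed_cor1 d Hd) as [k [H1 H2]]. now exists k.
Qed.

Lemma split_at_integer (n : nat) (t : R) : (0 < n)%nat -> 0 <= t <= INR n ->
  exists (i : nat) (u : R), (i < n)%nat /\ 0 <= u <= 1 /\ t = INR i + u.
Proof.
  induction n as [|n IH]; intros Hn Ht; [lia|].
  destruct (Rle_dec (INR n) t) as [h|h].
  - exists n, (t - INR n). rewrite S_INR in Ht. split; [lia | split; lra].
  - destruct n as [|n]; [simpl in h; lra|].
    destruct IH as (i & u & Hi & Hu & E); [lia | lra |].
    exists i, u. split; [lia | split; [exact Hu | exact E]].
Qed.

(** The polygon through the points of a closed chain is a loop; a contraction of this loop, cut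
    into small cells, transports the chain row by row to a constant chain. *)
Lemma reach_unique p s s' : simply_connected Omega -> Inv s -> reach p s p s' -> s = s'.
Proof.
  intros [_ SC] Hs HR.
  destruct (reach_sequence _ _ _ _ HR) as (n & x & sigma & X0 & S0 & Xn & Sn & HC).
  destruct n as [|n0]; [now rewrite -S0 -Sn|].
  set (n := Datatypes.S n0) in *. assert (Hn : (0 < n)%nat) by (unfold n; lia).
  assert (Hn' := lt_0_INR n Hn).
  set (gamma := fun t => (polyline (fun i => fst (x i)) n (INR n * t),
                          polyline (fun i => snd (x i)) n (INR n * t)) : R2).
  assert (Hseg : forall i u t, (i < n)%nat -> 0 <= u <= 1 -> INR n * t = INR i + u ->
    gamma t = (fst (x i) + u * (fst (x (Datatypes.S i)) - fst (x i)),
               snd (x i) + u * (snd (x (Datatypes.S i)) - snd (x i)))).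
  { intros i u t Hi Hu E. unfold gamma. rewrite E !polyline_segment //. }
  assert (Hgamma : path_in Omega gamma p p).
  { split; [|split; [|split]].
    - apply continuous_continuous_on. intros t.
      assert (Cl : continuous (fun t => INR n * t) t).
      { apply: continuous_mult; [apply continuous_const | apply continuous_id]. }
      apply (continuous_comp_2 (fun t => polyline (fun i => fst (x i)) n (INR n * t))
        (fun t => polyline (fun i => snd (x i)) n (INR n * t)) (fun u v => (u, v) : R2)).
      + apply (continuous_comp (fun t => INR n * t)); [exact Cl | apply polyline_continuous].
      + apply (continuous_comp (fun t => INR n * t)); [exact Cl | apply polyline_continuous].
      + apply continuous_ext with (fun z => z); [now intros [] | apply continuous_id].
    - intros t [Ht0 Ht1].
      destruct (split_at_integer n (INR n * t) Hn) as (i & u & Hi & Hu & E); [split; nra|].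
      rewrite (Hseg i u t Hi Hu E).
      destruct (HC i Hi) as (c & r & F & (HO & _) & H1 & H2 & _).
      apply HO. now apply ball_convex.
    - rewrite (Hseg O 0 0 Hn ltac:(lra)); [|simpl; ring]. rewrite X0. destruct p; simpl. f_equal; ring.
    - unfold gamma. rewrite Rmult_1_r !polyline_after; try lra. rewrite Xn. now destruct p. }
  destruct (SC p gamma Hgamma) as (H & CH & OH & H0 & H1 & Hside).
  destruct (lebesgue_good_ball H CH OH) as [d Hd].
  destruct (exists_large_nat d (cond_pos d)) as (k & Hk & Hkd).
  assert (Hk' := lt_0_INR k Hk).
  (* Each of the [n] sides of the polygon is divided into [k] steps, so that its vertices belong to
     the grid. *)
  set (N := (n * k)%nat). assert (HN : (0 < N)%nat) by (unfold N; nia).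
  assert (HN' := lt_0_INR N HN).
  assert (HNd : / INR N < d).
  { apply Rle_lt_trans with (/ INR k); [|exact Hkd]. apply Rinv_le_contravar; [exact Hk'|].
    apply le_INR. unfold N. nia. }
  set (h := fun i j : nat => H (INR i / INR N, INR j / INR N)).
  assert (Cell : forall i j, (i <= N)%nat -> (j < N)%nat -> exists c r, good_ball c r /\
    ball c r (h i j) /\ ball c r (h i (Datatypes.S j)) /\
    ((i < N)%nat -> ball c r (h (Datatypes.S i) j) /\ ball c r (h (Datatypes.S i) (Datatypes.S j)))).
  { intros i j Hi Hj.
    assert (ui := unit_fraction N i HN Hi). assert (uj := unit_fraction N j HN ltac:(lia)).
    assert (uj' := unit_fraction N (Datatypes.S j) HN Hj).
    destruct (Hd _ _ (conj ui uj)) as (c & r & Hc & HB).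
    destruct (fraction_step N i d HN HNd (cond_pos d)) as [fi fi'].
    destruct (fraction_step N j d HN HNd (cond_pos d)) as [fj fj'].
    exists c, r. split; [exact Hc|].
    split; [apply HB; auto; now split | split; [apply HB; auto; now split|]].
    intros Hi'. assert (ui' := unit_fraction N (Datatypes.S i) HN Hi').
    split; apply HB; auto; now split. }
  assert (Base : exists V, chain (h O) N V /\ V O = s /\ V N = s').
  { destruct (chain_exists (h O) N s Hs) as (V & V0 & HV).
    { intros j Hj. destruct (Cell O j ltac:(lia) Hj) as (c & r & A & B & C & _). exists c, r. tauto. }
    exists V. split; [exact HV | split; [exact V0|]].
    assert (Hh : forall i r, (i < n)%nat -> (r <= k)%nat -> h O (i * k + r)%nat =
      (fst (x i) + INR r / INR k * (fst (x (Datatypes.S i)) - fst (x i)),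
       snd (x i) + INR r / INR k * (snd (x (Datatypes.S i)) - snd (x i)))).
    { intros i r Hi Hr. unfold h.
      replace (INR 0 / INR N) with 0 by (simpl; field; lra).
      rewrite H0; [|apply unit_fraction; [exact HN | unfold N; nia]].
      apply Hseg; [exact Hi | now apply unit_fraction |].
      unfold N. rewrite plus_INR !mult_INR. field. lra. }
    (* Along the [i]-th side, the chain follows the solution that links its end points. *)
    assert (A : forall i, (i <= n)%nat -> V (i * k)%nat = sigma i).
    { induction i as [|i IH]; intros Hi; [simpl; now rewrite V0 S0|].
      destruct (HC i Hi) as (c & r & F & Hc & Bx & Bx' & HF & E & E').
      assert (B : forall m, (m <= k)%nat -> V (i * k + m)%nat = F (h O (i * k + m)%nat)).
      { induction m as [|m IHm]; intros Hm.
        - rewrite (Hh i O Hi ltac:(lia)) Nat.add_0_r IH; [|lia]. rewrite -E. f_equal.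
          simpl. destruct (x i); simpl. f_equal; field; lra.
        - symmetry.
          assert (Hm' : (i * k + m < N)%nat) by (unfold N; nia).
          assert (L := HV (i * k + m)%nat Hm'). rewrite IHm in L; [|lia].
          replace (i * k + Datatypes.S m)%nat with (Datatypes.S (i * k + m)) by lia.
          apply (link_in_ball c r F (h O (i * k + m)%nat)); auto.
          + rewrite (Hh i m Hi ltac:(lia)). apply ball_convex; auto. apply unit_fraction; lia.
          + replace (Datatypes.S (i * k + m)) with (i * k + Datatypes.S m)%nat by lia.
            rewrite (Hh i (Datatypes.S m) Hi Hm). apply ball_convex; auto. now apply unit_fraction. }
      replace (Datatypes.S i * k)%nat with (i * k + k)%nat by lia.
      rewrite B // (Hh i k Hi ltac:(lia)) -E'. f_equal.
      destruct (x (Datatypes.S i)); simpl. f_equal; field; lra. }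
    unfold N. rewrite A //. }
  (* The two lateral sides of the homotopy stay at [p], so the end values do not move. *)
  assert (Rows : forall i, (i <= N)%nat -> exists V, chain (h i) N V /\ V O = s /\ V N = s').
  { induction i as [|i IH]; intros Hi; [exact Base|].
    destruct IH as (V & HV & V0 & VN); [lia|].
    destruct (chain_transfer (h i) (h (Datatypes.S i)) N V HV) as (W & HW & LW); auto.
    { now rewrite V0. }
    { intros j Hj. destruct (Cell i j ltac:(lia) Hj) as (c & r & A & B & C & D).
      destruct (D Hi). exists c, r. tauto. }
    assert (side : forall i', (i' <= N)%nat -> h i' O = p /\ h i' N = p).
    { intros i' Hi'. unfold h. replace (INR 0 / INR N) with 0 by (simpl; field; lra).
      replace (INR N / INR N) with 1 by (field; lra). apply Hside. now apply unit_fraction. }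
    destruct (side i ltac:(lia)) as [e1 e2]. destruct (side (Datatypes.S i) Hi) as [e3 e4].
    exists W. split; [exact HW | split].
    - assert (L := LW O ltac:(lia)). rewrite e1 e3 in L. now rewrite -(link_refl_eq _ _ _ L).
    - assert (L := LW N ltac:(lia)). rewrite e2 e4 in L. now rewrite -(link_refl_eq _ _ _ L). }
  destruct (Rows N ltac:(lia)) as (V & HV & V0 & VN).
  assert (top : forall j, (j <= N)%nat -> h N j = p).
  { intros j Hj. unfold h. replace (INR N / INR N) with 1 by (field; lra).
    apply H1. now apply unit_fraction. }
  assert (const : forall j, (j <= N)%nat -> V j = s).
  { induction j as [|j IH]; intros Hj; [exact V0|].
    assert (L := HV j Hj). rewrite (top j ltac:(lia)) (top (Datatypes.S j) Hj) in L.
    rewrite -(link_refl_eq _ _ _ L). apply IH. lia. }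
  rewrite -VN. symmetry. apply const. lia.
Qed.

Lemma reach_exists p s q : simply_connected Omega -> Inv s -> Omega p -> Omega q ->
  exists s', reach p s q s'.
Proof.
  intros [PC _] Hs Hp Hq. destruct (PC p q Hp Hq) as (gamma & Cg & Og & g0 & g1).
  (* The path, read as a homotopy that does not depend on its first variable. *)
  destruct (lebesgue_good_ball (fun z => gamma (snd z))) as [d Hd].
  { intros z [_ Hz].
    apply: filterlim_comp; [|exact (Cg _ Hz)].
    intros A [e He]. exists e. intros z' Bz' [_ Uz']. apply He; [apply Bz' | exact Uz']. }
  { intros z [_ Hz]. now apply Og. }
  destruct (exists_large_nat d (cond_pos d)) as (N & HN & HNd).
  assert (HN' := lt_0_INR N HN).
  set (h := fun j : nat => gamma (INR j / INR N)).
  destruct (chain_exists h N s Hs) as (V & V0 & HV).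
  { intros j Hj.
    assert (uj := unit_fraction N j HN ltac:(lia)).
    assert (uj' := unit_fraction N (Datatypes.S j) HN Hj).
    assert (u0 : unit_interval 0) by (unfold unit_interval; lra).
    destruct (Hd 0 _ (conj u0 uj)) as (c & r & Hc & HB).
    destruct (fraction_step N j d HN HNd (cond_pos d)) as [fj fj'].
    assert (f0 : Rabs (0 - 0) < d) by (rewrite Rminus_diag Rabs_R0; apply cond_pos).
    exists c, r. split; [exact Hc|].
    split; [exact (HB 0 _ (conj u0 uj) f0 fj) | exact (HB 0 _ (conj u0 uj') f0 fj')]. }
  exists (V N). assert (A := chain_reach h N V HV N ltac:(lia)).
  unfold h in A. replace (INR 0 / INR N) with 0 in A by (simpl; field; lra).
  replace (INR N / INR N) with 1 in A by (field; lra). now rewrite g0 g1 V0 in A.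
Qed.

(** The value of [F] at [q] is the one reached from [s0] along any chain from [p0] to [q]; chains
    exist since the domain is path-connected, and all of them give the same value since it is
    simply connected. *)
Theorem monodromy p0 s0 : simply_connected Omega -> Inv s0 -> Omega p0 ->
  exists F : R2 -> S, F p0 = s0 /\
    forall q, Omega q -> Inv (F q) /\
      exists (r : posreal) G, forall z, ball q r z -> F z = G z /\ sol G z.
Proof.
  intros SC Hs Hp.
  destruct (choice (fun q s' => Omega q -> reach p0 s0 q s')) as [F HF].
  { intros q. destruct (Classical_Prop.classic (Omega q)) as [h|h]; [|exists s0; tauto].
    destruct (reach_exists p0 s0 q SC Hs Hp h) as [s' Hs']. now exists s'. }
  exists F. split; [symmetry; apply (reach_unique p0); auto|].
  intros q Hq. assert (Iq := reach_Inv _ _ _ _ (HF q Hq) Hs). split; [exact Iq|].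
  destruct (good q Hq) as [r Hr].
  destruct (proj1 (proj2 Hr) q (F q) (ball_center q r) Iq) as (G & E & HG).
  exists r, G. intros z Hz. split; [|now apply HG].
  assert (Hz' : Omega z) by now apply (proj1 Hr).
  apply (reach_unique z); auto.
  - apply (reach_Inv _ _ _ _ (HF z Hz') Hs).
  - apply reach_trans with q (F q).
    + apply reach_trans with p0 s0; [now apply reach_sym, HF | now apply HF].
    + apply reach_step with q (F q); [apply reach_refl|].
      exists q, r, G. split; [exact Hr|]. split; [apply ball_center|]. tauto.
Qed.

End Monodromy.

(** * Global solutions with values in the unimodular matrices *)

Lemma between_close (c a b t r : R) : Rabs (a - c) < r -> Rabs (b - c) < r ->
  Rmin a b <= t <= Rmax a b -> Rabs (t - c) < r.
Proof.
  intros Ha Hb Ht. apply Rabs_def2 in Ha as [? ?]. apply Rabs_def2 in Hb as [? ?].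
  apply Rabs_def1; unfold Rmin, Rmax in Ht; destruct Rle_dec; lra.
Qed.

(** The intersection of two balls is a rectangle, so that a horizontal segment followed by a vertical
    one joins any two of its points. *)
Lemma partials_zero_constant (c c' : R2) (r r' : R) (w : R2 -> R) (q q' : R2) :
  (forall z, ball c r z -> ball c' r' z -> partials w z 0 0) ->
  ball c r q -> ball c' r' q -> ball c r q' -> ball c' r' q' -> w q = w q'.
Proof.
  intros H h1 h2 h3 h4. destruct q as [x y], q' as [x' y'].
  destruct (proj1 (ball_R2 c (x, y) r) h1) as [a1 b1]. destruct (proj1 (ball_R2 c' (x, y) r') h2) as [a2 b2].
  destruct (proj1 (ball_R2 c (x', y') r) h3) as [a3 b3]. destruct (proj1 (ball_R2 c' (x', y') r') h4) as [a4 b4].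
  simpl in *.
  assert (B : forall s t, Rmin x x' <= s <= Rmax x x' -> Rmin y y' <= t <= Rmax y y' ->
    partials w (s, t) 0 0).
  { intros s t Hs Ht. apply H.
    - apply (proj2 (ball_R2 c (s, t) r)). split; simpl;
        [exact (between_close _ x x' s _ a1 a3 Hs) | exact (between_close _ y y' t _ b1 b3 Ht)].
    - apply (proj2 (ball_R2 c' (s, t) r')). split; simpl;
        [exact (between_close _ x x' s _ a2 a4 Hs) | exact (between_close _ y y' t _ b2 b4 Ht)]. }
  assert (E1 : w (x', y) - w (x, y) = 0).
  { apply (zero_of_half_pow_bounds _ 0). intros n. rewrite Rmult_0_l.
    rewrite -(Rmult_0_l (Rabs (x' - x))).
    apply (mvt_abs_bound (fun s => w (s, y)) (fun _ => 0)).
    - intros s Hs. apply (B s y Hs). split; [apply Rmin_l | apply Rmax_l].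
    - intros _ _. rewrite Rabs_R0. lra. }
  assert (E2 : w (x', y') - w (x', y) = 0).
  { apply (zero_of_half_pow_bounds _ 0). intros n. rewrite Rmult_0_l.
    rewrite -(Rmult_0_l (Rabs (y' - y))).
    apply (mvt_abs_bound (fun t => w (x', t)) (fun _ => 0)).
    - intros t Ht. refine (proj2 (B x' t _ Ht)). apply between_end.
    - intros _ _. rewrite Rabs_R0. lra. }
  lra.
Qed.

Section GlobalFrame.
Variables (U : R2 -> Prop) (a1 b1 a2 b2 k l : R2 -> R).
Hypotheses (HU : open U) (HS : structure_equations U a1 b1 a2 b2 k l).
Let fsol := frame_solution a1 b1 a2 b2 k l.

Lemma frame_solution_ext_loc P Q P' Q' p :
  locally p (fun q => P q = P' q /\ Q q = Q' q) -> fsol P Q p -> fsol P' Q' p.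
Proof.
  intros E (C1 & C2 & D1 & D2).
  assert (EP : locally p (fun q => P q = P' q)) by (apply: locally_imp E => q; tauto).
  assert (EQ : locally p (fun q => Q q = Q' q)) by (apply: locally_imp E => q; tauto).
  assert (EP' : locally p (fun q => P' q = P q)) by (apply: locally_imp EP => q; auto).
  assert (EQ' : locally p (fun q => Q' q = Q q)) by (apply: locally_imp EQ => q; auto).
  unfold fsol, frame_solution. rewrite -(locally_singleton _ _ EP) -(locally_singleton _ _ EQ).
  split; [|split; [|split]].
  - now apply continuous_ext_loc with P.
  - now apply continuous_ext_loc with Q.
  - now apply partials_ext_loc with P.
  - now apply partials_ext_loc with Q.
Qed.

Lemma frame_solution_combination alpha beta P Q P' Q' p : fsol P Q p -> fsol P' Q' p ->
  fsol (fun q => alpha * P q + beta * P' q) (fun q => alpha * Q q + beta * Q' q) p.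
Proof.
  intros (C1 & C2 & D1 & D2) (C1' & C2' & D1' & D2').
  assert (lin : forall g g' : R2 -> R, continuous g p -> continuous g' p ->
     continuous (fun q => alpha * g q + beta * g' q) p).
  { intros g g' Hg Hg'. apply: continuous_plus; apply: continuous_mult; auto using continuous_const. }
  split; [now apply lin | split; [now apply lin | split]].
  - eapply partials_eq; [apply (partials_plus _ _ p _ _ _ _ (partials_scal alpha _ _ _ _ D1)
     (partials_scal beta _ _ _ _ D1'))| |]; field.
  - eapply partials_eq; [apply (partials_plus _ _ p _ _ _ _ (partials_scal alpha _ _ _ _ D2)
     (partials_scal beta _ _ _ _ D2'))| |]; field.
Qed.

Definition mat : Type := (R * R * R * R)%type.
Definition ma (m : mat) : R := fst (fst (fst m)).
Definition mb (m : mat) : R := snd (fst (fst m)).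
Definition mc (m : mat) : R := snd (fst m).
Definition md (m : mat) : R := snd m.

Definition unimodular (m : mat) : Prop := ma m * md m - mb m * mc m = 1.

Definition matrix_solution (F : R2 -> mat) (p : R2) : Prop :=
  fsol (fun q => ma (F q)) (fun q => mb (F q)) p /\
  fsol (fun q => mc (F q)) (fun q => md (F q)) p.

(** A pair of solutions with Wronskian 1 on a ball yields all solutions there by linear
    combination; Wronskians with this pair are constant, which gives uniqueness. *)
Lemma good_ball_exists p : U p -> exists r, good_ball mat unimodular U matrix_solution p r.
Proof.
  intros Hp. destruct (frame_solution_exists U a1 b1 a2 b2 k l HU HS p Hp) as (r & HrU & Sol).
  destruct (Sol 1 0) as (P1 & Q1 & P10 & Q10 & S1).
  destruct (Sol 0 1) as (P2 & Q2 & P20 & Q20 & S2).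
  assert (W : forall q, ball p r q -> P1 q * Q2 q - P2 q * Q1 q = 1).
  { intros q Hq. transitivity (P1 p * Q2 p - P2 p * Q1 p).
    - symmetry.
      apply (partials_zero_constant p p r r (fun q => P1 q * Q2 q - P2 q * Q1 q)); auto using ball_center.
      intros z Hz _. apply (wronskian_constant a1 b1 a2 b2 k l); auto.
    - rewrite P10 Q10 P20 Q20. ring. }
  exists r. split; [exact HrU|split].
  - intros q [[[a b] c] d] Hq Hs. unfold unimodular, ma, mb, mc, md in Hs; simpl in Hs.
    set (al := a * Q2 q - b * P2 q). set (be := b * P1 q - a * Q1 q).
    set (ga := c * Q2 q - d * P2 q). set (de := d * P1 q - c * Q1 q).
    exists (fun z => (al * P1 z + be * P2 z, al * Q1 z + be * Q2 z,
                      ga * P1 z + de * P2 z, ga * Q1 z + de * Q2 z)).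
    assert (Wq := W q Hq). split.
    + assert (E : forall u v, (u * Q2 q - v * P2 q) * P1 q + (v * P1 q - u * Q1 q) * P2 q = u /\
                         (u * Q2 q - v * P2 q) * Q1 q + (v * P1 q - u * Q1 q) * Q2 q = v).
      { intros u v. split.
        - transitivity (u * (P1 q * Q2 q - P2 q * Q1 q)); [ring | rewrite Wq; ring].
        - transitivity (v * (P1 q * Q2 q - P2 q * Q1 q)); [ring | rewrite Wq; ring]. }
      unfold al, be, ga, de.
      destruct (E a b) as [-> ->]. destruct (E c d) as [-> ->]. reflexivity.
    + intros z Hz. split.
      * split; unfold ma, mb, mc, md; simpl; apply frame_solution_combination; now (apply S1 || apply S2).
      * unfold unimodular, ma, mb, mc, md; simpl.
        transitivity ((a * d - b * c) * (P1 q * Q2 q - P2 q * Q1 q) * (P1 z * Q2 z - P2 z * Q1 z)).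
        -- unfold al, be, ga, de. ring.
        -- rewrite Hs Wq (W z Hz). ring.
  - intros c' r' F G q q' HFG Hq Hq2 Hq' Hq2' E.
    assert (K : forall P Q P' Q' : R2 -> R,
      (forall z, ball p r z -> ball c' r' z -> fsol P Q z /\ fsol P' Q' z) ->
      P q = P' q -> Q q = Q' q -> P q' = P' q' /\ Q q' = Q' q').
    { intros P Q P' Q' HPQ EP EQ.
      assert (Wc : forall X Y P3 Q3, (forall z, ball p r z -> fsol X Y z) ->
         (forall z, ball p r z -> ball c' r' z -> fsol P3 Q3 z) ->
         X q * Q3 q - P3 q * Y q = X q' * Q3 q' - P3 q' * Y q').
      { intros X Y P3 Q3 HX H3.
        apply (partials_zero_constant p c' r r' (fun z => X z * Q3 z - P3 z * Y z)); auto.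
        intros z Hz Hz'. apply (wronskian_constant a1 b1 a2 b2 k l); [now apply HX | now apply H3]. }
      assert (w1 := Wc P1 Q1 P Q S1 (fun z h h' => proj1 (HPQ z h h'))).
      assert (w2 := Wc P2 Q2 P Q S2 (fun z h h' => proj1 (HPQ z h h'))).
      assert (w1' := Wc P1 Q1 P' Q' S1 (fun z h h' => proj2 (HPQ z h h'))).
      assert (w2' := Wc P2 Q2 P' Q' S2 (fun z h h' => proj2 (HPQ z h h'))).
      rewrite EP EQ in w1, w2. rewrite w1 in w1'. rewrite w2 in w2'.
      assert (Wq := W q' Hq'). split.
      - transitivity (P q' * (P1 q' * Q2 q' - P2 q' * Q1 q')); [rewrite Wq; ring|].
        transitivity (P' q' * (P1 q' * Q2 q' - P2 q' * Q1 q')); [|rewrite Wq; ring].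
        transitivity (P2 q' * (P1 q' * Q q' - P q' * Q1 q') - P1 q' * (P2 q' * Q q' - P q' * Q2 q')); [ring|].
        rewrite w1' w2'. ring.
      - transitivity (Q q' * (P1 q' * Q2 q' - P2 q' * Q1 q')); [rewrite Wq; ring|].
        transitivity (Q' q' * (P1 q' * Q2 q' - P2 q' * Q1 q')); [|rewrite Wq; ring].
        transitivity (Q2 q' * (P1 q' * Q q' - P q' * Q1 q') - Q1 q' * (P2 q' * Q q' - P q' * Q2 q')); [ring|].
        rewrite w1' w2'. ring. }
    destruct (K (fun z => ma (F z)) (fun z => mb (F z)) (fun z => ma (G z)) (fun z => mb (G z))) as [Ea Eb].
    { intros z Hz Hz'. destruct (HFG z Hz Hz') as [[] []]. now split. }
    { now rewrite E. } { now rewrite E. }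
    destruct (K (fun z => mc (F z)) (fun z => md (F z)) (fun z => mc (G z)) (fun z => md (G z))) as [Ec Ed].
    { intros z Hz Hz'. destruct (HFG z Hz Hz') as [[] []]. now split. }
    { now rewrite E. } { now rewrite E. }
    destruct (F q') as [[[? ?] ?] ?], (G q') as [[[? ?] ?] ?].
    unfold ma, mb, mc, md in *; simpl in *. congruence.
Qed.

Lemma unimodular_solution_exists p0 : simply_connected U -> U p0 ->
  exists A B C D : R2 -> R, forall q, U q ->
    A q * D q - B q * C q = 1 /\ fsol A B q /\ fsol C D q.
Proof.
  intros SC Hp.
  destruct (monodromy mat unimodular U matrix_solution good_ball_exists p0 (1, 0, 0, 1) SC) as (F & _ & HF).
  { unfold unimodular, ma, mb, mc, md; simpl. ring. }
  { exact Hp. }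
  exists (fun q => ma (F q)), (fun q => mb (F q)), (fun q => mc (F q)), (fun q => md (F q)).
  intros q Hq. destruct (HF q Hq) as (I & r & G & HG). split; [exact I|].
  destruct (HG q (ball_center q r)) as [_ [Sab Scd]].
  split.
  - apply frame_solution_ext_loc with (2 := Sab). exists r. intros z Hz.
    destruct (HG z Hz) as [-> _]. now split.
  - apply frame_solution_ext_loc with (2 := Scd). exists r. intros z Hz.
    destruct (HG z Hz) as [-> _]. now split.
Qed.

End GlobalFrame.

(** * Rank two *)

Lemma dot_nonneg v : 0 <= dot v v.
Proof. unfold dot. nra. Qed.

Lemma dot_eq0 v : dot v v = 0 -> v = (0, 0, 0).
Proof.
  destruct v as [[x y] z]. unfold dot, c1, c2, c3; simpl. intros H.
  assert (x = 0) by nra. assert (y = 0) by nra. assert (z = 0) by nra. now subst.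
Qed.

Definition linear_combination (a b : R) (v w : R3) : R3 :=
  (a * c1 v + b * c1 w, a * c2 v + b * c2 w, a * c3 v + b * c3 w).

Lemma linear_combination_1_0 v w : linear_combination 1 0 v w = v.
Proof. destruct v as [[x y] z]. unfold linear_combination, c1, c2, c3; simpl. f_equal; [f_equal|]; ring. Qed.

Lemma linear_combination_0_1 v w : linear_combination 0 1 v w = w.
Proof. destruct w as [[x y] z]. unfold linear_combination, c1, c2, c3; simpl. f_equal; [f_equal|]; ring. Qed.

(** If the Gram determinant of [v] and [w] vanishes, then so does the squared norm of
    [- <v, w> v + <v, v> w], and this is a relation between [v] and [w]. *)
Lemma gram_pos_of_independent (v w : R3) :
  (forall a b : R, linear_combination a b v w = (0, 0, 0) -> a = 0 /\ b = 0) ->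
  0 < dot (cross v w) (cross v w).
Proof.
  intros H. destruct (Rle_lt_or_eq_dec _ _ (dot_nonneg (cross v w))) as [h|h]; [exact h|exfalso].
  symmetry in h. rewrite dot_cross_cross in h.
  set (z := linear_combination (- dot v w) (dot v v) v w).
  assert (Z : dot z z = dot v v * (dot v v * dot w w - dot v w ^ 2)).
  { unfold z, linear_combination, dot, c1, c2, c3; simpl. ring. }
  rewrite h Rmult_0_r in Z. apply dot_eq0 in Z. destruct (H _ _ Z) as [_ E].
  apply dot_eq0 in E. destruct (H 1 0) as [A _]; [|lra].
  rewrite E. unfold linear_combination, c1, c2, c3; simpl. f_equal; [f_equal|]; ring.
Qed.

(** A basis of the image consists of combinations of the two partial derivatives, and its Gram
    determinant is a square times theirs. *)
Lemma rank_two_gram_pos (f : R2 -> R3) p : rank_two (diff_R3 f p) ->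
  0 < dot (cross (dx3 f p) (dy3 f p)) (cross (dx3 f p) (dy3 f p)).
Proof.
  intros (e1 & e2 & Hind & Himg).
  assert (X : forall a b : R, plus (scal a e1) (scal b e2) = linear_combination a b e1 e2)
    by reflexivity.
  destruct (proj2 (Himg e1)) as [v Hv].
  { exists 1, 0. rewrite X. symmetry. apply linear_combination_1_0. }
  destruct (proj2 (Himg e2)) as [w Hw].
  { exists 0, 1. rewrite X. symmetry. apply linear_combination_0_1. }
  assert (G : 0 < dot (cross e1 e2) (cross e1 e2)).
  { apply gram_pos_of_independent. intros a b E. apply Hind.
    rewrite X. exact E. }
  assert (E : dot (cross e1 e2) (cross e1 e2) = (fst v * snd w - snd v * fst w) ^ 2 *
     dot (cross (dx3 f p) (dy3 f p)) (cross (dx3 f p) (dy3 f p))).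
  { rewrite Hv Hw. unfold diff_R3, diff_R, dx3, dy3, dot, cross, c1, c2, c3; simpl. ring. }
  rewrite E in G.
  destruct (Rle_lt_or_eq_dec _ _ (dot_nonneg (cross (dx3 f p) (dy3 f p)))) as [h|h]; [exact h|].
  rewrite -h Rmult_0_r in G. lra.
Qed.

Lemma standard_basis_R2 (w : R2) : w = (fst w * 1 + snd w * 0, fst w * 0 + snd w * 1).
Proof. destruct w; simpl. f_equal; ring. Qed.

Lemma cramer_R2 (w : R2) (ux uy vx vy : R) : ux * vy - uy * vx <> 0 ->
  w = ((fst w * vy - snd w * uy) / (ux * vy - uy * vx) * ux
        + (snd w * ux - fst w * vx) / (ux * vy - uy * vx) * uy,
       (fst w * vy - snd w * uy) / (ux * vy - uy * vx) * vx
        + (snd w * ux - fst w * vx) / (ux * vy - uy * vx) * vy).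
Proof. intros H. destruct w; simpl. f_equal; field; exact H. Qed.

Lemma rank_two_of_jacobian (phi : R2 -> R2) p :
  dx (fun q => fst (phi q)) p * dy (fun q => snd (phi q)) p
    - dy (fun q => fst (phi q)) p * dx (fun q => snd (phi q)) p <> 0 ->
  rank_two (diff_R2 phi p).
Proof.
  intros HJ. exists ((1, 0) : R2), ((0, 1) : R2). split.
  - intros a b E. injection E as E1 E2.
    unfold plus, scal in E1, E2; simpl in E1, E2. unfold mult in E1, E2; simpl in E1, E2.
    unfold zero in E1, E2; simpl in E1, E2. lra.
  - intros w. split; intros _.
    + exists (fst (w : R2)), (snd (w : R2)). exact (standard_basis_R2 w).
    + set (ux := dx (fun q => fst (phi q)) p) in *. set (uy := dy (fun q => fst (phi q)) p) in *.
      set (vx := dx (fun q => snd (phi q)) p) in *. set (vy := dy (fun q => snd (phi q)) p) in *.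
      exists ((fst (w : R2) * vy - snd (w : R2) * uy) / (ux * vy - uy * vx),
              (snd (w : R2) * ux - fst (w : R2) * vx) / (ux * vy - uy * vx)).
      unfold diff_R2, diff_R; simpl. fold ux uy vx vy. now apply cramer_R2.
Qed.

Lemma partials_inv g p a b : g p <> 0 -> partials g p a b ->
  partials (fun q => / g q) p (a * - / (g p) ^ 2) (b * - / (g p) ^ 2).
Proof.
  intros Hg. apply partials_comp. auto_derive; [exact Hg|]. field. exact Hg.
Qed.

(** * The developing map *)

Section Developing.
Variables (U : R2 -> Prop) (a1 b1 a2 b2 k l A B C D : R2 -> R).
Hypotheses (HU : open U) (HS : structure_equations U a1 b1 a2 b2 k l).
Hypothesis HF : forall q, U q -> A q * D q - B q * C q = 1 /\
  frame_solution a1 b1 a2 b2 k l A B q /\ frame_solution a1 b1 a2 b2 k l C D q.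

(** The point [(A i + B) / (C i + D)] of the upper half-plane, when [A D - B C = 1]. *)
Definition developing (q : R2) : R2 :=
  ((A q * C q + B q * D q) * / (C q * C q + D q * D q), / (C q * C q + D q * D q)).

Let m q := C q * C q + D q * D q.

Lemma denominator_pos q : U q -> 0 < m q.
Proof.
  intros Hq. destruct (HF q Hq) as [W _]. unfold m.
  destruct (Req_dec (C q) 0) as [Z|Z]; [|nra].
  destruct (Req_dec (D q) 0) as [Z'|Z']; [|nra].
  rewrite Z Z' in W. lra.
Qed.

(** The real part of [(u + i v) / (C i + D)^2]. *)
Let re (u v : R2 -> R) q := ((D q * D q - C q * C q) * u q + (2 * C q * D q) * v q) * / (m q * m q).

(** The homography maps tangent vectors at [i] by [z -> z / (C i + D)^2], hence
    [d phi = (w1 + i w2) / (C i + D)^2]: the connection form has disappeared, and the partial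
    derivatives of the developing map are of class C1. *)
Lemma developing_partials q : U q ->
  partials (fun q => fst (developing q)) q (re a1 a2 q) (re b1 b2 q) /\
  partials (fun q => snd (developing q)) q (re a2 (fun q => - a1 q) q) (re b2 (fun q => - b1 q) q).
Proof.
  intros Hq. destruct (HF q Hq) as (W & (_ & _ & DA & DB) & (_ & _ & DC & DD)).
  assert (m0 := Rgt_not_eq _ _ (denominator_pos q Hq)).
  assert (Dm := partials_plus _ _ q _ _ _ _ (partials_mult _ _ q _ _ _ _ DC DC) (partials_mult _ _ q _ _ _ _ DD DD)).
  assert (Di := partials_inv _ q _ _ m0 Dm).
  assert (Dn := partials_plus _ _ q _ _ _ _ (partials_mult _ _ q _ _ _ _ DA DC) (partials_mult _ _ q _ _ _ _ DB DD)).
  unfold developing; simpl. unfold m in m0. split.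
  - eapply partials_eq; [apply (partials_mult _ _ q _ _ _ _ Dn Di)| |]; unfold re, m.
    + transitivity ((A q * D q - B q * C q) * (((D q * D q - C q * C q) * a1 q + (2 * C q * D q) * a2 q)
        * / ((C q * C q + D q * D q) * (C q * C q + D q * D q)))); [field; exact m0 | rewrite W; ring].
    + transitivity ((A q * D q - B q * C q) * (((D q * D q - C q * C q) * b1 q + (2 * C q * D q) * b2 q)
        * / ((C q * C q + D q * D q) * (C q * C q + D q * D q)))); [field; exact m0 | rewrite W; ring].
  - eapply partials_eq; [exact Di| |]; unfold re, m; field; exact m0.
Qed.

Lemma developing_coefficient_C1 u v : C1_on U u -> C1_on U v -> C1_on U (re u v).
Proof.
  intros Hu Hv.
  assert (CC : forall q, U q -> continuous C q) by (intros q Hq; apply (HF q Hq)).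
  assert (CD : forall q, U q -> continuous D q) by (intros q Hq; apply (HF q Hq)).
  assert (Ck := se_k _ _ _ _ _ _ _ HS). assert (Cl := se_l _ _ _ _ _ _ _ HS).
  assert (Ca1 := fun q Hq => C1_continuous U a1 q HU (se_a1 _ _ _ _ _ _ _ HS) Hq).
  assert (Cb1 := fun q Hq => C1_continuous U b1 q HU (se_b1 _ _ _ _ _ _ _ HS) Hq).
  assert (Ca2 := fun q Hq => C1_continuous U a2 q HU (se_a2 _ _ _ _ _ _ _ HS) Hq).
  assert (Cb2 := fun q Hq => C1_continuous U b2 q HU (se_b2 _ _ _ _ _ _ _ HS) Hq).
  assert (C1C : C1_on U C).
  { eapply C1_intro; [exact HU | intros q Hq; apply (HF q Hq)| |]; intros q Hq; simpl;
    apply: continuous_mult; try apply continuous_const;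
    apply: continuous_plus; apply: continuous_mult; auto; apply: continuous_minus; auto. }
  assert (C1D : C1_on U D).
  { eapply C1_intro; [exact HU | intros q Hq; apply (HF q Hq)| |]; intros q Hq; simpl;
    apply: continuous_mult; try apply continuous_const;
    apply: continuous_minus; apply: continuous_mult; auto; apply: continuous_plus; auto. }
  assert (C1m : C1_on U m) by (apply C1_plus; auto; now apply C1_mult).
  apply C1_mult; auto; [apply C1_plus; auto; apply C1_mult; auto|].
  - apply C1_minus; auto; now apply C1_mult.
  - apply C1_mult; auto. apply C1_mult; auto. now apply C1_const.
  - apply C1_inv; auto; [|now apply C1_mult]. intros q Hq.
    assert (h := denominator_pos q Hq). apply Rgt_not_eq. now apply Rmult_lt_0_compat.
Qed.

Lemma developing_Ck : Ck_R2 2 U developing.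
Proof.
  assert (Ca1 := se_a1 _ _ _ _ _ _ _ HS). assert (Cb1 := se_b1 _ _ _ _ _ _ _ HS).
  assert (Ca2 := se_a2 _ _ _ _ _ _ _ HS). assert (Cb2 := se_b2 _ _ _ _ _ _ _ HS).
  assert (A' : forall (g u v u' v' : R2 -> R), C1_on U u -> C1_on U v -> C1_on U u' -> C1_on U v' ->
    (forall q, U q -> partials g q (re u v q) (re u' v' q)) -> Ck 2 U g).
  { intros g u v u' v' Hu Hv Hu' Hv' Hg.
    assert (Ruv := developing_coefficient_C1 u v Hu Hv).
    assert (Ruv' := developing_coefficient_C1 u' v' Hu' Hv').
    assert (C1g : C1_on U g).
    { apply (C1_intro U g (re u v) (re u' v')); auto; intros; now apply (C1_continuous U). }
    apply Ck_S_intro; auto; apply C1_Ck; auto.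
    - apply C1_ext with (re u v); auto. intros q Hq. symmetry. exact (partials_dx _ _ _ _ (Hg q Hq)).
    - apply C1_ext with (re u' v'); auto. intros q Hq. symmetry. exact (partials_dy _ _ _ _ (Hg q Hq)). }
  split.
  - apply (A' _ a1 a2 b1 b2); auto. intros q Hq. now apply developing_partials.
  - apply (A' _ a2 (fun q => - a1 q) b2 (fun q => - b1 q)); auto; try now apply C1_opp.
    intros q Hq. now apply developing_partials.
Qed.

Lemma developing_pullback q v w : U q ->
  pullback_R2 developing H2_metric q v w =
  (fst v * a1 q + snd v * b1 q) * (fst w * a1 q + snd w * b1 q) +
  (fst v * a2 q + snd v * b2 q) * (fst w * a2 q + snd w * b2 q).
Proof.
  intros Hq. destruct (developing_partials q Hq) as [Du Dv].
  assert (m0 := Rgt_not_eq _ _ (denominator_pos q Hq)).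
  unfold pullback_R2, H2_metric, diff_R2, diff_R. simpl fst. simpl snd.
  rewrite (partials_dx _ _ _ _ Du) (partials_dy _ _ _ _ Du)
          (partials_dx _ _ _ _ Dv) (partials_dy _ _ _ _ Dv).
  unfold re, m. unfold m in m0. field. exact m0.
Qed.

Lemma developing_jacobian q : U q ->
  dx (fun q => fst (developing q)) q * dy (fun q => snd (developing q)) q
    - dy (fun q => fst (developing q)) q * dx (fun q => snd (developing q)) q
  = (a1 q * b2 q - a2 q * b1 q) * / (m q * m q).
Proof.
  intros Hq. destruct (developing_partials q Hq) as [Du Dv].
  assert (m0 := Rgt_not_eq _ _ (denominator_pos q Hq)).
  rewrite (partials_dx _ _ _ _ Du) (partials_dy _ _ _ _ Du)
          (partials_dx _ _ _ _ Dv) (partials_dy _ _ _ _ Dv).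
  unfold re, m. unfold m in m0. field. exact m0.
Qed.

Lemma developing_immersion : (forall q, U q -> a1 q * b2 q - a2 q * b1 q <> 0) ->
  immersion_R2 1 U developing.
Proof.
  intros HW. split.
  - destruct developing_Ck as [Hu Hv]. split; apply (Ck_le U 1 2); auto.
  - intros q Hq. apply rank_two_of_jacobian. rewrite developing_jacobian //.
    assert (m0 := Rgt_not_eq _ _ (denominator_pos q Hq)).
    apply Rmult_integral_contrapositive_currified; [now apply HW|].
    now apply Rinv_neq_0_compat, Rmult_integral_contrapositive_currified.
Qed.

End Developing.

Theorem theorem1p1 (Omega : R2 -> Prop) (n : nat) (f : R2 -> R3)
    (Omega_open : open Omega)
    (Omega_sc : simply_connected Omega)
    (n_ge2 : (2 <= n)%nat)
    (f_imm : immersion_R3 n Omega f)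
    (f_curv : forall p, Omega p -> gauss_curvature f p = -1) :
  exists phi : R2 -> R2,
    Ck_R2 2 Omega phi /\
    isometry Omega (pullback_R3 f euclidean_metric) H2 H2_metric phi.
Proof.
  destruct f_imm as [(F1 & F2 & F3) f_rank].
  destruct (Classical_Prop.classic (exists p0, Omega p0)) as [[p0 Hp0]|Hempty].
  - assert (HG : forall p, Omega p -> 0 < dot (cross (dx3 f p) (dy3 f p)) (cross (dx3 f p) (dy3 f p))).
    { intros p Hp. now apply rank_two_gram_pos, f_rank. }
    destruct (moving_frame Omega f Omega_open) as (a1 & b1 & a2 & b2 & k & l & HS & HM); auto.
    { split; [|split]; now apply Ck_le with n. }
    destruct (unimodular_solution_exists Omega a1 b1 a2 b2 k l Omega_open HS p0 Omega_sc Hp0)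
      as (A & B & C & D & HF).
    exists (developing A B C D).
    split; [now apply (developing_Ck Omega a1 b1 a2 b2 k l)|].
    split; [|split].
    + intros p Hp. unfold H2, developing; simpl. apply Rinv_0_lt_compat.
      now apply (denominator_pos Omega a1 b1 a2 b2 k l A B C D).
    + apply (developing_immersion Omega a1 b1 a2 b2 k l); auto. intros p Hp Z.
      specialize (HG p Hp). rewrite dot_cross_cross in HG.
      destruct (HM p Hp) as (-> & -> & ->) in HG.
      assert (E : (a1 p * b2 p - a2 p * b1 p) ^ 2 > 0) by (ring_simplify; ring_simplify in HG; lra).
      rewrite Z in E. lra.
    + intros p Hp v w. rewrite (developing_pullback Omega a1 b1 a2 b2 k l) //.
      destruct (HM p Hp) as (E & F & G).
      transitivity (fst v * fst w * (a1 p * a1 p + a2 p * a2 p)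
        + (fst v * snd w + snd v * fst w) * (a1 p * b1 p + a2 p * b2 p)
        + snd v * snd w * (b1 p * b1 p + b2 p * b2 p)); [ring|].
      rewrite -E -F -G. unfold pullback_R3, euclidean_metric, diff_R3, diff_R, dot, dx3, dy3, c1, c2, c3; simpl. ring.
  - exists (fun q => q). assert (V : forall p, ~ Omega p) by (intros p Hp; apply Hempty; now exists p).
    split; [|split; [|split; [split|]]].
    + split; intros x y Hp; now destruct (V (x, y)).
    + intros p Hp; now destruct (V p).
    + split; intros x y Hp; now destruct (V (x, y)).
    + intros p Hp; now destruct (V p).
    + intros p Hp; now destruct (V p).
Qed.
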